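(* Let $\mathbb B$ be a double category, $H:\mathbb B\times\mathbb B\to\mathbb B$ a pseudodouble quasi-functor with trivial structure 2-cells $H(U,u)$, and $\otimes=\mathcal F(H):\mathbb B\times\mathbb B\to\mathbb B$ the pseudodouble functor corresponding to it under the double category equivalence $\mathcal F:q\text{-}\mathrm{Ps}^{st}_{hop}(\mathbb B\times\mathbb B,\mathbb B)\to\mathrm{Ps}_{hop}(\mathbb B\times\mathbb B,\mathbb B)$. Let $\theta$ be an associativity for $H$, i.e. an invertible vertical strict transformation between the ternary pseudodouble quasi-functors $H(H\times1)$ and $H(1\times H)$, and let $\Sigma$ be the vertical strict transformation between $\otimes(\otimes\times1)$ and $\otimes(1\times\otimes)$ corresponding to $\theta$ under the induced equivalence between ternary quasi-functors and pseudodouble functors on $\mathbb B\times\mathbb B\times\mathbb B$. Then: 1. $\theta$ obeys the 24 axioms, which are indeed 12 axioms; 2. $(\mathbb B,H,\theta,I)$ is a purely central premonoidal double category (with trivial structure 2-cells $H(U,u)$) if and only if $(\mathbb B,\otimes,\Sigma,I)$ is a monoidal double category.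
   Context: Double categories are strict: objects, 1h-cells (horizontal), 1v-cells (vertical), squares (2-cells). $[a|b]$: horizontal composition ($a$ left); $a/b$: vertical composition ($a$ on top), also for 1v-cells and transformations. Pseudodouble functors preserve vertical structure strictly and horizontal composition up to coherent natural invertible compositors/unitors $F_{gf},F_A$. A horizontal pseudonatural transformation $\alpha:F\Rightarrow G$ has 1h-components, squares $\alpha^u$ (top $\alpha(A)$, bottom $\alpha(\tilde A)$, left $F(u)$, right $G(u)$) and invertible horizontally globular 2-cells $\alpha(B)F(f)\Rightarrow G(f)\alpha(A)$, coherent and natural. A vertical pseudonatural transformation has 1v-components, squares $\alpha_f$ (top $F(f)$, bottom $G(f)$) and horizontally invertible vertically globular 2-cells between $\alpha(A)/G(u)$ and $F(u)/\alpha(\tilde A)$, coherent and natural; strict if these are identities, and then invertible if all $\alpha_f$ are vertically invertible. Pseudodouble quasi-functor $H:\mathbb B\times\mathbb B\to\mathbb B$ with trivial $H(U,u)$: pseudodouble functors $H(A,-)$, $H(-,B)$ agreeing on objects; for 1h-cells $K:A\to A'$, $k:B\to B'$ and 1v-cells $U:A\to\tilde A$, $u:B\to\tilde B$, invertible horizontally globular $H(K,k):H(K,B')H(A,k)\Rightarrow H(A',k)H(K,B)$, squares $H(K,u)$ (top $H(K,B)$, bottom $H(K,\tilde B)$, left $H(A,u)$, right $H(A',u)$), $H(U,k)$ (top $H(A,k)$, bottom $H(\tilde A,k)$, left $H(U,B)$, right $H(U,B')$), and $H(U,B)/H(\tilde A,u)=H(A,u)/H(U,\tilde B)$; such that for each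 1-cell in one variable the resulting cells form a horizontal (for a 1h-cell) or vertical strict (for a 1v-cell) pseudonatural transformation between the corresponding functors in the other variable, and for each 2-cell in one variable they form a modification. $\otimes=\mathcal F(H)$: $A\otimes B=H(A,B)$; for a pair of 2-cells $\sigma$ (top $K:A\to A'$, bottom $\tilde K$, left $U$, right $U'$) and $\delta$ (top $k:B\to B'$, bottom $\tilde k$, left $u$, right $u'$), $\sigma\otimes\delta=[H(\sigma,B)/H(\tilde K,u)\;|\;H(U',k)/H(\tilde A',\delta)]$, so $K\otimes k=H(A',k)H(K,B)$, $U\otimes u=H(U,B)/H(\tilde A,u)$; compositor $[\mathrm{Id}|H(K',k)|\mathrm{Id}]/[H(-,B)_{K'K}|H(A'',-)_{k'k}]$ and unitor $[H(-,B)_A|H(A,-)_B]$. This is part of a double category equivalence between such quasi-functors (with horizontal oplax and vertical lax transformations, modifications) and pseudodouble functors $\mathbb B\times\mathbb B\to\mathbb B$. Ternary quasi-functors consist of binary quasi-functors in every two of the three variables, agreeing on one-variable functors, whose exchange cells satisfy the commuting-cube condition for every triple of 1-cells; $H(H\times1)$ and $H(1\times H)$ are such. A vertical strict transformation $\theta$ between ternary quasi-functors consists of three one-variable families of vertical strict transformations agreeing on objects and compatible with the exchange cells of both quasi-functors. The category of ternary quasi-functors with trivial vertical-vertical cells and vertical strict transformations is equivalent to that of pseudodouble functors $\mathbb B^3\to\mathbb B$ and vertical strict transformations, extending $\mathcal F$. The three families constituting $\theta$ are denoted $\alpha_{-,B,C},\alpha_{A,-,C},\alpha_{A,B,-}$.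 $H$ induces a binoidal structure $A\ltimes-=H(A,-)$, $-\rtimes B=H(-,B)$ with $A\ltimes B=A\rtimes B=:A\bowtie B$ $(=AB)$, in which every 1-cell is left central (via $p\ltimes-$) and right central (via $-\rtimes p$) with $K\ltimes-|_k=H(K,k)=(-\rtimes k|_K)^{-1}$, $K\ltimes-|_u=-\rtimes u|_K=H(K,u)$, $U\ltimes-|_k=-\rtimes k|_U=H(U,k)$, $U\ltimes-|_u$ trivial; such a binoidal double category is called purely central. Here a 1h-cell (1v-cell) $p:A\to A'$ is left central via a horizontal (vertical) pseudonatural transformation $p\ltimes-:A\ltimes-\Rightarrow A'\ltimes-$ with $p\ltimes B=p\rtimes B$, right central via $-\rtimes p$ with $B\rtimes p=B\ltimes p$; an invertible 1v-cell is inversely central if it and its inverse are central (left and right) with mutually inverse components at 1h-cells. Premonoidal: there are an object $I$ and invertible vertical strict transformations $\lambda:I\ltimes-\Rightarrow\mathrm{Id}$, $\rho:-\rtimes I\Rightarrow\mathrm{Id}$, and $\alpha_{-,B,C}:(-\rtimes B)\rtimes C\Rightarrow-\rtimes(B\bowtie C)$, $\alpha_{A,-,C}:(A\ltimes-)\rtimes C\Rightarrow A\ltimes(-\rtimes C)$, $\alpha_{A,B,-}:(A\bowtie B)\ltimes-\Rightarrow A\ltimes(B\ltimes-)$, with inversely central 1v-components, the three $\alpha$'s having common 1v-components, satisfying the pentagon $\alpha_{W,X,Y}Z/\alpha_{W,XY,Z}/W\alpha_{X,Y,Z}=\alpha_{WX,Y,Z}/\alpha_{W,X,YZ}$ in each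 variable and $\alpha_{W,I,Y}/W\lambda_Y=\rho_WY$, $\alpha_{I,W,Y}/\lambda_{WY}=\lambda_WY$, $\alpha_{W,Y,I}/W\rho_Y=\rho_{WY}$ in each of $W,Y$. Monoidal double category: pseudodouble functors $\otimes$, $I:*\to\mathbb B$ with invertible vertical strict associativity and unit transformations satisfying the pentagon and the three unit triangles strictly. The 24 axioms: for 1-cells $p,q$ (each horizontal or vertical) in slots $i<j$ of a triple product (fixed object in the third), the pasting of the source exchange cell $E^s$ above the components of $\alpha$ at $p,q$ equals the pasting of the components of $\alpha$ at $p,q$ above the target exchange cell $E^t$, where for $(i,j)=(1,2),(1,3),(2,3)$, left version: $E^s=(p\ltimes-|_q)\rtimes C$, $(p\rtimes B)\ltimes-|_q$, $(A\ltimes p)\ltimes-|_q$, $E^t=p\ltimes-|_{q\rtimes C}$, $p\ltimes-|_{B\ltimes q}$, $A\ltimes(p\ltimes-|_q)$; right version: $E^s=(-\rtimes q|_p)\rtimes C$, $-\rtimes q|_{p\rtimes B}$, $-\rtimes q|_{A\ltimes p}$, $E^t=-\rtimes(q\rtimes C)|_p$, $-\rtimes(B\ltimes q)|_p$, $A\ltimes(-\rtimes q|_p)$ (functors applied to globular cells being conjugated by compositors). ''Indeed 12'': the left and right versions coincide. *)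

(* Defs.v *)
From Stdlib Require Import ClassicalEpsilon.

Set Implicit Arguments.
Unset Strict Implicit.
Unset Printing Implicit Defensive.

(** Cells of each kind form one type, with boundary maps, and the partial
    compositions are total functions whose values on non-composable pairs are
    unconstrained: every law below is guarded by composability (or only involves
    composable cells).  This way the strict laws of a double category are plain
    equalities, without transport along equalities of boundaries.

    Structures (double categories, functors, transformations, ...) are split
    into a record of data and a predicate stating the axioms.

    All compositions are written in diagrammatic order: [f ;; g] is the 1h-cell
    gf, [u // v] is u/v, [a <|> b] is [a|b] and [a </> b] is a/b. *)

Record dcat : Type := DCat {
  ob : Type;
  hc : Type;
  vc : Type;
  sq : Type;
  hs : hc -> ob;
  ht : hc -> ob;
  vs : vc -> ob;
  vt : vc -> ob;
  top : sq -> hc;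
  bot : sq -> hc;
  lft : sq -> vc;
  rgt : sq -> vc;
  hid : ob -> hc;
  vid : ob -> vc;
  hcomp : hc -> hc -> hc;
  vcomp : vc -> vc -> vc;
  sidh : hc -> sq; (* vertical identity square on a 1h-cell *)
  sidv : vc -> sq; (* horizontal identity square on a 1v-cell *)
  shc : sq -> sq -> sq;
  svc : sq -> sq -> sq
}.

Notation "f ;; g" := (hcomp f g) (at level 40, left associativity).
Notation "u // v" := (vcomp u v) (at level 40, left associativity).
Notation "a <|> b" := (shc a b) (at level 42, left associativity).
Notation "a </> b" := (svc a b) (at level 45, left associativity).

Record is_double_category (B : dcat) : Prop := {
  dc_tl : forall a : sq B, hs (top a) = vs (lft a);
  dc_tr : forall a : sq B, ht (top a) = vs (rgt a);
  dc_bl : forall a : sq B, hs (bot a) = vt (lft a);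
  dc_br : forall a : sq B, ht (bot a) = vt (rgt a);
  dc_hid : forall A : ob B, hs (hid A) = A /\ ht (hid A) = A;
  dc_vid : forall A : ob B, vs (vid A) = A /\ vt (vid A) = A;
  dc_hcomp : forall f g : hc B, ht f = hs g ->
    hs (f ;; g) = hs f /\ ht (f ;; g) = ht g;
  dc_vcomp : forall u v : vc B, vt u = vs v ->
    vs (u // v) = vs u /\ vt (u // v) = vt v;
  dc_hassoc : forall f g h : hc B, ht f = hs g -> ht g = hs h ->
    f ;; (g ;; h) = f ;; g ;; h;
  dc_vassoc : forall u v w : vc B, vt u = vs v -> vt v = vs w ->
    u // (v // w) = u // v // w;
  dc_hunitl : forall f : hc B, hid (hs f) ;; f = f;
  dc_hunitr : forall f : hc B, f ;; hid (ht f) = f;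
  dc_vunitl : forall u : vc B, vid (vs u) // u = u;
  dc_vunitr : forall u : vc B, u // vid (vt u) = u;
  dc_sidh : forall f : hc B,
    top (sidh f) = f /\ bot (sidh f) = f /\
    lft (sidh f) = vid (hs f) /\ rgt (sidh f) = vid (ht f);
  dc_sidv : forall u : vc B,
    top (sidv u) = hid (vs u) /\ bot (sidv u) = hid (vt u) /\
    lft (sidv u) = u /\ rgt (sidv u) = u;
  dc_shc : forall a b : sq B, rgt a = lft b ->
    top (a <|> b) = top a ;; top b /\ bot (a <|> b) = bot a ;; bot b /\
    lft (a <|> b) = lft a /\ rgt (a <|> b) = rgt b;
  dc_svc : forall a b : sq B, bot a = top b ->
    top (a </> b) = top a /\ bot (a </> b) = bot b /\
    lft (a </> b) = lft a // lft b /\ rgt (a </> b) = rgt a // rgt b;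
  dc_shassoc : forall a b c : sq B, rgt a = lft b -> rgt b = lft c ->
    a <|> (b <|> c) = a <|> b <|> c;
  dc_svassoc : forall a b c : sq B, bot a = top b -> bot b = top c ->
    a </> (b </> c) = a </> b </> c;
  dc_shunitl : forall a : sq B, sidv (lft a) <|> a = a;
  dc_shunitr : forall a : sq B, a <|> sidv (rgt a) = a;
  dc_svunitl : forall a : sq B, sidh (top a) </> a = a;
  dc_svunitr : forall a : sq B, a </> sidh (bot a) = a;
  dc_interchange : forall a b c d : sq B,
    rgt a = lft b -> rgt c = lft d -> bot a = top c -> bot b = top d ->
    (a <|> b) </> (c <|> d) = (a </> c) <|> (b </> d);
  dc_sidh_comp : forall f g : hc B, ht f = hs g ->
    sidh f <|> sidh g = sidh (f ;; g);
  dc_sidv_comp : forall u v : vc B, vt u = vs v ->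
    sidv u </> sidv v = sidv (u // v);
  dc_sid_id : forall A : ob B, sidh (hid A) = sidv (vid A)
}.

Definition framed (B : dcat) (t b : hc B) (l r : vc B) (a : sq B) : Prop :=
  top a = t /\ bot a = b /\ lft a = l /\ rgt a = r.

Definition hglob (B : dcat) (t b : hc B) (a : sq B) : Prop :=
  framed t b (vid (hs t)) (vid (ht t)) a.

Definition vglob (B : dcat) (l r : vc B) (a : sq B) : Prop :=
  framed (hid (vs l)) (hid (vt l)) l r a.

Definition vinverse (B : dcat) (a b : sq B) : Prop :=
  top b = bot a /\ bot b = top a /\
  a </> b = sidh (top a) /\ b </> a = sidh (bot a).

Definition hinverse (B : dcat) (a b : sq B) : Prop :=
  lft b = rgt a /\ rgt b = lft a /\
  a <|> b = sidv (lft a) /\ b <|> a = sidv (rgt a).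

(* the vertical inverse of a square, arbitrary if there is none *)
Definition vinv (B : dcat) (a : sq B) : sq B :=
  epsilon (inhabits a) (vinverse a).

Definition dprod (A B : dcat) : dcat := {|
  ob := ob A * ob B;
  hc := hc A * hc B;
  vc := vc A * vc B;
  sq := sq A * sq B;
  hs f := (hs (fst f), hs (snd f));
  ht f := (ht (fst f), ht (snd f));
  vs u := (vs (fst u), vs (snd u));
  vt u := (vt (fst u), vt (snd u));
  top a := (top (fst a), top (snd a));
  bot a := (bot (fst a), bot (snd a));
  lft a := (lft (fst a), lft (snd a));
  rgt a := (rgt (fst a), rgt (snd a));
  hid X := (hid (fst X), hid (snd X));
  vid X := (vid (fst X), vid (snd X));
  hcomp f g := (fst f ;; fst g, snd f ;; snd g);
  vcomp u v := (fst u // fst v, snd u // snd v);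
  sidh f := (sidh (fst f), sidh (snd f));
  sidv u := (sidv (fst u), sidv (snd u));
  shc a b := (fst a <|> fst b, snd a <|> snd b);
  svc a b := (fst a </> fst b, snd a </> snd b)
|}.

Definition dunit : dcat := {|
  ob := unit; hc := unit; vc := unit; sq := unit;
  hs _ := tt; ht _ := tt; vs _ := tt; vt _ := tt;
  top _ := tt; bot _ := tt; lft _ := tt; rgt _ := tt;
  hid _ := tt; vid _ := tt;
  hcomp _ _ := tt; vcomp _ _ := tt;
  sidh _ := tt; sidv _ := tt;
  shc _ _ := tt; svc _ _ := tt
|}.

(** * Pseudodouble functors *)

(* [fcomp F f g] is the compositor F(g)F(f) => F(gf),
   [funit F A] the unitor id_{F A} => F(id_A). *)
Record psf (A B : dcat) : Type := Psf {
  fo : ob A -> ob B;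
  fh : hc A -> hc B;
  fv : vc A -> vc B;
  fs : sq A -> sq B;
  fcomp : hc A -> hc A -> sq B;
  funit : ob A -> sq B
}.

Record is_psf (A B : dcat) (F : psf A B) : Prop := {
  psf_h : forall f, hs (fh F f) = fo F (hs f) /\ ht (fh F f) = fo F (ht f);
  psf_v : forall u, vs (fv F u) = fo F (vs u) /\ vt (fv F u) = fo F (vt u);
  psf_s : forall a,
    framed (fh F (top a)) (fh F (bot a)) (fv F (lft a)) (fv F (rgt a)) (fs F a);
  psf_vid : forall X, fv F (vid X) = vid (fo F X);
  psf_vcomp : forall u v, vt u = vs v -> fv F (u // v) = fv F u // fv F v;
  psf_sidh : forall f, fs F (sidh f) = sidh (fh F f);
  psf_svc : forall a b, bot a = top b -> fs F (a </> b) = fs F a </> fs F b;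
  psf_fcomp : forall f g, ht f = hs g ->
    hglob (fh F f ;; fh F g) (fh F (f ;; g)) (fcomp F f g) /\
    exists b, vinverse (fcomp F f g) b;
  psf_funit : forall X,
    hglob (hid (fo F X)) (fh F (hid X)) (funit F X) /\
    exists b, vinverse (funit F X) b;
  psf_fcomp_nat : forall a b, rgt a = lft b ->
    (fs F a <|> fs F b) </> fcomp F (bot a) (bot b)
    = fcomp F (top a) (top b) </> fs F (a <|> b);
  psf_funit_nat : forall u,
    sidv (fv F u) </> funit F (vt u) = funit F (vs u) </> fs F (sidv u);
  psf_assoc : forall f g h, ht f = hs g -> ht g = hs h ->
    (fcomp F f g <|> sidh (fh F h)) </> fcomp F (f ;; g) h
    = (sidh (fh F f) <|> fcomp F g h) </> fcomp F f (g ;; h);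
  psf_unitl : forall f,
    (funit F (hs f) <|> sidh (fh F f)) </> fcomp F (hid (hs f)) f
    = sidh (fh F f);
  psf_unitr : forall f,
    (sidh (fh F f) <|> funit F (ht f)) </> fcomp F f (hid (ht f))
    = sidh (fh F f)
}.

(* a strict double functor, with identity compositors and unitors *)
Definition psf_strict (A B : dcat) (o : ob A -> ob B) (h : hc A -> hc B)
    (v : vc A -> vc B) (s : sq A -> sq B) : psf A B :=
  Psf o h v s (fun f g => sidh (h f ;; h g)) (fun X => sidh (hid (o X))).

Definition psf_id (A : dcat) : psf A A :=
  psf_strict (fun X : ob A => X) (fun f : hc A => f)
             (fun u : vc A => u) (fun a : sq A => a).

(* [psf_comp F G] is F followed by G *)
Definition psf_comp (A B C : dcat) (F : psf A B) (G : psf B C) : psf A C := {|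
  fo X := fo G (fo F X);
  fh f := fh G (fh F f);
  fv u := fv G (fv F u);
  fs a := fs G (fs F a);
  fcomp f g := fcomp G (fh F f) (fh F g) </> fs G (fcomp F f g);
  funit X := funit G (fo F X) </> fs G (funit F X)
|}.

Definition psf_prod (A B C D : dcat) (F : psf A C) (G : psf B D) :
    psf (dprod A B) (dprod C D) :=
  @Psf (dprod A B) (dprod C D)
    (fun X => (fo F (fst X), fo G (snd X)))
    (fun f => (fh F (fst f), fh G (snd f)))
    (fun u => (fv F (fst u), fv G (snd u)))
    (fun a => (fs F (fst a), fs G (snd a)))
    (fun f g => (fcomp F (fst f) (fst g), fcomp G (snd f) (snd g)))
    (fun X => (funit F (fst X), funit G (snd X))).

Definition psf_assoc_iso (A B C : dcat) :
    psf (dprod (dprod A B) C) (dprod A (dprod B C)) :=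
  @psf_strict (dprod (dprod A B) C) (dprod A (dprod B C))
    (fun X => (fst (fst X), (snd (fst X), snd X)))
    (fun f => (fst (fst f), (snd (fst f), snd f)))
    (fun u => (fst (fst u), (snd (fst u), snd u)))
    (fun a => (fst (fst a), (snd (fst a), snd a))).

Definition psf_lunit_iso (A : dcat) : psf A (dprod dunit A) :=
  @psf_strict A (dprod dunit A)
    (fun X => (tt, X)) (fun f => (tt, f)) (fun u => (tt, u)) (fun a => (tt, a)).

Definition psf_runit_iso (A : dcat) : psf A (dprod A dunit) :=
  @psf_strict A (dprod A dunit)
    (fun X => (X, tt)) (fun f => (f, tt)) (fun u => (u, tt)) (fun a => (a, tt)).

(** * Transformations *)

(* Horizontal pseudonatural transformations: [htv al u] is the square al^u and
   [hth al f] the globular cell al(B)F(f) => G(f)al(A). *)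
Record hpt (A B : dcat) : Type := Hpt {
  hto : ob A -> hc B;
  htv : vc A -> sq B;
  hth : hc A -> sq B
}.

Record is_hpt (A B : dcat) (F G : psf A B) (al : hpt A B) : Prop := {
  hpt_o : forall X, hs (hto al X) = fo F X /\ ht (hto al X) = fo G X;
  hpt_v : forall u,
    framed (hto al (vs u)) (hto al (vt u)) (fv F u) (fv G u) (htv al u);
  hpt_h : forall f,
    hglob (fh F f ;; hto al (ht f)) (hto al (hs f) ;; fh G f) (hth al f) /\
    exists b, vinverse (hth al f) b;
  hpt_vcomp : forall u v, vt u = vs v -> htv al (u // v) = htv al u </> htv al v;
  hpt_vid : forall X, htv al (vid X) = sidh (hto al X);
  hpt_hcomp : forall f g, ht f = hs g ->
    (fcomp F f g <|> sidh (hto al (ht g))) </> hth al (f ;; g)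
    = (sidh (fh F f) <|> hth al g) </> (hth al f <|> sidh (fh G g))
      </> (sidh (hto al (hs f)) <|> fcomp G f g);
  hpt_hid : forall X,
    (funit F X <|> sidh (hto al X)) </> hth al (hid X)
    = sidh (hto al X) <|> funit G X;
  hpt_nat : forall a,
    (fs F a <|> htv al (rgt a)) </> hth al (bot a)
    = hth al (top a) </> (htv al (lft a) <|> fs G a)
}.

(* Vertical pseudonatural transformations: [vth al f] is the square al_f and
   [vtv al u] the globular cell from al(A)/G(u) to F(u)/al(A~). *)
Record vpt (A B : dcat) : Type := Vpt {
  pto : ob A -> vc B;
  pth : hc A -> sq B;
  ptv : vc A -> sq B
}.

Record is_vpt (A B : dcat) (F G : psf A B) (al : vpt A B) : Prop := {
  vpt_o : forall X, vs (pto al X) = fo F X /\ vt (pto al X) = fo G X;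
  vpt_h : forall f,
    framed (fh F f) (fh G f) (pto al (hs f)) (pto al (ht f)) (pth al f);
  vpt_v : forall u,
    vglob (pto al (vs u) // fv G u) (fv F u // pto al (vt u)) (ptv al u) /\
    exists b, hinverse (ptv al u) b;
  vpt_hcomp : forall f g, ht f = hs g ->
    (pth al f <|> pth al g) </> fcomp G f g = fcomp F f g </> pth al (f ;; g);
  vpt_hid : forall X,
    sidv (pto al X) </> funit G X = funit F X </> pth al (hid X);
  vpt_vcomp : forall u v, vt u = vs v ->
    ptv al (u // v)
    = (ptv al u </> sidv (fv G v)) <|> (sidv (fv F u) </> ptv al v);
  vpt_vid : forall X, ptv al (vid X) = sidv (pto al X);
  vpt_nat : forall a,
    ptv al (lft a) <|> (fs F a </> pth al (bot a))
    = (pth al (top a) </> fs G a) <|> ptv al (rgt a)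
}.

(* Vertical strict transformations: the globular cells are identities, and are
   not part of the data. *)
Record vst (A B : dcat) : Type := Vst {
  vto : ob A -> vc B;
  vth : hc A -> sq B
}.

Definition vpt_of (A B : dcat) (G : psf A B) (al : vst A B) : vpt A B :=
  Vpt (vto al) (vth al) (fun u => sidv (vto al (vs u) // fv G u)).

Definition is_vst (A B : dcat) (F G : psf A B) (al : vst A B) : Prop :=
  is_vpt F G (vpt_of G al).

Definition vst_invertible (A B : dcat) (al : vst A B) : Prop :=
  forall f, exists b, vinverse (vth al f) b.

(* Modifications with horizontal pseudonatural [al] (F => G, top) and
   [be] (F' => G', bottom), and vertical pseudonatural [ga] (F => F', left) and
   [de] (G => G', right). *)
Record is_modification (A B : dcat) (F G F' G' : psf A B) (al be : hpt A B)
    (ga de : vpt A B) (Th : ob A -> sq B) : Prop := {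
  mod_o : forall X,
    framed (hto al X) (hto be X) (pto ga X) (pto de X) (Th X);
  mod_h : forall f,
    (pth ga f <|> Th (ht f)) </> hth be f
    = hth al f </> (Th (hs f) <|> pth de f);
  mod_v : forall u,
    ptv ga u <|> (htv al u </> Th (vt u))
    = (Th (vs u) </> htv be u) <|> ptv de u
}.

(** * Binoidal double categories *)

(* [bl D A] is the functor A |x -, [br D B] is - x| B *)
Record binoidal (B : dcat) : Type := Binoidal {
  bl : ob B -> psf B B;
  br : ob B -> psf B B
}.

Definition bo (B : dcat) (D : binoidal B) (X Y : ob B) : ob B := fo (bl D X) Y.

Definition is_binoidal (B : dcat) (D : binoidal B) : Prop :=
  (forall X, is_psf (bl D X)) /\ (forall Y, is_psf (br D Y)) /\
  (forall X Y, fo (bl D X) Y = fo (br D Y) X).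

(* Candidate transformations p |x - (left) and - x| p (right) for all 1-cells;
   they are only required to be transformations where some 1-cell is asserted
   to be central. *)
Record centers (B : dcat) : Type := Centers {
  lch : hc B -> hpt B B;
  lcv : vc B -> vpt B B;
  rch : hc B -> hpt B B;
  rcv : vc B -> vpt B B
}.

Section Central.
Variables (B : dcat) (D : binoidal B) (c : centers B).

Definition left_central_h (K : hc B) : Prop :=
  is_hpt (bl D (hs K)) (bl D (ht K)) (lch c K) /\
  forall Y, hto (lch c K) Y = fh (br D Y) K.

Definition left_central_v (U : vc B) : Prop :=
  is_vpt (bl D (vs U)) (bl D (vt U)) (lcv c U) /\
  forall Y, pto (lcv c U) Y = fv (br D Y) U.

Definition right_central_h (k : hc B) : Prop :=
  is_hpt (br D (hs k)) (br D (ht k)) (rch c k) /\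
  forall X, hto (rch c k) X = fh (bl D X) k.

Definition right_central_v (u : vc B) : Prop :=
  is_vpt (br D (vs u)) (br D (vt u)) (rcv c u) /\
  forall X, pto (rcv c u) X = fv (bl D X) u.

Definition inversely_central (U : vc B) : Prop :=
  exists V : vc B,
    vs V = vt U /\ vt V = vs U /\ U // V = vid (vs U) /\ V // U = vid (vt U) /\
    left_central_v U /\ right_central_v U /\
    left_central_v V /\ right_central_v V /\
    (forall k, vinverse (pth (lcv c U) k) (pth (lcv c V) k)) /\
    (forall K, vinverse (pth (rcv c U) K) (pth (rcv c V) K)).

Definition purely_central : Prop :=
  is_binoidal D /\
  (forall K, left_central_h K /\ right_central_h K) /\
  (forall U, left_central_v U /\ right_central_v U) /\
  (forall K k, vinverse (hth (lch c K) k) (hth (rch c k) K)) /\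
  (forall K u, htv (lch c K) u = pth (rcv c u) K) /\
  (forall U k, pth (lcv c U) k = htv (rch c k) U) /\
  (forall U u, ptv (lcv c U) u
               = sidv (fv (br D (vs u)) U // fv (bl D (vt U)) u)) /\
  (forall U u, ptv (rcv c u) U
               = sidv (fv (bl D (vs U)) u // fv (br D (vt u)) U)).

End Central.

(** * Quasi-functors *)

(* H(A,-) and H(-,B) are [bl H A] and [br H B]; the exchange cells are
   H(K,k), H(K,u) and H(U,k), with H(U,u) trivial. *)
Record quasi (B : dcat) : Type := Quasi {
  qbin :> binoidal B;
  qkk : hc B -> hc B -> sq B;
  qku : hc B -> vc B -> sq B;
  quk : vc B -> hc B -> sq B
}.

Section QuasiFunctors.
Variable B : dcat.

Definition hpt_l (H : quasi B) (K : hc B) : hpt B B :=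
  {| hto := fun Y => fh (br H Y) K;
     htv := fun u => qku H K u;
     hth := fun k => qkk H K k |}.

Definition hpt_r (H : quasi B) (k : hc B) : hpt B B :=
  {| hto := fun X => fh (bl H X) k;
     htv := fun U => quk H U k;
     hth := fun K => vinv (qkk H K k) |}.

Definition vst_l (H : quasi B) (U : vc B) : vst B B :=
  {| vto := fun Y => fv (br H Y) U; vth := fun k => quk H U k |}.

Definition vst_r (H : quasi B) (u : vc B) : vst B B :=
  {| vto := fun X => fv (bl H X) u; vth := fun K => qku H K u |}.

Definition centers_of (H : quasi B) : centers B :=
  {| lch := hpt_l H;
     lcv := fun U => vpt_of (bl H (vt U)) (vst_l H U);
     rch := hpt_r H;
     rcv := fun u => vpt_of (br H (vt u)) (vst_r H u) |}.

Record is_quasi (H : quasi B) : Prop := {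
  q_bin : is_binoidal H;
  q_hl : forall K, is_hpt (bl H (hs K)) (bl H (ht K)) (hpt_l H K);
  q_hr : forall k, is_hpt (br H (hs k)) (br H (ht k)) (hpt_r H k);
  q_vl : forall U, is_vst (bl H (vs U)) (bl H (vt U)) (vst_l H U);
  q_vr : forall u, is_vst (br H (vs u)) (br H (vt u)) (vst_r H u);
  q_ml : forall s : sq B,
    is_modification (bl H (vs (lft s))) (bl H (vs (rgt s)))
      (bl H (vt (lft s))) (bl H (vt (rgt s)))
      (hpt_l H (top s)) (hpt_l H (bot s))
      (lcv (centers_of H) (lft s)) (lcv (centers_of H) (rgt s))
      (fun Y => fs (br H Y) s);
  q_mr : forall d : sq B,
    is_modification (br H (vs (lft d))) (br H (vs (rgt d)))
      (br H (vt (lft d))) (br H (vt (rgt d)))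
      (hpt_r H (top d)) (hpt_r H (bot d))
      (rcv (centers_of H) (lft d)) (rcv (centers_of H) (rgt d))
      (fun X => fs (bl H X) d)
}.

(* the pseudodouble functor F(H) *)
Definition tensor (H : quasi B) : psf (dprod B B) B :=
  @Psf (dprod B B) B
    (fun X => bo H (fst X) (snd X))
    (fun f => fh (br H (hs (snd f))) (fst f) ;; fh (bl H (ht (fst f))) (snd f))
    (fun u => fv (br H (vs (snd u))) (fst u) // fv (bl H (vt (fst u))) (snd u))
    (fun a => let (s, d) := a in
       (fs (br H (hs (top d))) s </> qku H (bot s) (lft d))
       <|> (quk H (rgt s) (top d) </> fs (bl H (ht (bot s))) d))
    (fun f g => let (K, k) := f in let (K', k') := g in
       (sidh (fh (br H (hs k)) K) <|> qkk H K' k <|> sidh (fh (bl H (ht K')) k'))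
       </> (fcomp (br H (hs k)) K K' <|> fcomp (bl H (ht K')) k k'))
    (fun X => funit (br H (snd X)) (fst X) <|> funit (bl H (fst X)) (snd X)).

(* the image of a horizontally globular cell [a] from [f ;; g] to [f' ;; g'],
   conjugated by the compositors of [F] *)
Definition conjh (F : psf B B) (f g f' g' : hc B) (a : sq B) : sq B :=
  fcomp F f g </> fs F a </> vinv (fcomp F f' g').

(* the image of a vertically globular cell, conjugated by the unitors of [F] *)
Definition conjv (F : psf B B) (a : sq B) : sq B :=
  funit F (vs (lft a)) </> fs F a </> vinv (funit F (vt (lft a))).

(* A ternary quasi-functor H is given by its binary ones: [t12 C] = H(-,-,C),
   [t13 Y] = H(-,Y,-), [t23 A] = H(A,-,-). *)
Record tquasi : Type := Tquasi {
  t12 : ob B -> quasi B;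
  t13 : ob B -> quasi B;
  t23 : ob B -> quasi B
}.

(* H(H x 1) *)
Definition left_ternary (H : quasi B) : tquasi := {|
  t12 := fun C => {|
    qbin := {| bl := fun X => psf_comp (bl H X) (br H C);
               br := fun Y => psf_comp (br H Y) (br H C) |};
    qkk := fun K k => conjh (br H C)
             (fh (bl H (hs K)) k) (fh (br H (ht k)) K)
             (fh (br H (hs k)) K) (fh (bl H (ht K)) k) (qkk H K k);
    qku := fun K u => fs (br H C) (qku H K u);
    quk := fun U k => fs (br H C) (quk H U k) |};
  t13 := fun Y => {|
    qbin := {| bl := fun X => bl H (bo H X Y);
               br := fun C => psf_comp (br H Y) (br H C) |};
    qkk := fun K l => qkk H (fh (br H Y) K) l;
    qku := fun K w => qku H (fh (br H Y) K) w;
    quk := fun U l => quk H (fv (br H Y) U) l |};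
  t23 := fun X => {|
    qbin := {| bl := fun Y => bl H (bo H X Y);
               br := fun C => psf_comp (bl H X) (br H C) |};
    qkk := fun k l => qkk H (fh (bl H X) k) l;
    qku := fun k w => qku H (fh (bl H X) k) w;
    quk := fun u l => quk H (fv (bl H X) u) l |}
|}.

(* H(1 x H) *)
Definition right_ternary (H : quasi B) : tquasi := {|
  t12 := fun C => {|
    qbin := {| bl := fun X => psf_comp (br H C) (bl H X);
               br := fun Y => br H (bo H Y C) |};
    qkk := fun K k => qkk H K (fh (br H C) k);
    qku := fun K u => qku H K (fv (br H C) u);
    quk := fun U k => quk H U (fh (br H C) k) |};
  t13 := fun Y => {|
    qbin := {| bl := fun X => psf_comp (bl H Y) (bl H X);
               br := fun C => br H (bo H Y C) |};
    qkk := fun K l => qkk H K (fh (bl H Y) l);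
    qku := fun K w => qku H K (fv (bl H Y) w);
    quk := fun U l => quk H U (fh (bl H Y) l) |};
  t23 := fun X => {|
    qbin := {| bl := fun Y => psf_comp (bl H Y) (bl H X);
               br := fun C => psf_comp (br H C) (bl H X) |};
    qkk := fun k l => conjh (bl H X)
             (fh (bl H (hs k)) l) (fh (br H (ht l)) k)
             (fh (br H (hs l)) k) (fh (bl H (ht k)) l) (qkk H k l);
    qku := fun k w => fs (bl H X) (qku H k w);
    quk := fun u l => fs (bl H X) (quk H u l) |}
|}.

(* Two families [a1 Y] : S(-,Y) => T(-,Y) and [a2 X] : S(X,-) => T(X,-) of
   vertical strict transformations that agree on objects. *)
Definition vst_pair (S T : binoidal B) (a1 a2 : ob B -> vst B B) : Prop :=
  (forall Y, is_vst (br S Y) (br T Y) (a1 Y)) /\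
  (forall X, is_vst (bl S X) (bl T X) (a2 X)) /\
  (forall X Y, vto (a1 Y) X = vto (a2 X) Y).

(* vertical strict transformations of binary quasi-functors *)
Definition is_qvst (S T : quasi B) (a1 a2 : ob B -> vst B B) : Prop :=
  vst_pair S T a1 a2 /\
  (forall K k,
     qkk S K k </> (vth (a1 (hs k)) K <|> vth (a2 (ht K)) k)
     = (vth (a2 (hs K)) k <|> vth (a1 (ht k)) K) </> qkk T K k) /\
  (forall K u,
     qku S K u </> vth (a1 (vt u)) K = vth (a1 (vs u)) K </> qku T K u) /\
  (forall U k,
     quk S U k </> vth (a2 (vt U)) k = vth (a2 (vs U)) k </> quk T U k).

(* [th1 Y C], [th2 X C], [th3 X Y] are the transformations in the first, second
   and third variable, the other two being fixed. *)
Record ttrans : Type := Ttrans {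
  th1 : ob B -> ob B -> vst B B;
  th2 : ob B -> ob B -> vst B B;
  th3 : ob B -> ob B -> vst B B
}.

Definition is_ttrans_family (S T : tquasi) (th : ttrans) : Prop :=
  (forall C, vst_pair (t12 S C) (t12 T C)
               (fun Y => th1 th Y C) (fun X => th2 th X C)) /\
  (forall Y, vst_pair (t13 S Y) (t13 T Y)
               (fun C => th1 th Y C) (fun X => th3 th X Y)) /\
  (forall X, vst_pair (t23 S X) (t23 T X)
               (fun C => th2 th X C) (fun Y => th3 th X Y)).

Definition is_ttrans (S T : tquasi) (th : ttrans) : Prop :=
  (forall C, is_qvst (t12 S C) (t12 T C)
               (fun Y => th1 th Y C) (fun X => th2 th X C)) /\
  (forall Y, is_qvst (t13 S Y) (t13 T Y)
               (fun C => th1 th Y C) (fun X => th3 th X Y)) /\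
  (forall X, is_qvst (t23 S X) (t23 T X)
               (fun C => th2 th X C) (fun Y => th3 th X Y)).

Definition ttrans_invertible (th : ttrans) : Prop :=
  (forall Y C, vst_invertible (th1 th Y C)) /\
  (forall X C, vst_invertible (th2 th X C)) /\
  (forall X Y, vst_invertible (th3 th X Y)).

Definition is_associativity (H : quasi B) (th : ttrans) : Prop :=
  is_ttrans (left_ternary H) (right_ternary H) th /\ ttrans_invertible th.

(* The transformation from T(T x 1) to T(1 x T), T = [tensor H], corresponding
   to [th].  At 1h-cells (K,k,l) it is the composite of the components of [th]
   at K, k, l in turn; the outer cells compare the images of a composite under
   H(-,C) and H(A',-) with the composites of the images. *)
Definition Sigma (H : quasi B) (th : ttrans) : vst (dprod (dprod B B) B) B :=
  @Vst (dprod (dprod B B) B) B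
    (fun X => vto (th1 th (snd (fst X)) (snd X)) (fst (fst X)))
    (fun f => let K := fst (fst f) in let k := snd (fst f) in let l := snd f in
       (vinv (fcomp (br H (hs l)) (fh (br H (hs k)) K) (fh (bl H (ht K)) k))
        <|> sidh (fh (bl H (bo H (ht K) (ht k))) l))
       </> (vth (th1 th (hs k) (hs l)) K <|> vth (th2 th (ht K) (hs l)) k
            <|> vth (th3 th (ht K) (ht k)) l)
       </> (sidh (fh (br H (bo H (hs k) (hs l))) K)
            <|> fcomp (bl H (ht K)) (fh (br H (hs l)) k) (fh (bl H (ht k)) l))).

(** * The 24 axioms *)

(* a 1h-cell or a 1v-cell *)
Definition cell : Type := (hc B + vc B)%type.

Inductive side : Type := Left | Right.

Inductive slots : Type := S12 | S13 | S23.

Definition on1 (F : psf B B) (p : cell) : cell :=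
  match p with inl f => inl (fh F f) | inr u => inr (fv F u) end.

(* [xcell c Left p q] is p |x -|_q and [xcell c Right p q] is - x| q|_p *)
Definition xcell (c : centers B) (v : side) (p q : cell) : sq B :=
  match v, p, q with
  | Left, inl K, inl k => hth (lch c K) k
  | Left, inl K, inr u => htv (lch c K) u
  | Left, inr U, inl k => pth (lcv c U) k
  | Left, inr U, inr u => ptv (lcv c U) u
  | Right, inl K, inl k => hth (rch c k) K
  | Right, inl K, inr u => pth (rcv c u) K
  | Right, inr U, inl k => htv (rch c k) U
  | Right, inr U, inr u => ptv (rcv c u) U
  end.

(* the image of [xcell c v p q] under [F] *)
Definition fxcell (D : binoidal B) (c : centers B) (F : psf B B) (v : side)
    (p q : cell) : sq B :=
  match p, q with
  | inl K, inl k =>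
      match v with
      | Left => conjh F (fh (bl D (hs K)) k) (fh (br D (ht k)) K)
                        (fh (br D (hs k)) K) (fh (bl D (ht K)) k)
      | Right => conjh F (fh (br D (hs k)) K) (fh (bl D (ht K)) k)
                         (fh (bl D (hs K)) k) (fh (br D (ht k)) K)
      end (xcell c v p q)
  | inr _, inr _ => conjv F (xcell c v p q)
  | _, _ => fs F (xcell c v p q)
  end.

(* the source and target exchange cells; X is the object in the
   remaining slot *)
Definition Es (D : binoidal B) (c : centers B) (v : side) (i : slots) (X : ob B)
    (p q : cell) : sq B :=
  match i with
  | S12 => fxcell D c (br D X) v p q
  | S13 => xcell c v (on1 (br D X) p) q
  | S23 => xcell c v (on1 (bl D X) p) q
  end.

Definition Et (D : binoidal B) (c : centers B) (v : side) (i : slots) (X : ob B)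
    (p q : cell) : sq B :=
  match i with
  | S12 => xcell c v p (on1 (br D X) q)
  | S13 => xcell c v p (on1 (bl D X) q)
  | S23 => fxcell D c (bl D X) v p q
  end.

(* the components of the transformations in the two slots [i] *)
Definition slot1 (th : ttrans) (i : slots) (X : ob B) : ob B -> vst B B :=
  match i with
  | S12 => fun Y => th1 th Y X
  | S13 => fun C => th1 th X C
  | S23 => fun C => th2 th X C
  end.

Definition slot2 (th : ttrans) (i : slots) (X : ob B) : ob B -> vst B B :=
  match i with
  | S12 => fun A => th2 th A X
  | S13 => fun A => th3 th A X
  | S23 => fun Y => th3 th X Y
  end.

(* The components of [th] at 1v-cells are identities, hence do not show up when
   p or q is vertical.  For i, v and the directions of p and q ranging over
   their values these are 3 * 2 * 4 axioms. *)
Definition exchange_axiom (D : binoidal B) (c : centers B) (th : ttrans)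
    (v : side) (i : slots) (X : ob B) (p q : cell) : Prop :=
  let es := Es D c v i X p q in
  let et := Et D c v i X p q in
  let a1 := slot1 th i X in
  let a2 := slot2 th i X in
  match p, q with
  | inl K, inl k =>
      let K_then_k := vth (a1 (hs k)) K <|> vth (a2 (ht K)) k in
      let k_then_K := vth (a2 (hs K)) k <|> vth (a1 (ht k)) K in
      match v with
      | Left => es </> K_then_k = k_then_K </> et
      | Right => es </> k_then_K = K_then_k </> et
      end
  | inl K, inr u => es </> vth (a1 (vt u)) K = vth (a1 (vs u)) K </> et
  | inr U, inl k => es </> vth (a2 (vt U)) k = vth (a2 (vs U)) k </> et
  | inr U, inr u =>
      es </> sidv (vto (a1 (vt u)) (vt U)) = sidv (vto (a1 (vs u)) (vs U)) </> et
  end.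

Definition axioms24 (H : quasi B) (th : ttrans) : Prop :=
  forall v i X p q, exchange_axiom H (centers_of H) th v i X p q.

(* The left and right versions are the same axioms: this concerns arbitrary
   families of one-variable transformations, not only those satisfying the
   axioms. *)
Definition left_right_coincide (H : quasi B) : Prop :=
  forall th, is_ttrans_family (left_ternary H) (right_ternary H) th ->
  forall i X p q,
    exchange_axiom H (centers_of H) th Left i X p q <->
    exchange_axiom H (centers_of H) th Right i X p q.

(** * Premonoidal double categories *)

Section Premonoidal.
Variables (D : binoidal B) (c : centers B) (I : ob B) (th : ttrans)
          (la rho : vst B B).

(* the common 1v-components of the three associativity families *)
Definition asc (X Y Z : ob B) : vc B := vto (th1 th Y Z) X.

Definition premonoidal_assoc : Prop :=
  (forall Y Z, is_vst (psf_comp (br D Y) (br D Z)) (br D (bo D Y Z))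
                 (th1 th Y Z)) /\
  (forall X Z, is_vst (psf_comp (bl D X) (br D Z)) (psf_comp (br D Z) (bl D X))
                 (th2 th X Z)) /\
  (forall X Y, is_vst (bl D (bo D X Y)) (psf_comp (bl D Y) (bl D X))
                 (th3 th X Y)) /\
  ttrans_invertible th /\
  (forall X Y Z, vto (th2 th X Z) Y = asc X Y Z) /\
  (forall X Y Z, vto (th3 th X Y) Z = asc X Y Z) /\
  (forall X Y Z, inversely_central D c (asc X Y Z)).

Definition premonoidal_units : Prop :=
  is_vst (bl D I) (psf_id B) la /\ vst_invertible la /\
  is_vst (br D I) (psf_id B) rho /\ vst_invertible rho /\
  (forall X, inversely_central D c (vto la X)) /\
  (forall X, inversely_central D c (vto rho X)).

Definition premonoidal_pentagon : Prop :=
  (forall W X Y Z,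
     fv (br D Z) (asc W X Y) // asc W (bo D X Y) Z // fv (bl D W) (asc X Y Z)
     = asc (bo D W X) Y Z // asc W X (bo D Y Z)) /\
  (forall (K : hc B) X Y Z,
     fs (br D Z) (vth (th1 th X Y) K) </> vth (th1 th (bo D X Y) Z) K
       </> pth (rcv c (asc X Y Z)) K
     = vth (th1 th Y Z) (fh (br D X) K) </> vth (th1 th X (bo D Y Z)) K) /\
  (forall W (k : hc B) Y Z,
     fs (br D Z) (vth (th2 th W Y) k) </> vth (th2 th W Z) (fh (br D Y) k)
       </> fs (bl D W) (vth (th1 th Y Z) k)
     = vth (th1 th Y Z) (fh (bl D W) k) </> vth (th2 th W (bo D Y Z)) k) /\
  (forall W X (l : hc B) Z,
     fs (br D Z) (vth (th3 th W X) l) </> vth (th2 th W Z) (fh (bl D X) l)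
       </> fs (bl D W) (vth (th2 th X Z) l)
     = vth (th2 th (bo D W X) Z) l </> vth (th3 th W X) (fh (br D Z) l)) /\
  (forall W X Y (m : hc B),
     pth (lcv c (asc W X Y)) m </> vth (th3 th W (bo D X Y)) m
       </> fs (bl D W) (vth (th3 th X Y) m)
     = vth (th3 th (bo D W X) Y) m </> vth (th3 th W X) (fh (bl D Y) m)).

Definition premonoidal_triangle_mid : Prop :=
  (forall W Y,
     asc W I Y // fv (bl D W) (vto la Y) = fv (br D Y) (vto rho W)) /\
  (forall (K : hc B) Y,
     vth (th1 th I Y) K </> pth (rcv c (vto la Y)) K
     = fs (br D Y) (vth rho K)) /\
  (forall W (l : hc B),
     vth (th3 th W I) l </> fs (bl D W) (vth la l)
     = pth (lcv c (vto rho W)) l).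

Definition premonoidal_triangle_left : Prop :=
  (forall W Y,
     asc I W Y // vto la (bo D W Y) = fv (br D Y) (vto la W)) /\
  (forall (k : hc B) Y,
     vth (th2 th I Y) k </> vth la (fh (br D Y) k) = fs (br D Y) (vth la k)) /\
  (forall W (l : hc B),
     vth (th3 th I W) l </> vth la (fh (bl D W) l)
     = pth (lcv c (vto la W)) l).

Definition premonoidal_triangle_right : Prop :=
  (forall W Y,
     asc W Y I // fv (bl D W) (vto rho Y) = vto rho (bo D W Y)) /\
  (forall (K : hc B) Y,
     vth (th1 th Y I) K </> pth (rcv c (vto rho Y)) K
     = vth rho (fh (br D Y) K)) /\
  (forall W (k : hc B),
     vth (th2 th W I) k </> fs (bl D W) (vth rho k) = vth rho (fh (bl D W) k)).

Definition is_premonoidal : Prop :=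
  is_binoidal D /\ premonoidal_assoc /\ premonoidal_units /\
  premonoidal_pentagon /\ premonoidal_triangle_mid /\
  premonoidal_triangle_left /\ premonoidal_triangle_right.

End Premonoidal.

Definition purely_central_premonoidal (H : quasi B) (th : ttrans) (I : ob B) :
    Prop :=
  purely_central H (centers_of H) /\
  exists la rho : vst B B, is_premonoidal H (centers_of H) I th la rho.

(** * Monoidal double categories *)

Section Monoidal.
Variables (T : psf (dprod B B) B) (Sg : vst (dprod (dprod B B) B) B)
          (I : psf dunit B) (la rho : vst B B).

Definition tensor_left : psf (dprod (dprod B B) B) B :=
  psf_comp (psf_prod T (psf_id B)) T.

Definition tensor_right : psf (dprod (dprod B B) B) B :=
  psf_comp (psf_comp (psf_assoc_iso B B B) (psf_prod (psf_id B) T)) T.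

Definition unit_left : psf B B :=
  psf_comp (psf_comp (psf_lunit_iso B) (psf_prod I (psf_id B))) T.

Definition unit_right : psf B B :=
  psf_comp (psf_comp (psf_runit_iso B) (psf_prod (psf_id B) I)) T.

Definition monoidal_pentagon : Prop :=
  (forall W X Y Z : ob B,
     fv T (vto Sg ((W, X), Y), vid Z) // vto Sg ((W, fo T (X, Y)), Z)
       // fv T (vid W, vto Sg ((X, Y), Z))
     = vto Sg ((fo T (W, X), Y), Z) // vto Sg ((W, X), fo T (Y, Z))) /\
  (forall K k l m : hc B,
     fs T (vth Sg ((K, k), l), sidh m) </> vth Sg ((K, fh T (k, l)), m)
       </> fs T (sidh K, vth Sg ((k, l), m))
     = vth Sg ((fh T (K, k), l), m) </> vth Sg ((K, k), fh T (l, m))).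

Definition monoidal_triangle_mid : Prop :=
  (forall W Y : ob B,
     vto Sg ((W, fo I tt), Y) // fv T (vid W, vto la Y)
     = fv T (vto rho W, vid Y)) /\
  (forall K l : hc B,
     vth Sg ((K, fh I tt), l) </> fs T (sidh K, vth la l)
     = fs T (vth rho K, sidh l)).

Definition monoidal_triangle_left : Prop :=
  (forall W Y : ob B,
     vto Sg ((fo I tt, W), Y) // vto la (fo T (W, Y))
     = fv T (vto la W, vid Y)) /\
  (forall k l : hc B,
     vth Sg ((fh I tt, k), l) </> vth la (fh T (k, l))
     = fs T (vth la k, sidh l)).

Definition monoidal_triangle_right : Prop :=
  (forall W Y : ob B,
     vto Sg ((W, Y), fo I tt) // fv T (vid W, vto rho Y)
     = vto rho (fo T (W, Y))) /\
  (forall K k : hc B,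
     vth Sg ((K, k), fh I tt) </> fs T (sidh K, vth rho k)
     = vth rho (fh T (K, k))).

Definition is_monoidal : Prop :=
  is_psf T /\ is_psf I /\
  is_vst tensor_left tensor_right Sg /\ vst_invertible Sg /\
  is_vst unit_left (psf_id B) la /\ vst_invertible la /\
  is_vst unit_right (psf_id B) rho /\ vst_invertible rho /\
  monoidal_pentagon /\ monoidal_triangle_mid /\
  monoidal_triangle_left /\ monoidal_triangle_right.

End Monoidal.

Definition monoidal (T : psf (dprod B B) B) (Sg : vst (dprod (dprod B B) B) B)
    (I : psf dunit B) : Prop :=
  exists la rho : vst B B, is_monoidal T Sg I la rho.

End QuasiFunctors.

(* Main.v *)
Require Import Defs.
From Stdlib Require Import ClassicalEpsilon.

(** Both implications are checked on generators.  A vertical strict transformation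
    commutes with compositors, so it is determined by its components at 1h-cells all but
    one of whose entries are identities; hence the pentagon and the triangles for the
    tensor product need only be compared there.  The invertible cells
    [ii : K (x) 1_Y => K x| Y] and [jj : 1_X (x) k => X |x k], built from the unitors of
    the quasi-functor, conjugate the component of [Sigma] at (K,1,1), (1,k,1), (1,1,l)
    into the component of [th1], [th2], [th3] at K, k, l.  Moving [ii] and [jj] through the
    pentagon at such a generator by naturality leaves the premonoidal pentagon in that
    variable, and likewise for the triangles.  The unitors for the two structures
    correspond under composition with the invertible transformations from I (x) - to I |x -
    and from - (x) I to - x| I, whose 1v-components are identities.

    That [Sigma] is a transformation at all is obtained by gluing one-variable
    transformations along their exchange axioms, two variables at a time. *)

Set Implicit Arguments.
Unset Strict Implicit.
Unset Printing Implicit Defensive.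

(** * Boundaries and invertible squares *)

(* To compare two sides on generators, both must first be exhibited as transformations between the
   same two functors. The edges of the pentagon and of the triangles meet in composites that are
   bracketed differently and carry extra identity squares in their compositors, so these functors
   agree only in the sense of [psf_eq], and transformations are transported along that relation.

   The source T(T x 1) of [Sigma] is not the tensor of a quasi-functor on B x B, since its first
   variable is itself a pair. Gluing is therefore set up for two different domains: once with A = B
   for [th1] and [th2], once with A = B x B for the result and [th3]. For the functors [gtensor S]
   met on the way no coherence is proved: a transformation between them needs only frames and
   invertible compositors, that is, [is_ppsf].

   Comparison transformations made of compositors or unitors have identity 1v-components, so they
   are inverted componentwise, without choosing inverses of 1v-cells. *)
Existing Class is_double_category.
Existing Class is_psf.

(* Enough of [is_psf] for boundary computations: it is available before the coherence axioms
   of a functor are known. *)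
Record is_ppsf (A B : dcat) (F : psf A B) : Prop := {
  ppsf_h : forall f, hs (fh F f) = fo F (hs f) /\ ht (fh F f) = fo F (ht f);
  ppsf_v : forall u, vs (fv F u) = fo F (vs u) /\ vt (fv F u) = fo F (vt u);
  ppsf_s : forall a,
    framed (fh F (top a)) (fh F (bot a)) (fv F (lft a)) (fv F (rgt a)) (fs F a);
  ppsf_vid : forall X, fv F (vid X) = vid (fo F X);
  ppsf_vcomp : forall u v, vt u = vs v -> fv F (u // v) = fv F u // fv F v;
  ppsf_fcomp : forall f g, ht f = hs g ->
    hglob (fh F f ;; fh F g) (fh F (f ;; g)) (fcomp F f g) /\
    exists b, vinverse (fcomp F f g) b;
  ppsf_funit : forall X,
    hglob (hid (fo F X)) (fh F (hid X)) (funit F X) /\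
    exists b, vinverse (funit F X) b
}.

Existing Class is_ppsf.
(* Search is blocked until the structure itself is known; a goal about an undetermined functor would
   otherwise be closed by an arbitrary instance. *)
Global Hint Mode is_double_category ! : typeclass_instances.
Global Hint Mode is_psf - - ! : typeclass_instances.
Global Hint Mode is_ppsf - - ! : typeclass_instances.

Global Instance ppsf_psf (A B : dcat) (F : psf A B) : is_psf F -> is_ppsf F.
Proof. intros hF; split; apply hF. Qed.

(** As a class of its own, invertibility can be found by search; the existential statements in the
    structures are convertible to it. *)
Definition vinvertible (B : dcat) (a : sq B) : Prop := exists b, vinverse a b.
Existing Class vinvertible.

Ltac vi := first [assumption | typeclasses eauto].

Ltac bdstep := fail.
Ltac bdstepq := fail.
Ltac bdpair := match goal with
  | |- context [@hs (dprod _ _) _] => progress cbn [hs dprod fst snd]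
  | |- context [@ht (dprod _ _) _] => progress cbn [ht dprod fst snd]
  | |- context [@vs (dprod _ _) _] => progress cbn [vs dprod fst snd]
  | |- context [@vt (dprod _ _) _] => progress cbn [vt dprod fst snd]
  | |- context [@top (dprod _ _) _] => progress cbn [top dprod fst snd]
  | |- context [@bot (dprod _ _) _] => progress cbn [bot dprod fst snd]
  | |- context [@lft (dprod _ _) _] => progress cbn [lft dprod fst snd]
  | |- context [@rgt (dprod _ _) _] => progress cbn [rgt dprod fst snd]
  | |- context [@hid (dprod _ _) _] => progress cbn [hid dprod fst snd]
  | |- context [@vid (dprod _ _) _] => progress cbn [vid dprod fst snd]
  | |- context [@sidh (dprod _ _) _] => progress cbn [sidh dprod fst snd]
  | |- context [@sidv (dprod _ _) _] => progress cbn [sidv dprod fst snd]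
  | |- context [@hcomp (dprod _ _) _ _] => progress cbn [hcomp dprod fst snd]
  | |- context [@vcomp (dprod _ _) _ _] => progress cbn [vcomp dprod fst snd]
  | |- context [@shc (dprod _ _) _ _] => progress cbn [shc dprod fst snd]
  | |- context [@svc (dprod _ _) _ _] => progress cbn [svc dprod fst snd]
  end.

(* [bd] computes boundaries, to discharge the composability conditions that guard every law;
   [bdstep], [bdstepq] and [vi_extra] are extended as new kinds of cells appear. *)
Ltac bd :=
  intros;
  lazymatch goal with
  | |- is_double_category _ => typeclasses eauto
  | |- is_psf _ => typeclasses eauto
  | |- is_ppsf _ => typeclasses eauto
  | |- vinvertible _ => vi
  | |- _ = _ =>
      first [reflexivity | assumption
            | repeat first [bdpair | bdstep | bdstepq
                      | match goal with
                         | h : lft ?a = vid _ |- context [lft ?a] => rewrite !h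
                         | h : rgt ?a = vid _ |- context [rgt ?a] => rewrite !h
                         | h : top ?a = hid _ |- context [top ?a] => rewrite !h
                         | h : bot ?a = hid _ |- context [bot ?a] => rewrite !h
                         | h : forall _, _ = _ |- _ => progress (rewrite !h)
                         | h : forall _ _, _ = _ |- _ => progress (rewrite !h)
                         | h : forall _ _ _, _ = _ |- _ => progress (rewrite !h)
                         end];
              solve [reflexivity | congruence]]
  | |- _ => first [assumption | typeclasses eauto]
  end.

Section Boundaries.
Context {B : dcat} {hB : is_double_category B}.
Implicit Types (a b : sq B) (f g : hc B) (u v : vc B) (A : ob B).

Lemma hs_top a : hs (top a) = vs (lft a). Proof. apply hB. Qed.
Lemma ht_top a : ht (top a) = vs (rgt a). Proof. apply hB. Qed.
Lemma hs_bot a : hs (bot a) = vt (lft a). Proof. apply hB. Qed.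
Lemma ht_bot a : ht (bot a) = vt (rgt a). Proof. apply hB. Qed.
Lemma hs_hid A : hs (hid A) = A. Proof. apply hB. Qed.
Lemma ht_hid A : ht (hid A) = A. Proof. apply hB. Qed.
Lemma vs_vid A : vs (vid A) = A. Proof. apply hB. Qed.
Lemma vt_vid A : vt (vid A) = A. Proof. apply hB. Qed.
Lemma hs_hcomp f g : ht f = hs g -> hs (f ;; g) = hs f. Proof. apply hB. Qed.
Lemma ht_hcomp f g : ht f = hs g -> ht (f ;; g) = ht g. Proof. apply hB. Qed.
Lemma vs_vcomp u v : vt u = vs v -> vs (u // v) = vs u. Proof. apply hB. Qed.
Lemma vt_vcomp u v : vt u = vs v -> vt (u // v) = vt v. Proof. apply hB. Qed.
Lemma hassoc f g h : ht f = hs g -> ht g = hs h -> f ;; (g ;; h) = f ;; g ;; h.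
Proof. apply hB. Qed.
Lemma vassoc u v w : vt u = vs v -> vt v = vs w -> u // (v // w) = u // v // w.
Proof. apply hB. Qed.
(** The unit laws take the object as a variable with a boundary equation, so that they also rewrite
    where the object equals the boundary only provably. *)
Lemma hunitl f A : hs f = A -> hid A ;; f = f. Proof. intros <-; apply hB. Qed.
Lemma hunitr f A : ht f = A -> f ;; hid A = f. Proof. intros <-; apply hB. Qed.
Lemma vunitl u A : vs u = A -> vid A // u = u. Proof. intros <-; apply hB. Qed.
Lemma vunitr u A : vt u = A -> u // vid A = u. Proof. intros <-; apply hB. Qed.
Lemma top_sidh f : top (sidh f) = f. Proof. apply hB. Qed.
Lemma bot_sidh f : bot (sidh f) = f. Proof. apply hB. Qed.
Lemma lft_sidh f : lft (sidh f) = vid (hs f). Proof. apply hB. Qed.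
Lemma rgt_sidh f : rgt (sidh f) = vid (ht f). Proof. apply hB. Qed.
Lemma top_sidv u : top (sidv u) = hid (vs u). Proof. apply hB. Qed.
Lemma bot_sidv u : bot (sidv u) = hid (vt u). Proof. apply hB. Qed.
Lemma lft_sidv u : lft (sidv u) = u. Proof. apply hB. Qed.
Lemma rgt_sidv u : rgt (sidv u) = u. Proof. apply hB. Qed.
Lemma top_shc a b : rgt a = lft b -> top (a <|> b) = top a ;; top b. Proof. apply hB. Qed.
Lemma bot_shc a b : rgt a = lft b -> bot (a <|> b) = bot a ;; bot b. Proof. apply hB. Qed.
Lemma lft_shc a b : rgt a = lft b -> lft (a <|> b) = lft a. Proof. apply hB. Qed.
Lemma rgt_shc a b : rgt a = lft b -> rgt (a <|> b) = rgt b. Proof. apply hB. Qed.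
Lemma top_svc a b : bot a = top b -> top (a </> b) = top a. Proof. apply hB. Qed.
Lemma bot_svc a b : bot a = top b -> bot (a </> b) = bot b. Proof. apply hB. Qed.
Lemma lft_svc a b : bot a = top b -> lft (a </> b) = lft a // lft b. Proof. apply hB. Qed.
Lemma rgt_svc a b : bot a = top b -> rgt (a </> b) = rgt a // rgt b. Proof. apply hB. Qed.
Lemma shassoc a b c : rgt a = lft b -> rgt b = lft c -> a <|> (b <|> c) = a <|> b <|> c.
Proof. apply hB. Qed.
Lemma svassoc a b c : bot a = top b -> bot b = top c -> a </> (b </> c) = a </> b </> c.
Proof. apply hB. Qed.
Lemma shunitl a u : lft a = u -> sidv u <|> a = a. Proof. intros <-; apply hB. Qed.
Lemma shunitr a u : rgt a = u -> a <|> sidv u = a. Proof. intros <-; apply hB. Qed.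
Lemma svunitl a f : top a = f -> sidh f </> a = a. Proof. intros <-; apply hB. Qed.
Lemma svunitr a f : bot a = f -> a </> sidh f = a. Proof. intros <-; apply hB. Qed.
Lemma interchange a b c d :
  rgt a = lft b -> rgt c = lft d -> bot a = top c -> bot b = top d ->
  (a <|> b) </> (c <|> d) = (a </> c) <|> (b </> d).
Proof. apply hB. Qed.
Lemma sidh_hcomp f g : ht f = hs g -> sidh (f ;; g) = sidh f <|> sidh g.
Proof. intros; symmetry; now apply hB. Qed.
Lemma sidv_vcomp u v : vt u = vs v -> sidv (u // v) = sidv u </> sidv v.
Proof. intros; symmetry; now apply hB. Qed.
Lemma sidh_hid A : sidh (hid A) = sidv (vid A). Proof. apply hB. Qed.
Lemma sidh_unitl A a : lft a = vid A -> sidh (hid A) <|> a = a.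
Proof. intros; rewrite sidh_hid; now apply shunitl. Qed.
Lemma sidh_unitr A a : rgt a = vid A -> a <|> sidh (hid A) = a.
Proof. intros; rewrite sidh_hid; now apply shunitr. Qed.
Lemma sidv_unitl A a : top a = hid A -> sidv (vid A) </> a = a.
Proof. intros; rewrite <- sidh_hid; now apply svunitl. Qed.
Lemma sidv_unitr A a : bot a = hid A -> a </> sidv (vid A) = a.
Proof. intros; rewrite <- sidh_hid; now apply svunitr. Qed.
Lemma svc_lft a b : bot a = top b -> vt (lft a) = vs (lft b).
Proof. intros e; rewrite <- hs_bot, e; apply hs_top. Qed.
Lemma svc_rgt a b : bot a = top b -> vt (rgt a) = vs (rgt b).
Proof. intros e; rewrite <- ht_bot, e; apply ht_top. Qed.
End Boundaries.

Ltac bd_dcat :=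
  match goal with
  | |- context [hs (top _)] => rewrite hs_top by bd
  | |- context [ht (top _)] => rewrite ht_top by bd
  | |- context [hs (bot _)] => rewrite hs_bot by bd
  | |- context [ht (bot _)] => rewrite ht_bot by bd
  | |- context [hs (hid _)] => rewrite hs_hid by bd
  | |- context [ht (hid _)] => rewrite ht_hid by bd
  | |- context [vs (vid _)] => rewrite vs_vid by bd
  | |- context [vt (vid _)] => rewrite vt_vid by bd
  | |- context [hs (_ ;; _)] => rewrite hs_hcomp by bd
  | |- context [ht (_ ;; _)] => rewrite ht_hcomp by bd
  | |- context [vs (_ // _)] => rewrite vs_vcomp by bd
  | |- context [vt (_ // _)] => rewrite vt_vcomp by bd
  | |- context [_ ;; (_ ;; _)] => rewrite hassoc by bd
  | |- context [_ // (_ // _)] => rewrite vassoc by bd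
  | |- context [hid _ ;; _] => rewrite hunitl by bd
  | |- context [_ ;; hid _] => rewrite hunitr by bd
  | |- context [vid _ // _] => rewrite vunitl by bd
  | |- context [_ // vid _] => rewrite vunitr by bd
  | |- context [top (sidh _)] => rewrite top_sidh by bd
  | |- context [bot (sidh _)] => rewrite bot_sidh by bd
  | |- context [lft (sidh _)] => rewrite lft_sidh by bd
  | |- context [rgt (sidh _)] => rewrite rgt_sidh by bd
  | |- context [top (sidv _)] => rewrite top_sidv by bd
  | |- context [bot (sidv _)] => rewrite bot_sidv by bd
  | |- context [lft (sidv _)] => rewrite lft_sidv by bd
  | |- context [rgt (sidv _)] => rewrite rgt_sidv by bd
  | |- context [top (_ <|> _)] => rewrite top_shc by bd
  | |- context [bot (_ <|> _)] => rewrite bot_shc by bd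
  | |- context [lft (_ <|> _)] => rewrite lft_shc by bd
  | |- context [rgt (_ <|> _)] => rewrite rgt_shc by bd
  | |- context [top (_ </> _)] => rewrite top_svc by bd
  | |- context [bot (_ </> _)] => rewrite bot_svc by bd
  | |- context [lft (_ </> _)] => rewrite lft_svc by bd
  | |- context [rgt (_ </> _)] => rewrite rgt_svc by bd
  end.
Ltac bdstep ::= bd_dcat.

Section Inverses.
Context {B : dcat} {hB : is_double_category B}.
Implicit Types (a b : sq B) (f g : hc B) (u v : vc B) (A : ob B).

Lemma vinv_spec a : vinvertible a -> vinverse a (vinv a).
Proof. intros h; unfold vinv; apply epsilon_spec; exact h. Qed.
Lemma top_vinv a : vinvertible a -> top (vinv a) = bot a.
Proof. intros h; now apply vinv_spec. Qed.
Lemma bot_vinv a : vinvertible a -> bot (vinv a) = top a.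
Proof. intros h; now apply vinv_spec. Qed.
Lemma vinvr a : vinvertible a -> a </> vinv a = sidh (top a).
Proof. intros h; now apply vinv_spec. Qed.
Lemma vinvl a : vinvertible a -> vinv a </> a = sidh (bot a).
Proof. intros h; now apply vinv_spec. Qed.
Lemma vinverse_lft a b : vinverse a b -> lft a // lft b = vid (vs (lft a)).
Proof.
  intros (h1 & h2 & h3 & h4).
  generalize (f_equal (@lft B) h3); rewrite lft_svc by bd; intros ->; bd.
Qed.
Lemma vinverse_rgt a b : vinverse a b -> rgt a // rgt b = vid (vs (rgt a)).
Proof.
  intros (h1 & h2 & h3 & h4).
  generalize (f_equal (@rgt B) h3); rewrite rgt_svc by bd; intros ->; bd.
Qed.
Lemma vinverse_sym a b : vinverse a b -> vinverse b a.
Proof. intros (h1 & h2 & h3 & h4); repeat split; congruence. Qed.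
(** Inverse squares have inverse vertical sides, and the inverse of an identity is an identity. *)
Lemma lft_vinv a A : vinvertible a -> lft a = vid A -> lft (vinv a) = vid A.
Proof.
  intros h e; generalize (vinverse_lft (vinv_spec h)); rewrite e, vs_vid.
  rewrite vunitl; [easy|]. rewrite <- hs_top, (top_vinv h), hs_bot, e; bd.
Qed.
Lemma rgt_vinv a A : vinvertible a -> rgt a = vid A -> rgt (vinv a) = vid A.
Proof.
  intros h e; generalize (vinverse_rgt (vinv_spec h)); rewrite e, vs_vid.
  rewrite vunitl; [easy|]. rewrite <- ht_top, (top_vinv h), ht_bot, e; bd.
Qed.
Lemma lft_vinv_id a : vinvertible a -> lft a = vid (vs (lft a)) -> lft (vinv a) = lft a.
Proof. intros h e; transitivity (vid (vs (lft a))); [now apply lft_vinv | easy]. Qed.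
Lemma rgt_vinv_id a : vinvertible a -> rgt a = vid (vs (rgt a)) -> rgt (vinv a) = rgt a.
Proof. intros h e; transitivity (vid (vs (rgt a))); [now apply rgt_vinv | easy]. Qed.
Lemma vinverse_unique a b c : vinverse a b -> vinverse a c -> b = c.
Proof.
  intros (h1 & h2 & h3 & h4) (k1 & k2 & k3 & k4).
  rewrite <- (@svunitr B hB b (top a)) by bd. rewrite <- k3.
  rewrite svassoc by bd. rewrite h4. apply svunitl; congruence.
Qed.
(** The value chosen by [epsilon] is unspecified, but inverses are unique, so any explicit inverse
    computes [vinv]. *)
Lemma vinv_eq a b : vinverse a b -> vinv a = b.
Proof. intros h; apply (@vinverse_unique a); [apply vinv_spec; now exists b | easy]. Qed.
Lemma vinverse_sidh f : vinverse (sidh f) (sidh f).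
Proof. repeat split; rewrite ?top_sidh, ?bot_sidh, ?svunitl; bd. Qed.
Lemma vinv_sidh f : vinv (sidh f) = sidh f.
Proof. apply vinv_eq, vinverse_sidh. Qed.
Lemma vinverse_svc a a' b b' : bot a = top b -> vinverse a a' -> vinverse b b' ->
  vinverse (a </> b) (b' </> a').
Proof.
  intros e (h1 & h2 & h3 & h4) (k1 & k2 & k3 & k4).
  assert (bot b' = top a') by congruence.
  repeat split; rewrite ?top_svc, ?bot_svc by bd; try congruence.
  - rewrite svassoc by bd. rewrite <- (svassoc (a:=a)) by bd.
    rewrite k3, svunitr by bd. congruence.
  - rewrite svassoc by bd. rewrite <- (svassoc (a:=b')) by bd.
    rewrite h4, svunitr by bd. congruence.
Qed.
Lemma vinverse_shc a a' b b' : rgt a = lft b -> rgt a' = lft b' ->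
  vinverse a a' -> vinverse b b' ->
  vinverse (a <|> b) (a' <|> b').
Proof.
  intros e e' (h1 & h2 & h3 & h4) (k1 & k2 & k3 & k4).
  repeat split; rewrite ?top_shc, ?bot_shc by bd; try congruence.
  - rewrite interchange by bd. rewrite sidh_hcomp by bd. congruence.
  - rewrite interchange by bd. rewrite sidh_hcomp by bd. congruence.
Qed.
(* The vertical boundaries of inverses are inverse, hence determined by those of the cells. *)
Lemma vinverse_composable a a' b b' : rgt a = lft b -> vinverse a a' -> vinverse b b' ->
  rgt a' = lft b'.
Proof.
  intros e h k.
  pose proof (vinverse_rgt h) as h1. pose proof (vinverse_lft k) as k1.
  pose proof (vinverse_rgt (vinverse_sym h)) as h2.
  destruct h as (e1 & e2 & _ & _), k as (e3 & e4 & _ & _).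
  assert (vt (rgt a) = vs (rgt a')) by (rewrite <- ht_top, <- ht_bot; congruence).
  assert (vt (lft b) = vs (lft b')) by (rewrite <- hs_top, <- hs_bot; congruence).
  assert (vt (rgt a') = vs (rgt a)) by (rewrite <- ht_top, <- ht_bot; congruence).
  rewrite <- (@vunitr B hB (rgt a') (vs (rgt a))) by bd.
  rewrite e, <- k1, <- e, vassoc by bd. rewrite h2. rewrite vunitl; congruence.
Qed.
Lemma vinvertible_shc a b : rgt a = lft b -> vinvertible a -> vinvertible b ->
  vinvertible (a <|> b).
Proof.
  intros e [a' ha] [b' hb']; exists (a' <|> b').
  eapply vinverse_shc; eauto. eapply vinverse_composable; eauto.
Qed.
Lemma vinvertible_svc a b : bot a = top b -> vinvertible a -> vinvertible b ->
  vinvertible (a </> b).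
Proof. intros e [a' ha] [b' hb']; exists (b' </> a'). now apply vinverse_svc. Qed.
Lemma vinvertible_sidh f : vinvertible (sidh f).
Proof. eexists; apply vinverse_sidh. Qed.
Lemma vinvertible_vinv a : vinvertible a -> vinvertible (vinv a).
Proof. intros h. exists a. now apply vinverse_sym, vinv_spec. Qed.
Lemma vinv_vinv a : vinvertible a -> vinv (vinv a) = a.
Proof. intros h. now apply vinv_eq, vinverse_sym, vinv_spec. Qed.

Lemma vinv_svc a b : bot a = top b -> vinvertible a -> vinvertible b ->
  vinv (a </> b) = vinv b </> vinv a.
Proof. intros e ha hb. apply vinv_eq, vinverse_svc; auto using vinv_spec. Qed.
Lemma vinv_shc a b : rgt a = lft b -> vinvertible a -> vinvertible b ->
  vinv (a <|> b) = vinv a <|> vinv b.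
Proof.
  intros e ha hb. apply vinv_eq, vinverse_shc; auto using vinv_spec.
  eapply vinverse_composable; eauto using vinv_spec.
Qed.

(** Many coherence equations below are proved after composing with an invertible cell, where an
    axiom applies. The boundary hypotheses guard the cancellation, because composites that do not
    match are unconstrained. *)
Lemma vcancel_l a b c : vinvertible a -> bot a = top b -> bot a = top c ->
  a </> b = a </> c -> b = c.
Proof.
  intros h e1 e2 E. rewrite <- (@svunitl B hB b (bot a)) by bd.
  rewrite <- (@svunitl B hB c (bot a)) by bd. rewrite <- (vinvl h).
  assert (bot (vinv a) = top a) by now apply bot_vinv.
  rewrite <- !svassoc by bd. now rewrite E.
Qed.
Lemma vcancel_r a b c : vinvertible a -> bot b = top a -> bot c = top a ->
  b </> a = c </> a -> b = c.
Proof.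
  intros h e1 e2 E. rewrite <- (@svunitr B hB b (top a)) by bd.
  rewrite <- (@svunitr B hB c (top a)) by bd. rewrite <- (vinvr h).
  assert (top (vinv a) = bot a) by now apply top_vinv.
  rewrite !svassoc by bd. now rewrite E.
Qed.
Lemma vinv_move a b c : vinvertible a -> bot a = top c ->
  b = a </> c -> vinv a </> b = c.
Proof.
  intros h e ->. assert (bot (vinv a) = top a) by now apply bot_vinv.
  rewrite svassoc by bd. rewrite vinvl by bd. now apply svunitl.
Qed.
Lemma vinv_move_r a b c : vinvertible a -> bot c = top a ->
  b = c </> a -> b </> vinv a = c.
Proof.
  intros h e ->. assert (top (vinv a) = bot a) by now apply top_vinv.
  rewrite <- svassoc by bd. rewrite vinvr by bd. now apply svunitr.
Qed.
End Inverses.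

Ltac bd_vinv :=
  match goal with
  | |- context [top (vinv _)] => rewrite top_vinv by bd
  | |- context [bot (vinv _)] => rewrite bot_vinv by bd
  | |- context [lft (vinv _)] => rewrite lft_vinv_id by bd
  | |- context [rgt (vinv _)] => rewrite rgt_vinv_id by bd
  end.
Ltac bdstep ::= first [bd_dcat | bd_vinv].

Section PsfBoundaries.
Context {A B : dcat} (F : psf A B) {hF : is_ppsf F}.
Lemma hs_fh f : hs (fh F f) = fo F (hs f). Proof. apply hF. Qed.
Lemma ht_fh f : ht (fh F f) = fo F (ht f). Proof. apply hF. Qed.
Lemma vs_fv f : vs (fv F f) = fo F (vs f). Proof. apply hF. Qed.
Lemma vt_fv f : vt (fv F f) = fo F (vt f). Proof. apply hF. Qed.
Lemma top_fs a : top (fs F a) = fh F (top a). Proof. apply hF. Qed.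
Lemma bot_fs a : bot (fs F a) = fh F (bot a). Proof. apply hF. Qed.
Lemma lft_fs a : lft (fs F a) = fv F (lft a). Proof. apply hF. Qed.
Lemma rgt_fs a : rgt (fs F a) = fv F (rgt a). Proof. apply hF. Qed.
Lemma fv_vid X : fv F (vid X) = vid (fo F X). Proof. apply hF. Qed.
Lemma top_fcomp f g : ht f = hs g -> top (fcomp F f g) = fh F f ;; fh F g.
Proof. intros e; apply (ppsf_fcomp hF e). Qed.
Lemma bot_fcomp f g : ht f = hs g -> bot (fcomp F f g) = fh F (f ;; g).
Proof. intros e; apply (ppsf_fcomp hF e). Qed.
Lemma lft_fcomp {hB : is_double_category B} f g : ht f = hs g ->
  lft (fcomp F f g) = vid (fo F (hs f)).
Proof.
  intros e; destruct (ppsf_fcomp hF e) as [(_ & _ & -> & _) _].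
  rewrite hs_hcomp, hs_fh; [easy|]. rewrite hs_fh, ht_fh; congruence.
Qed.
Lemma rgt_fcomp {hB : is_double_category B} f g : ht f = hs g ->
  rgt (fcomp F f g) = vid (fo F (ht g)).
Proof.
  intros e; destruct (ppsf_fcomp hF e) as [(_ & _ & _ & ->) _].
  rewrite ht_hcomp, ht_fh; [easy|]. rewrite hs_fh, ht_fh; congruence.
Qed.
Lemma vinvertible_fcomp f g : ht f = hs g -> vinvertible (fcomp F f g).
Proof. intros e; apply (ppsf_fcomp hF e). Qed.
Lemma top_funit X : top (funit F X) = hid (fo F X).
Proof. apply (ppsf_funit hF X). Qed.
Lemma bot_funit X : bot (funit F X) = fh F (hid X).
Proof. apply (ppsf_funit hF X). Qed.
Lemma lft_funit {hB : is_double_category B} X : lft (funit F X) = vid (fo F X).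
Proof. destruct (ppsf_funit hF X) as [(_ & _ & -> & _) _]. now rewrite hs_hid. Qed.
Lemma rgt_funit {hB : is_double_category B} X : rgt (funit F X) = vid (fo F X).
Proof. destruct (ppsf_funit hF X) as [(_ & _ & _ & ->) _]. now rewrite ht_hid. Qed.
Lemma vinvertible_funit X : vinvertible (funit F X).
Proof. apply (ppsf_funit hF X). Qed.
Lemma fv_vcomp u v : vt u = vs v -> fv F (u // v) = fv F u // fv F v.
Proof. apply hF. Qed.
End PsfBoundaries.

Section PsfLaws.
Context {A B : dcat} (F : psf A B) {hF : is_psf F}.
Lemma fs_sidh f : fs F (sidh f) = sidh (fh F f). Proof. apply hF. Qed.
Lemma fs_svc a b : bot a = top b -> fs F (a </> b) = fs F a </> fs F b.
Proof. apply hF. Qed.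
Lemma fcomp_nat a b : rgt a = lft b ->
  (fs F a <|> fs F b) </> fcomp F (bot a) (bot b)
  = fcomp F (top a) (top b) </> fs F (a <|> b).
Proof. apply hF. Qed.
Lemma vinverse_fs a b : vinverse a b -> vinverse (fs F a) (fs F b).
Proof.
  intros (h1 & h2 & h3 & h4).
  repeat split; rewrite ?top_fs, ?bot_fs by bd; rewrite <- ?fs_svc, ?h3, ?h4, ?fs_sidh by bd; congruence.
Qed.
Lemma vinvertible_fs a : vinvertible a -> vinvertible (fs F a).
Proof. intros [b h]; exists (fs F b); now apply vinverse_fs. Qed.
Lemma fs_vinv {hB : is_double_category B} a : vinvertible a -> fs F (vinv a) = vinv (fs F a).
Proof. intros h; symmetry; apply vinv_eq, vinverse_fs, vinv_spec, h. Qed.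
End PsfLaws.

Ltac bd_psf :=
  match goal with
  | |- context [hs (fh _ _)] => rewrite hs_fh by bd
  | |- context [ht (fh _ _)] => rewrite ht_fh by bd
  | |- context [vs (fv _ _)] => rewrite vs_fv by bd
  | |- context [vt (fv _ _)] => rewrite vt_fv by bd
  | |- context [top (fs _ _)] => rewrite top_fs by bd
  | |- context [bot (fs _ _)] => rewrite bot_fs by bd
  | |- context [lft (fs _ _)] => rewrite lft_fs by bd
  | |- context [rgt (fs _ _)] => rewrite rgt_fs by bd
  | |- context [fv _ (vid _)] => rewrite fv_vid by bd
  | |- context [top (fcomp _ _ _)] => rewrite top_fcomp by bd
  | |- context [bot (fcomp _ _ _)] => rewrite bot_fcomp by bd
  | |- context [lft (fcomp _ _ _)] => rewrite lft_fcomp by bd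
  | |- context [rgt (fcomp _ _ _)] => rewrite rgt_fcomp by bd
  | |- context [top (funit _ _)] => rewrite top_funit by bd
  | |- context [bot (funit _ _)] => rewrite bot_funit by bd
  | |- context [lft (funit _ _)] => rewrite lft_funit by bd
  | |- context [rgt (funit _ _)] => rewrite rgt_funit by bd
  | |- context [fv _ (_ // _)] => rewrite fv_vcomp by bd
  end.
Ltac bdstep ::= first [bd_dcat | bd_vinv | bd_psf].

Lemma vinverse_pair {A B : dcat} (a c : sq A) (b d : sq B) :
  vinverse a c -> vinverse b d -> @vinverse (dprod A B) (a, b) (c, d).
Proof.
  intros (h1 & h2 & h3 & h4) (k1 & k2 & k3 & k4). repeat split; cbn; congruence.
Qed.
Lemma vinvertible_pair {A B : dcat} (a : sq A) (b : sq B) :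
  vinvertible a -> vinvertible b -> @vinvertible (dprod A B) (a, b).
Proof. intros [c h] [d k]; exists (c, d); now apply vinverse_pair. Qed.

Ltac vi_extra := fail.
Ltac vi ::=
  intros;
  first [assumption |
  lazymatch goal with
  | |- vinvertible (fcomp _ _ _) => apply vinvertible_fcomp; bd
  | |- vinvertible (funit _ _) => apply vinvertible_funit; bd
  | |- vinvertible (fs _ _) => apply vinvertible_fs; bd
  | |- vinvertible (sidh _) => apply vinvertible_sidh
  | |- vinvertible (_, _) => apply vinvertible_pair; bd
  | |- vinvertible (vinv _) => apply vinvertible_vinv; bd
  | |- vinvertible (_ </> _) => apply vinvertible_svc; bd
  | |- vinvertible (_ <|> _) => apply vinvertible_shc; bd
  | |- _ => vi_extra
  end].

Ltac ich := match goal with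
  | |- context [(?a <|> ?b) </> (?c <|> ?d)] => rewrite (@interchange _ _ a b c d) by bd
  end.
Ltac vun := match goal with
  | |- context [sidh ?f </> ?a] => rewrite (@svunitl _ _ a f) by bd
  | |- context [?a </> sidh ?f] => rewrite (@svunitr _ _ a f) by bd
  | |- context [sidv (vid ?A) </> ?a] => rewrite (@sidv_unitl _ _ A a) by bd
  | |- context [?a </> sidv (vid ?A)] => rewrite (@sidv_unitr _ _ A a) by bd
  | |- context [(sidh ?f <|> sidh ?g) </> ?a] =>
      rewrite <- (@sidh_hcomp _ _ f g), (@svunitl _ _ a (f ;; g)) by bd
  | |- context [?a </> (sidh ?f <|> sidh ?g)] =>
      rewrite <- (@sidh_hcomp _ _ f g), (@svunitr _ _ a (f ;; g)) by bd
  end.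
Ltac vas := match goal with
  | |- context [?a </> (?b </> ?c)] => rewrite (@svassoc _ _ a b c) by bd
  end.
Ltac has := match goal with
  | |- context [?a <|> (?b <|> ?c)] => rewrite (@shassoc _ _ a b c) by bd
  end.
(* Merges rows of the same shape into columns. *)
Ltac cols := repeat first [vun | ich].

(** * Vertical strict transformations *)

Section Vst.
Context {A B : dcat} {hB : is_double_category B} {F G : psf A B} {al : vst A B}.
Section Elim.
Context (h : is_vst F G al).
Lemma vst_vs X : vs (vto al X) = fo F X. Proof. apply (vpt_o h). Qed.
Lemma vst_vt X : vt (vto al X) = fo G X. Proof. apply (vpt_o h). Qed.
Lemma vst_top f : top (vth al f) = fh F f. Proof. apply (vpt_h h). Qed.
Lemma vst_bot f : bot (vth al f) = fh G f. Proof. apply (vpt_h h). Qed.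
Lemma vst_lft f : lft (vth al f) = vto al (hs f). Proof. apply (vpt_h h). Qed.
Lemma vst_rgt f : rgt (vth al f) = vto al (ht f). Proof. apply (vpt_h h). Qed.
(** The globular cell of a strict transformation at [u] is the identity square on the first
    composite, while its frame prescribes the second composite as right side; hence the two are
    equal. *)
Lemma vst_v u : vto al (vs u) // fv G u = fv F u // vto al (vt u).
Proof.
  destruct (proj1 (vpt_v h u)) as (_ & _ & _ & e). cbn in e.
  now rewrite rgt_sidv in e.
Qed.
Lemma vst_hcomp f g : ht f = hs g ->
  (vth al f <|> vth al g) </> fcomp G f g = fcomp F f g </> vth al (f ;; g).
Proof. apply (vpt_hcomp h). Qed.
Lemma vst_hid X : sidv (vto al X) </> funit G X = funit F X </> vth al (hid X).
Proof. apply (vpt_hid h). Qed.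
Context {hA : is_double_category A} {hF : is_ppsf F} {hG : is_ppsf G}.
Lemma vst_nat a : fs F a </> vth al (bot a) = vth al (top a) </> fs G a.
Proof.
  pose proof (vpt_nat h a) as e. cbn in e.
  rewrite shunitl, shunitr in e; [easy| |].
  - rewrite rgt_svc by (rewrite vst_bot, top_fs; easy).
    rewrite vst_rgt, rgt_fs; bd.
  - rewrite lft_svc by (rewrite vst_top, bot_fs; easy).
    rewrite vst_lft, lft_fs, vst_v; bd.
Qed.
End Elim.

Context {hA : is_double_category A} {hF : is_ppsf F} {hG : is_ppsf G}.
(** The axioms of a vertical transformation with the identity globular cells eliminated. The laws
    for composites and identities of 1v-cells then follow, because identity squares compose to
    identity squares. *)
Lemma is_vst_intro
  (ho : forall X, vs (vto al X) = fo F X /\ vt (vto al X) = fo G X)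
  (hh : forall f, framed (fh F f) (fh G f) (vto al (hs f)) (vto al (ht f)) (vth al f))
  (hv : forall u, vto al (vs u) // fv G u = fv F u // vto al (vt u))
  (hc : forall f g, ht f = hs g ->
    (vth al f <|> vth al g) </> fcomp G f g = fcomp F f g </> vth al (f ;; g))
  (hi : forall X, sidv (vto al X) </> funit G X = funit F X </> vth al (hid X))
  (hn : forall a, fs F a </> vth al (bot a) = vth al (top a) </> fs G a) :
  is_vst F G al.
Proof.
  assert (ho1 : forall X, vs (vto al X) = fo F X) by apply ho.
  assert (ho2 : forall X, vt (vto al X) = fo G X) by apply ho.
  assert (hh1 : forall f, top (vth al f) = fh F f) by apply hh.
  assert (hh2 : forall f, bot (vth al f) = fh G f) by apply hh.
  assert (hh3 : forall f, lft (vth al f) = vto al (hs f)) by apply hh.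
  assert (hh4 : forall f, rgt (vth al f) = vto al (ht f)) by apply hh.
  split; cbn; auto.
  - intros u. split; [split; [|split; [|split]]|]; rewrite ?top_sidv, ?bot_sidv, ?lft_sidv, ?rgt_sidv; auto.
    eexists; repeat split; rewrite ?lft_sidv, ?rgt_sidv; try reflexivity;
      rewrite shunitl; bd.
  - intros u v e.
    assert (E : sidv (vto al (vs (u // v)) // fv G (u // v)) =
      sidv (vto al (vs u) // fv G u) </> sidv (fv G v)).
    { rewrite vs_vcomp, fv_vcomp, vassoc, sidv_vcomp by bd. reflexivity. }
    rewrite E. rewrite <- (sidv_vcomp (u := fv F u)) by bd. symmetry; apply shunitr.
    rewrite rgt_svc, !rgt_sidv by bd. rewrite hv, <- vassoc by bd.
    now rewrite <- e.
  - intros X. rewrite vs_vid, fv_vid, vunitr by bd. reflexivity.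
  - intros a. rewrite shunitl, shunitr; [apply hn| |].
    + rewrite rgt_svc by bd. rewrite hh4, ht_top, rgt_fs by bd. bd.
    + rewrite lft_svc by bd. rewrite hh3, hs_bot, lft_fs by bd. bd.
Qed.
End Vst.

(** * Products, strict functors and composites of pseudodouble functors *)

Section Instances.
Context {A B : dcat} {hA : is_double_category A} {hB : is_double_category B}.

Global Instance is_double_category_dprod : is_double_category (dprod A B).
Proof.
  split; cbn; intros;
    repeat match goal with x : _ * _ |- _ => destruct x end; cbn in *;
    repeat match goal with h : (_, _) = (_, _) |- _ => injection h as ? ? end;
    repeat split; cbn; f_equal; try solve [bd];
    solve [symmetry; bd | apply interchange; auto | apply svassoc; auto | apply shassoc; auto |
      now apply shunitl | now apply shunitr | now apply svunitl | now apply svunitr |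
      symmetry; now apply sidh_hcomp | symmetry; now apply sidv_vcomp | apply sidh_hid ].
Qed.
End Instances.

Global Instance is_double_category_dunit : is_double_category dunit.
Proof.
  split; cbn; intros; repeat match goal with x : unit |- _ => destruct x end; auto.
Qed.

Section Instances2.
Context {A B : dcat} {hA : is_double_category A} {hB : is_double_category B}.

Lemma is_psf_strict (o : ob A -> ob B) (h : hc A -> hc B) (v : vc A -> vc B) (s : sq A -> sq B) :
  (forall f, hs (h f) = o (hs f)) -> (forall f, ht (h f) = o (ht f)) ->
  (forall f, vs (v f) = o (vs f)) -> (forall f, vt (v f) = o (vt f)) ->
  (forall a, framed (h (top a)) (h (bot a)) (v (lft a)) (v (rgt a)) (s a)) ->
  (forall X, h (hid X) = hid (o X)) -> (forall X, v (vid X) = vid (o X)) ->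
  (forall f g, ht f = hs g -> h (f ;; g) = h f ;; h g) ->
  (forall f g, vt f = vs g -> v (f // g) = v f // v g) ->
  (forall f, s (sidh f) = sidh (h f)) -> (forall f, s (sidv f) = sidv (v f)) ->
  (forall a b, rgt a = lft b -> s (a <|> b) = s a <|> s b) ->
  (forall a b, bot a = top b -> s (a </> b) = s a </> s b) ->
  is_psf (psf_strict o h v s).
Proof.
  intros E1 E2 E3 E4 fr E5 E6 E7 E8 E9 E10 E11 E12.
  assert (s1 : forall a, top (s a) = h (top a)) by apply fr.
  assert (s2 : forall a, bot (s a) = h (bot a)) by apply fr.
  assert (s3 : forall a, lft (s a) = v (lft a)) by apply fr.
  assert (s4 : forall a, rgt (s a) = v (rgt a)) by apply fr.
  split; cbn; auto.
  - intros f g e; rewrite E7 by easy; split;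
      [repeat split; rewrite ?top_sidh, ?bot_sidh, ?lft_sidh, ?rgt_sidh; bd|].
      apply vinvertible_sidh.
  - intros X; rewrite E5; split; [repeat split; rewrite ?top_sidh, ?bot_sidh, ?lft_sidh, ?rgt_sidh; bd|].
      apply vinvertible_sidh.
  - intros a b e. rewrite E11 by easy. rewrite svunitr, svunitl by bd. easy.
  - intros u. rewrite E10. rewrite svunitr, svunitl by bd. easy.
  - intros f g k e e'. rewrite !E7 by bd. rewrite <- !sidh_hcomp by bd. rewrite !svunitl by bd. bd.
  - intros f. rewrite <- !sidh_hcomp by bd. rewrite E5, svunitl by bd. rewrite !hunitl by bd. bd.
  - intros f. rewrite <- !sidh_hcomp by bd. rewrite E5, svunitl by bd. rewrite !hunitr by bd. bd.
Qed.

End Instances2.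

Global Instance is_psf_id {A : dcat} {hA : is_double_category A} : is_psf (psf_id A).
Proof. apply is_psf_strict; repeat split; auto. Qed.

Section Instances3.
Context {A B : dcat} {hA : is_double_category A} {hB : is_double_category B}.

Section Prod.
Context {C D : dcat} {hC : is_double_category C} {hD : is_double_category D}
  (F : psf A C) (G : psf B D) {hF : is_psf F} {hG : is_psf G}.
Global Instance is_psf_prod : is_psf (psf_prod F G).
Proof.
  split; cbn; intros;
    repeat match goal with x : _ * _ |- _ => destruct x end; cbn in *;
    repeat match goal with h : (_, _) = (_, _) |- _ => injection h as ? ? end.
  all: try (repeat split; cbn; f_equal; solve [bd]).
  - rewrite !fs_sidh by bd. easy.
  - rewrite !fs_svc by bd. easy.
  - split; [repeat split; cbn; f_equal; solve [bd]|].
    destruct (@vinvertible_fcomp _ _ F _ h1 h) as [x hx]; [easy|].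
    destruct (@vinvertible_fcomp _ _ G _ h2 h0) as [y hy]; [easy|].
    exists (x, y). destruct hx as (?&?&?&?), hy as (?&?&?&?).
    repeat split; cbn; f_equal; auto.
  - split; [repeat split; cbn; f_equal; solve [bd]|].
    destruct (@vinvertible_funit _ _ F _ o) as [x hx].
    destruct (@vinvertible_funit _ _ G _ o0) as [y hy].
    exists (x, y). destruct hx as (?&?&?&?), hy as (?&?&?&?).
    repeat split; cbn; f_equal; auto.
  - f_equal; now apply fcomp_nat.
  - f_equal; [apply hF|apply hG].
  - f_equal; [apply hF|apply hG]; auto.
  - f_equal; [apply hF|apply hG]; auto.
  - f_equal; [apply hF|apply hG]; auto.
Qed.
End Prod.

Section Comp.
Context {C : dcat} {hC : is_double_category C}
  (F : psf A B) (G : psf B C) {hF : is_psf F} {hG : is_psf G}.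
Global Instance is_psf_comp : is_psf (psf_comp F G).
Proof.
  split; cbn; intros.
  - split; bd.
  - split; bd.
  - repeat split; bd.
  - bd.
  - rewrite !fv_vcomp by bd. easy.
  - now rewrite !fs_sidh by bd.
  - rewrite !fs_svc by bd. easy.
  - split; [repeat split; bd|]. change (vinvertible (fcomp G (fh F f) (fh F g) </> fs G (fcomp F f g))). vi.
  - split; [repeat split; bd|]. change (vinvertible (funit G (fo F X) </> fs G (funit F X))). vi.
  - rewrite svassoc by bd.
    replace (fh F (bot a)) with (bot (fs F a)) by bd.
    replace (fh F (bot b)) with (bot (fs F b)) by bd.
    rewrite fcomp_nat by bd. rewrite <- !svassoc by bd. rewrite <- !fs_svc by bd.
    rewrite fcomp_nat by bd. bd.
  - rewrite svassoc by bd. pose proof (psf_funit_nat hG (fv F u)) as e.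
    rewrite vs_fv, vt_fv in e by bd. rewrite e.
    rewrite <- !svassoc by bd. rewrite <- !fs_svc by bd.
    rewrite (psf_funit_nat hF u). easy.
  (* A compositor of the composite has two layers: a compositor of [G], and the image of one of [F].
     Interchange separates the layers; naturality then moves the image past a compositor of [G], and
     the associativity laws of [G] and [F] apply in turn. *)
  - assert (E1 : forall f g h, ht f = hs g -> ht g = hs h ->
      ((fcomp G (fh F f) (fh F g) </> fs G (fcomp F f g)) <|> sidh (fh G (fh F h)))
        = (fcomp G (fh F f) (fh F g) <|> sidh (fh G (fh F h))) </>
          (fs G (fcomp F f g) <|> fs G (sidh (fh F h)))).
    { intros. rewrite fs_sidh, interchange, svunitl by bd. easy. }
    assert (E2 : forall f g h, ht f = hs g -> ht g = hs h ->
      (sidh (fh G (fh F f)) <|> (fcomp G (fh F g) (fh F h) </> fs G (fcomp F g h)))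
        = (sidh (fh G (fh F f)) <|> fcomp G (fh F g) (fh F h)) </>
          (fs G (sidh (fh F f)) <|> fs G (fcomp F g h))).
    { intros. rewrite fs_sidh, interchange, svunitl by bd. easy. }
    rewrite E1, E2 by easy. rewrite !svassoc by bd.
    replace (fh F (f ;; g)) with (bot (fcomp F f g)) by bd.
    replace (fh F (g ;; h)) with (bot (fcomp F g h)) by bd.
    rewrite <- (svassoc (a := fcomp G _ _ <|> _)) by bd.
    rewrite <- (svassoc (a := _ <|> fcomp G _ _)) by bd.
    replace (fcomp G (bot (fcomp F f g)) (fh F h)) with
      (fcomp G (bot (fcomp F f g)) (bot (sidh (fh F h)))) by bd.
    replace (fcomp G (fh F f) (bot (fcomp F g h))) with
      (fcomp G (bot (sidh (fh F f))) (bot (fcomp F g h))) by bd.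
    rewrite !fcomp_nat by bd.
    rewrite !svassoc by bd.
    replace (top (fcomp F f g)) with (fh F f ;; fh F g) by bd.
    replace (top (fcomp F g h)) with (fh F g ;; fh F h) by bd.
    rewrite !top_sidh, (psf_assoc hG) by bd.
    rewrite <- !(svassoc (b := fs _ _) (c := fs _ _)) by bd.
    rewrite <- !fs_svc by bd. rewrite (psf_assoc hF) by bd. easy.
  - assert (E1 : ((funit G (fo F (hs f)) </> fs G (funit F (hs f))) <|> sidh (fh G (fh F f)))
        = (funit G (fo F (hs f)) <|> sidh (fh G (fh F f))) </>
          (fs G (funit F (hs f)) <|> fs G (sidh (fh F f)))).
    { rewrite fs_sidh, interchange, svunitl by bd. easy. }
    rewrite E1. rewrite !svassoc by bd.
    replace (fcomp G (fh F (hid (hs f))) (fh F f)) with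
      (fcomp G (bot (funit F (hs f))) (bot (sidh (fh F f)))) by bd.
    rewrite <- (svassoc (a := funit G _ <|> _)) by bd.
    rewrite fcomp_nat by bd.
    rewrite svassoc by bd. rewrite top_funit, top_sidh by bd.
    pose proof (psf_unitl hG (fh F f)) as e. rewrite hs_fh in e by bd. rewrite e.
    rewrite svunitl by bd. rewrite <- fs_svc by bd. rewrite (psf_unitl hF).
    apply fs_sidh; bd.
  - assert (E1 : (sidh (fh G (fh F f)) <|> (funit G (fo F (ht f)) </> fs G (funit F (ht f))))
        = (sidh (fh G (fh F f)) <|> funit G (fo F (ht f))) </>
          (fs G (sidh (fh F f)) <|> fs G (funit F (ht f)))).
    { rewrite fs_sidh, interchange, svunitl by bd. easy. }
    rewrite E1. rewrite !svassoc by bd.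
    replace (fcomp G (fh F f) (fh F (hid (ht f)))) with
      (fcomp G (bot (sidh (fh F f))) (bot (funit F (ht f)))) by bd.
    rewrite <- (svassoc (a := _ <|> funit G _)) by bd.
    rewrite fcomp_nat by bd.
    rewrite svassoc by bd. rewrite top_funit, top_sidh by bd.
    pose proof (psf_unitr hG (fh F f)) as e. rewrite ht_fh in e by bd. rewrite e.
    rewrite svunitl by bd. rewrite <- fs_svc by bd. rewrite (psf_unitr hF).
    apply fs_sidh; bd.
Qed.
End Comp.
End Instances3.

Global Instance is_psf_assoc_iso {A B C : dcat} {hA : is_double_category A}
  {hB : is_double_category B} {hC : is_double_category C} : is_psf (psf_assoc_iso A B C).
Proof. apply is_psf_strict; repeat split; auto. Qed.
Global Instance is_psf_lunit {A : dcat} {hA : is_double_category A} : is_psf (psf_lunit_iso A).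
Proof. apply is_psf_strict; repeat split; auto. Qed.
Global Instance is_psf_runit {A : dcat} {hA : is_double_category A} : is_psf (psf_runit_iso A).
Proof. apply is_psf_strict; repeat split; auto. Qed.

(** Boundaries enter as variables tied by equations, since in use they occur in a computed form that
    the original law does not match syntactically. *)
Lemma fcomp_nat' {A B : dcat} (F : psf A B) {hF : is_psf F} a b f g f' g' :
  rgt a = lft b -> bot a = f' -> bot b = g' -> top a = f -> top b = g ->
  (fs F a <|> fs F b) </> fcomp F f' g' = fcomp F f g </> fs F (a <|> b).
Proof. intros e <- <- <- <-. now apply fcomp_nat. Qed.

Lemma funit_nat' {A B : dcat} (F : psf A B) {hF : is_psf F} u X Y :
  vt u = Y -> vs u = X ->
  sidv (fv F u) </> funit F Y = funit F X </> fs F (sidv u).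
Proof. intros <- <-. apply hF. Qed.

Lemma vst_nat' {A B : dcat} {hB : is_double_category B} {F G : psf A B} {al : vst A B}
  (h : is_vst F G al) {hA : is_double_category A} {hF : is_ppsf F} {hG : is_ppsf G} a f g :
  bot a = g -> top a = f -> fs F a </> vth al g = vth al f </> fs G a.
Proof. intros <- <-. now apply vst_nat. Qed.

(* Puts the boundary equations of a transformation in the context, where [bd] finds them. *)
Ltac vst_facts h :=
  pose proof (vst_vs h); pose proof (vst_vt h); pose proof (vst_top h);
  pose proof (vst_bot h); pose proof (vst_lft h); pose proof (vst_rgt h).

Definition vst_comp (A B : dcat) (al be : vst A B) : vst A B :=
  Vst (fun X => vto al X // vto be X) (fun f => vth al f </> vth be f).

Definition vst_post (A B C : dcat) (al : vst A B) (T : psf B C) : vst A C :=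
  Vst (fun X => fv T (vto al X)) (fun f => fs T (vth al f)).

Definition vst_pre (A B C : dcat) (P : psf A B) (al : vst B C) : vst A C :=
  Vst (fun X => vto al (fo P X)) (fun f => vth al (fh P f)).

Definition vst_prod (A B C D : dcat) (al : vst A C) (be : vst B D) :
    vst (dprod A B) (dprod C D) :=
  @Vst (dprod A B) (dprod C D) (fun X => (vto al (fst X), vto be (snd X)))
    (fun f => (vth al (fst f), vth be (snd f))).

Definition vst_id (A B : dcat) (F : psf A B) : vst A B :=
  Vst (fun X => vid (fo F X)) (fun f => sidh (fh F f)).

Section Vst.
Context {A B : dcat} {hA : is_double_category A} {hB : is_double_category B}.

Lemma is_vst_comp (F G K : psf A B) {hF : is_ppsf F} {hG : is_ppsf G} {hK : is_ppsf K}
  al be : is_vst F G al -> is_vst G K be -> is_vst F K (vst_comp al be).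
Proof.
  intros h k. vst_facts h. vst_facts k.
  apply is_vst_intro; cbn; intros.
  - split; bd.
  - repeat split; bd.
  - rewrite <- vassoc, (vst_v k), vassoc, (vst_v h), vassoc by bd. easy.
  - rewrite <- interchange by bd.
    rewrite <- svassoc, (vst_hcomp k), svassoc, (vst_hcomp h), svassoc by bd. easy.
  - rewrite sidv_vcomp by bd.
    rewrite <- svassoc, (vst_hid k), svassoc, (vst_hid h), svassoc by bd. easy.
  - rewrite svassoc, (vst_nat h), <- svassoc, (vst_nat k), svassoc by bd. easy.
Qed.

Lemma is_vst_id (F : psf A B) {hF : is_ppsf F} : is_vst F F (vst_id F).
Proof.
  apply is_vst_intro; cbn; intros.
  - split; bd.
  - repeat split; bd.
  - bd.
  - rewrite <- sidh_hcomp, svunitl, svunitr by bd. easy.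
  - rewrite sidv_unitl, svunitr by bd. easy.
  - rewrite svunitl, svunitr by bd. easy.
Qed.

Section Whisker.
Context {C : dcat} {hC : is_double_category C}.
Lemma is_vst_post (F G : psf A B) (T : psf B C) {hF : is_psf F} {hG : is_psf G} {hT : is_psf T}
  al : is_vst F G al -> is_vst (psf_comp F T) (psf_comp G T) (vst_post al T).
Proof.
  intros h. vst_facts h.
  apply is_vst_intro; cbn; intros.
  - split; bd.
  - repeat split; bd.
  - rewrite <- !fv_vcomp by bd. now rewrite (vst_v h).
  - rewrite svassoc by bd. rewrite (@fcomp_nat' _ _ T _ _ _ (fh F f) (fh F g)) by bd.
    rewrite <- !svassoc by bd. rewrite <- !fs_svc by bd. now rewrite (vst_hcomp h).
  - rewrite svassoc by bd. rewrite (@funit_nat' _ _ T _ (vto al X) (fo F X)) by bd.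
    rewrite <- !svassoc by bd. rewrite <- !fs_svc by bd. now rewrite (vst_hid h).
  - rewrite <- !fs_svc by bd. now rewrite (vst_nat h).
Qed.

Lemma is_vst_pre (P : psf A B) (F G : psf B C) {hF : is_psf F} {hG : is_psf G} {hP : is_psf P}
  al : is_vst F G al -> is_vst (psf_comp P F) (psf_comp P G) (vst_pre P al).
Proof.
  intros h. vst_facts h.
  apply is_vst_intro; cbn; intros.
  - split; bd.
  - repeat split; bd.
  - pose proof (vst_v h (fv P u)) as e. rewrite vs_fv, vt_fv in e by bd. exact e.
  - rewrite svassoc by bd. rewrite (vst_hcomp h) by bd. rewrite <- !svassoc by bd.
    rewrite (@vst_nat' _ _ _ _ _ _ h _ _ _ _ (fh P f ;; fh P g)) by bd. easy.
  - rewrite svassoc by bd. rewrite (vst_hid h) by bd. rewrite <- !svassoc by bd.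
    rewrite (@vst_nat' _ _ _ _ _ _ h _ _ _ _ (hid (fo P X))) by bd. easy.
  - rewrite (@vst_nat' _ _ _ _ _ _ h _ _ _ _ (fh P (top a))) by bd. easy.
Qed.
End Whisker.

Section Product.
Context {C D : dcat} {hC : is_double_category C} {hD : is_double_category D}.
Lemma is_vst_prod (F G : psf A C) (F' G' : psf B D) {hF : is_psf F} {hG : is_psf G}
  {hF' : is_psf F'} {hG' : is_psf G'} al be :
  is_vst F G al -> is_vst F' G' be -> is_vst (psf_prod F F') (psf_prod G G') (vst_prod al be).
Proof.
  intros h k. vst_facts h. vst_facts k.
  apply is_vst_intro; cbn; intros;
    repeat match goal with x : _ * _ |- _ => destruct x end; cbn in *;
    repeat match goal with h : (_, _) = (_, _) |- _ => injection h as ? ? end.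
  - split; f_equal; bd.
  - repeat split; cbn; f_equal; bd.
  - f_equal; eapply vst_v; eassumption.
  - f_equal; eapply vst_hcomp; eassumption.
  - f_equal; eapply vst_hid; eassumption.
  - f_equal; eapply vst_nat; eauto; typeclasses eauto.
Qed.
End Product.

Lemma vst_agree (F G : psf A B) {hF : is_ppsf F} {hG : is_ppsf G} al be f g :
  is_vst F G al -> is_vst F G be -> ht f = hs g ->
  vth al f = vth be f -> vth al g = vth be g -> vth al (f ;; g) = vth be (f ;; g).
Proof.
  intros h k e e1 e2. vst_facts h. vst_facts k.
  apply (@vcancel_l _ _ (fcomp F f g)); [bd..|].
  rewrite <- (vst_hcomp h), <- (vst_hcomp k) by easy. congruence.
Qed.

(* Equality of pseudodouble functors, up to the junk values of their compositors. *)
Definition psf_eq (F G : psf A B) : Prop :=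
  (forall X, fo F X = fo G X) /\ (forall f, fh F f = fh G f) /\
  (forall u, fv F u = fv G u) /\ (forall a, fs F a = fs G a) /\
  (forall f g, ht f = hs g -> fcomp F f g = fcomp G f g) /\
  (forall X, funit F X = funit G X).

(** The axioms of a strict transformation mention functors only through the values that [psf_eq]
    compares, with compositors at composable pairs, so no equality of records or functions is called
    for. *)
Lemma is_vst_ext (F G F' G' : psf A B) {hF : is_ppsf F} {hG : is_ppsf G}
  {hF' : is_ppsf F'} {hG' : is_ppsf G'} al al' :
  psf_eq F F' -> psf_eq G G' ->
  (forall X, vto al X = vto al' X) -> (forall f, vth al f = vth al' f) ->
  is_vst F G al -> is_vst F' G' al'.
Proof.
  intros (f1 & f2 & f3 & f4 & f5 & f6) (g1 & g2 & g3 & g4 & g5 & g6) o t h.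
  vst_facts h.
  apply is_vst_intro; cbn; intros.
  - rewrite <- f1, <- g1, <- !o; split; bd.
  - rewrite <- f2, <- g2, <- !o, <- !t; repeat split; bd.
  - rewrite <- f3, <- g3, <- !o; eapply vst_v; eassumption.
  - rewrite <- f5, <- g5, <- !t by easy; eapply vst_hcomp; eassumption.
  - rewrite <- f6, <- g6, <- !t, <- !o by easy; eapply vst_hid; eassumption.
  - rewrite <- f4, <- g4, <- !t by easy; eapply vst_nat; eauto.
Qed.

Lemma psf_eq_refl (F : psf A B) : psf_eq F F.
Proof. repeat split. Qed.
Lemma psf_eq_sym (F G : psf A B) : psf_eq F G -> psf_eq G F.
Proof. intros (?&?&?&?&?&?); repeat split; intros; symmetry; auto. Qed.
Lemma psf_eq_trans (F G K : psf A B) : psf_eq F G -> psf_eq G K -> psf_eq F K.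
Proof.
  intros (a1&a2&a3&a4&a5&a6) (b1&b2&b3&b4&b5&b6).
  split; [|split; [|split; [|split; [|split]]]]; intros;
    first [now rewrite a1 | now rewrite a2 | now rewrite a3 | now rewrite a4
          | now rewrite a5 by easy; apply b5 | now rewrite a6].
Qed.

(** Meant for transformations whose 1v-components are identities: these are kept as they are, and
    only the squares are inverted. *)
Definition vst_vinv (F : psf A B) (al : vst A B) : vst A B :=
  Vst (fun X => vid (fo F X)) (fun f => vinv (vth al f)).

Lemma is_vst_vinv (F G : psf A B) {hF : is_ppsf F} {hG : is_ppsf G} al :
  is_vst F G al -> vst_invertible al -> (forall X, vto al X = vid (fo F X)) ->
  is_vst G F (vst_vinv F al).
Proof.
  intros h i o. vst_facts h.
  assert (i' : forall f, vinvertible (vth al f)) by exact i.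
  assert (fG : forall X, fo G X = fo F X).
  { intros X. rewrite <- (H0 X), o. bd. }
  assert (VI : forall f, top (vinv (vth al f)) = fh G f /\ bot (vinv (vth al f)) = fh F f
    /\ lft (vinv (vth al f)) = vid (fo F (hs f)) /\ rgt (vinv (vth al f)) = vid (fo F (ht f))).
  { intros f; repeat split; [rewrite top_vinv by easy; bd | rewrite bot_vinv by easy; bd |
      apply lft_vinv; [easy|bd] | apply rgt_vinv; [easy|bd]]. }
  assert (V1 : forall f, top (vinv (vth al f)) = fh G f) by apply VI.
  assert (V2 : forall f, bot (vinv (vth al f)) = fh F f) by apply VI.
  assert (V3 : forall f, lft (vinv (vth al f)) = vid (fo F (hs f))) by apply VI.
  assert (V4 : forall f, rgt (vinv (vth al f)) = vid (fo F (ht f))) by apply VI.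
  apply is_vst_intro; cbn; intros.
  - split; bd.
  - repeat split; bd.
  - pose proof (vst_v h u) as e. rewrite !o, vunitl, vunitr in e by bd.
    rewrite vunitl, vunitr by bd. easy.
  - apply (@vcancel_r _ _ (vth al (f ;; g))); [apply i|bd|bd|].
    rewrite <- !svassoc by bd. rewrite vinvl by easy. rewrite <- (vst_hcomp h) by bd.
    rewrite svassoc by bd. rewrite interchange by bd. rewrite !vinvl by easy.
    rewrite svunitr by bd. rewrite <- sidh_hcomp by bd. rewrite svunitl by bd. easy.
  - apply (@vcancel_r _ _ (vth al (hid X))); [apply i|bd|bd|].
    rewrite <- !svassoc by bd. rewrite vinvl by easy. rewrite <- (vst_hid h) by bd.
    rewrite o. rewrite svunitr by bd. rewrite !sidv_unitl by bd. easy.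
  - apply (@vcancel_r _ _ (vth al (bot a))); [apply i|bd|bd|].
    rewrite <- !svassoc by bd. rewrite vinvl by easy. rewrite (vst_nat h).
    rewrite svassoc by bd. rewrite vinvl by easy. rewrite svunitr, svunitl by bd. easy.
Qed.
End Vst.

(** * Gluing one-variable transformations *)

(* A quasi-functor in two variables ranging over different double categories,
   without its axioms: [gP Y] is the functor in the first variable. *)
Record gq (A B C : dcat) : Type := Gq {
  gP : ob B -> psf A C;
  gQ : ob A -> psf B C;
  gx : hc A -> hc B -> sq C;
  gy : hc A -> vc B -> sq C;
  gz : vc A -> hc B -> sq C
}.

(** The formula of [tensor], with projections in place of pattern matching on pairs;
    [tensor_gtensor] identifies the two. *)
Definition gtensor (A B C : dcat) (S : gq A B C) : psf (dprod A B) C :=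
  @Psf (dprod A B) C
    (fun X => fo (gQ S (fst X)) (snd X))
    (fun f => fh (gP S (hs (snd f))) (fst f) ;; fh (gQ S (ht (fst f))) (snd f))
    (fun u => fv (gP S (vs (snd u))) (fst u) // fv (gQ S (vt (fst u))) (snd u))
    (fun a =>
       (fs (gP S (hs (top (snd a)))) (fst a) </> gy S (bot (fst a)) (lft (snd a)))
       <|> (gz S (rgt (fst a)) (top (snd a)) </> fs (gQ S (ht (bot (fst a)))) (snd a)))
    (fun f g =>
       (sidh (fh (gP S (hs (snd f))) (fst f)) <|> gx S (fst g) (snd f)
          <|> sidh (fh (gQ S (ht (fst g))) (snd g)))
       </> (fcomp (gP S (hs (snd f))) (fst f) (fst g)
            <|> fcomp (gQ S (ht (fst g))) (snd f) (snd g)))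
    (fun X => funit (gP S (snd X)) (fst X) <|> funit (gQ S (fst X)) (snd X)).

(** Frames, invertibility and the commutation of 1v-cells, without coherence laws: enough for
    [gtensor S] to satisfy [is_ppsf], and so to be the source or target of a glued
    transformation. *)
Record is_gq (A B C : dcat) (S : gq A B C) : Prop := {
  gq_P : forall Y, is_ppsf (gP S Y);
  gq_Q : forall X, is_ppsf (gQ S X);
  gq_o : forall X Y, fo (gP S Y) X = fo (gQ S X) Y;
  gq_x : forall f g,
    hglob (fh (gQ S (hs f)) g ;; fh (gP S (ht g)) f)
          (fh (gP S (hs g)) f ;; fh (gQ S (ht f)) g) (gx S f g) /\
    vinvertible (gx S f g);
  gq_y : forall f u, framed (fh (gP S (vs u)) f) (fh (gP S (vt u)) f)
    (fv (gQ S (hs f)) u) (fv (gQ S (ht f)) u) (gy S f u);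
  gq_z : forall u f, framed (fh (gQ S (vs u)) f) (fh (gQ S (vt u)) f)
    (fv (gP S (hs f)) u) (fv (gP S (ht f)) u) (gz S u f);
  gq_v : forall U u, fv (gP S (vs u)) U // fv (gQ S (vt U)) u =
    fv (gQ S (vs U)) u // fv (gP S (vt u)) U
}.
Existing Class is_gq.
Global Hint Mode is_gq - - - ! : typeclass_instances.
Global Hint Extern 3 (is_ppsf (gP _ _)) => apply gq_P : typeclass_instances.
Global Hint Extern 3 (is_ppsf (gQ _ _)) => apply gq_Q : typeclass_instances.

Section GqBoundaries.
Context {A B C : dcat} {hA : is_double_category A} {hB : is_double_category B}
  {hC : is_double_category C} (S : gq A B C) {hS : is_gq S}.
Lemma fo_gP X Y : fo (gP S Y) X = fo (gQ S X) Y. Proof. apply hS. Qed.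
Lemma top_gx f g : top (gx S f g) = fh (gQ S (hs f)) g ;; fh (gP S (ht g)) f.
Proof. apply (gq_x hS f g). Qed.
Lemma bot_gx f g : bot (gx S f g) = fh (gP S (hs g)) f ;; fh (gQ S (ht f)) g.
Proof. apply (gq_x hS f g). Qed.
Lemma lft_gx f g : lft (gx S f g) = vid (fo (gQ S (hs f)) (hs g)).
Proof.
  destruct (gq_x hS f g) as [(_ & _ & -> & _) _].
  rewrite hs_hcomp; [bd|]. rewrite ht_fh, hs_fh, fo_gP by bd; reflexivity.
Qed.
Lemma rgt_gx f g : rgt (gx S f g) = vid (fo (gQ S (ht f)) (ht g)).
Proof.
  destruct (gq_x hS f g) as [(_ & _ & _ & ->) _].
  rewrite ht_hcomp; [rewrite ht_fh, fo_gP by bd; reflexivity|].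
  rewrite ht_fh, hs_fh, fo_gP by bd; reflexivity.
Qed.
Lemma vinvertible_gx f g : vinvertible (gx S f g). Proof. apply (gq_x hS f g). Qed.
Lemma top_gy f u : top (gy S f u) = fh (gP S (vs u)) f. Proof. apply hS. Qed.
Lemma bot_gy f u : bot (gy S f u) = fh (gP S (vt u)) f. Proof. apply hS. Qed.
Lemma lft_gy f u : lft (gy S f u) = fv (gQ S (hs f)) u. Proof. apply hS. Qed.
Lemma rgt_gy f u : rgt (gy S f u) = fv (gQ S (ht f)) u. Proof. apply hS. Qed.
Lemma top_gz u f : top (gz S u f) = fh (gQ S (vs u)) f. Proof. apply hS. Qed.
Lemma bot_gz u f : bot (gz S u f) = fh (gQ S (vt u)) f. Proof. apply hS. Qed.
Lemma lft_gz u f : lft (gz S u f) = fv (gP S (hs f)) u. Proof. apply hS. Qed.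
Lemma rgt_gz u f : rgt (gz S u f) = fv (gP S (ht f)) u. Proof. apply hS. Qed.
Lemma gq_swap X Y U u : X = vs U -> Y = vt u ->
  fv (gQ S X) u // fv (gP S Y) U = fv (gP S (vs u)) U // fv (gQ S (vt U)) u.
Proof. intros -> ->. symmetry. apply hS. Qed.
End GqBoundaries.

Ltac bdgq :=
  match goal with
  | |- context [fo (gP _ _) _] => rewrite fo_gP by bd
  | |- context [top (gx _ _ _)] => rewrite top_gx by bd
  | |- context [bot (gx _ _ _)] => rewrite bot_gx by bd
  | |- context [lft (gx _ _ _)] => rewrite lft_gx by bd
  | |- context [rgt (gx _ _ _)] => rewrite rgt_gx by bd
  | |- context [top (gy _ _ _)] => rewrite top_gy by bd
  | |- context [bot (gy _ _ _)] => rewrite bot_gy by bd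
  | |- context [lft (gy _ _ _)] => rewrite lft_gy by bd
  | |- context [rgt (gy _ _ _)] => rewrite rgt_gy by bd
  | |- context [top (gz _ _ _)] => rewrite top_gz by bd
  | |- context [bot (gz _ _ _)] => rewrite bot_gz by bd
  | |- context [lft (gz _ _ _)] => rewrite lft_gz by bd
  | |- context [rgt (gz _ _ _)] => rewrite rgt_gz by bd
  | |- context [fv (gQ _ _) _ // fv (gP _ _) _] => rewrite gq_swap by bd
  end.
Ltac bdstepq ::= bdgq.
Ltac vi_gq :=
  lazymatch goal with
  | |- vinvertible (gx _ _ _) => apply vinvertible_gx; bd
  end.
Ltac vi_extra ::= vi_gq.

Section Gluing.
Context {A B C : dcat} {hA : is_double_category A} {hB : is_double_category B}
  {hC : is_double_category C}.

Lemma is_ppsf_gtensor (S : gq A B C) {hS : is_gq S} : is_ppsf (gtensor S).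
Proof.
  split; cbn; intros;
    repeat match goal with x : _ * _ |- _ => destruct x end; cbn in *;
    repeat match goal with h : (_, _) = (_, _) |- _ => injection h as ? ? end.
  - split; bd.
  - split; bd.
  - repeat split; bd.
  - bd.
  (* The composite of two pairs of 1v-cells interleaves the variables; [gq_swap], which expresses
     the trivial cells at two 1v-cells, exchanges the inner factors. *)
  - rewrite !fv_vcomp by bd. rewrite !vassoc by bd.
    rewrite <- (vassoc (u := fv (gP S (vs v2)) v1) (v := fv (gQ S (vt v1)) v2)) by bd.
    rewrite gq_swap by bd. bd.
  - split; [repeat split; bd|].
    match goal with |- exists b, vinverse ?a b => change (vinvertible a) end. vi.
  - split; [repeat split; bd|].
    match goal with |- exists b, vinverse ?a b => change (vinvertible a) end. vi.
Qed.

Definition glue (a1 : ob B -> vst A C) (a2 : ob A -> vst B C) : vst (dprod A B) C :=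
  @Vst (dprod A B) C (fun X => vto (a1 (snd X)) (fst X))
    (fun f => vth (a1 (hs (snd f))) (fst f) <|> vth (a2 (ht (fst f))) (snd f)).

(** Composing (K,k) with (K',k') requires K' to pass k, and the hypothesis on [gx] says that the
    components are compatible with this passage. The hypotheses on [gy] and [gz] play the same role
    for naturality at pairs of squares. *)
Lemma is_vst_glue (S T : gq A B C) {hS : is_gq S} {hT : is_gq T} a1 a2 :
  (forall Y, is_vst (gP S Y) (gP T Y) (a1 Y)) ->
  (forall X, is_vst (gQ S X) (gQ T X) (a2 X)) ->
  (forall X Y, vto (a2 X) Y = vto (a1 Y) X) ->
  (forall f g, gx S f g </> (vth (a1 (hs g)) f <|> vth (a2 (ht f)) g)
     = (vth (a2 (hs f)) g <|> vth (a1 (ht g)) f) </> gx T f g) ->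
  (forall f u, gy S f u </> vth (a1 (vt u)) f = vth (a1 (vs u)) f </> gy T f u) ->
  (forall u f, gz S u f </> vth (a2 (vt u)) f = vth (a2 (vs u)) f </> gz T u f) ->
  is_vst (gtensor S) (gtensor T) (glue a1 a2).
Proof.
  intros h1 h2 ho hx hy hz.
  assert (t1 : forall Y X, vs (vto (a1 Y) X) = fo (gQ S X) Y) by (intros; rewrite (vst_vs (h1 Y)); bd).
  assert (t2 : forall Y X, vt (vto (a1 Y) X) = fo (gQ T X) Y) by (intros; rewrite (vst_vt (h1 Y)); bd).
  assert (t3 : forall Y f, top (vth (a1 Y) f) = fh (gP S Y) f) by (intros; apply (vst_top (h1 Y))).
  assert (t4 : forall Y f, bot (vth (a1 Y) f) = fh (gP T Y) f) by (intros; apply (vst_bot (h1 Y))).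
  assert (t5 : forall Y f, lft (vth (a1 Y) f) = vto (a1 Y) (hs f)) by (intros; apply (vst_lft (h1 Y))).
  assert (t6 : forall Y f, rgt (vth (a1 Y) f) = vto (a1 Y) (ht f)) by (intros; apply (vst_rgt (h1 Y))).
  assert (s3 : forall Y f, top (vth (a2 Y) f) = fh (gQ S Y) f) by (intros; apply (vst_top (h2 Y))).
  assert (s4 : forall Y f, bot (vth (a2 Y) f) = fh (gQ T Y) f) by (intros; apply (vst_bot (h2 Y))).
  assert (s5 : forall Y f, lft (vth (a2 Y) f) = vto (a2 Y) (hs f)) by (intros; apply (vst_lft (h2 Y))).
  assert (s6 : forall Y f, rgt (vth (a2 Y) f) = vto (a2 Y) (ht f)) by (intros; apply (vst_rgt (h2 Y))).
  pose proof (is_ppsf_gtensor (S := S)) as pS. pose proof (is_ppsf_gtensor (S := T)) as pT.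
  assert (v1 : forall Y u, vto (a1 Y) (vs u) // fv (gP T Y) u = fv (gP S Y) u // vto (a1 Y) (vt u))
    by (intros; eapply vst_v; eauto).
  assert (v2 : forall X u, vto (a2 X) (vs u) // fv (gQ T X) u = fv (gQ S X) u // vto (a2 X) (vt u))
    by (intros; eapply vst_v; eauto).
  apply is_vst_intro; cbn.
  - intros [X Y]; cbn. split; bd.
  - intros [f g]; cbn. repeat split; bd.
  - intros [U u]; cbn. rewrite vassoc, v1 by bd. rewrite <- !vassoc by bd.
    rewrite <- !ho, v2 by bd. easy.
  - intros [K k] [K' k'] e; cbn in *. injection e as e1 e2.
    pose proof (vst_hcomp (h1 (hs k)) e1) as E1.
    pose proof (vst_hcomp (h2 (ht K')) e2) as E2.
    rewrite hs_hcomp, ht_hcomp by bd.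
    rewrite <- !svassoc by bd. rewrite (interchange (a := fcomp (gP S _) _ _)) by bd.
    rewrite <- E1, <- E2. rewrite <- interchange by bd. rewrite !svassoc by bd.
    f_equal. rewrite !shassoc by bd.
    (* Of the four columns only the inner two, those of k and K', differ between the sides;
       bracketing them together exposes [hx]. *)
    rewrite <- (shassoc (a := vth (a1 (hs k)) K) (b := vth (a2 _) k)) by bd.
    rewrite <- (shassoc (a := vth (a1 (hs k)) K) (b := vth (a1 _) K')) by bd.
    rewrite !interchange by bd. rewrite e1, <- e2, <- hx.
    rewrite !svunitl, !svunitr by bd. easy.
  - intros [X Y]; cbn.
    pose proof (vst_hid (h1 Y) X) as E1. pose proof (vst_hid (h2 X) Y) as E2.
    rewrite hs_hid, ht_hid by bd.
    rewrite interchange by bd. rewrite <- E1, <- E2, ho.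
    rewrite <- interchange by bd. rewrite shunitl by bd. easy.
  - intros [s d]; cbn.
    assert (E1 := fun Y f g => @vst_nat' _ _ _ _ _ _ (h1 Y) _ _ _ s f g).
    assert (E2 := fun Y f g => @vst_nat' _ _ _ _ _ _ (h2 Y) _ _ _ d f g).
    rewrite !interchange by bd. f_equal.
    + rewrite hs_bot, hs_top by bd. rewrite <- svassoc by bd. rewrite hy.
      rewrite !svassoc by bd. rewrite (E1 _ (top s)) by bd. easy.
    + rewrite ht_bot, ht_top by bd. rewrite <- svassoc by bd. rewrite (E2 _ (top d)) by bd.
      rewrite !svassoc by bd. rewrite hz. easy.
Qed.
End Gluing.

(** * Quasi-functors and their tensor products *)

Existing Class is_quasi.
Global Hint Mode is_quasi - ! : typeclass_instances.

Section QuasiBoundaries.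
Context {B : dcat} {hB : is_double_category B} (H : quasi B) {hH : is_quasi H}.

Global Instance is_psf_bl X : is_psf (bl H X). Proof. apply (q_bin hH). Qed.
Global Instance is_psf_br Y : is_psf (br H Y). Proof. apply (q_bin hH). Qed.
Lemma fo_br X Y : fo (br H Y) X = fo (bl H X) Y. Proof. symmetry; apply (q_bin hH). Qed.
Lemma top_qkk K k : top (qkk H K k) = fh (bl H (hs K)) k ;; fh (br H (ht k)) K.
Proof. apply (hpt_h (q_hl hH K) k). Qed.
Lemma bot_qkk K k : bot (qkk H K k) = fh (br H (hs k)) K ;; fh (bl H (ht K)) k.
Proof. apply (hpt_h (q_hl hH K) k). Qed.
Lemma lft_qkk K k : lft (qkk H K k) = vid (fo (bl H (hs K)) (hs k)).
Proof.
  destruct (hpt_h (q_hl hH K) k) as [(_ & _ & e & _) _]; cbn in e. rewrite e.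
  rewrite hs_hcomp; [bd|]. rewrite ht_fh, hs_fh, fo_br by bd. easy.
Qed.
Lemma rgt_qkk K k : rgt (qkk H K k) = vid (fo (bl H (ht K)) (ht k)).
Proof.
  destruct (hpt_h (q_hl hH K) k) as [(_ & _ & _ & e) _]; cbn in e. rewrite e.
  rewrite ht_hcomp; [rewrite ht_fh, fo_br by bd; easy|].
  rewrite ht_fh, hs_fh, fo_br by bd. easy.
Qed.
Lemma vinvertible_qkk K k : vinvertible (qkk H K k).
Proof. apply (hpt_h (q_hl hH K) k). Qed.
Lemma top_qku K u : top (qku H K u) = fh (br H (vs u)) K.
Proof. apply (hpt_v (q_hl hH K) u). Qed.
Lemma bot_qku K u : bot (qku H K u) = fh (br H (vt u)) K.
Proof. apply (hpt_v (q_hl hH K) u). Qed.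
Lemma lft_qku K u : lft (qku H K u) = fv (bl H (hs K)) u.
Proof. apply (hpt_v (q_hl hH K) u). Qed.
Lemma rgt_qku K u : rgt (qku H K u) = fv (bl H (ht K)) u.
Proof. apply (hpt_v (q_hl hH K) u). Qed.
Lemma top_quk U k : top (quk H U k) = fh (bl H (vs U)) k.
Proof. apply (hpt_v (q_hr hH k) U). Qed.
Lemma bot_quk U k : bot (quk H U k) = fh (bl H (vt U)) k.
Proof. apply (hpt_v (q_hr hH k) U). Qed.
Lemma lft_quk U k : lft (quk H U k) = fv (br H (hs k)) U.
Proof. apply (hpt_v (q_hr hH k) U). Qed.
Lemma rgt_quk U k : rgt (quk H U k) = fv (br H (ht k)) U.
Proof. apply (hpt_v (q_hr hH k) U). Qed.
Lemma quv U u :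
  fv (br H (vs u)) U // fv (bl H (vt U)) u = fv (bl H (vs U)) u // fv (br H (vt u)) U.
Proof. apply (vst_v (q_vl hH U) u). Qed.
Lemma quv_swap X Y U u : X = vs U -> Y = vt u ->
  fv (bl H X) u // fv (br H Y) U = fv (br H (vs u)) U // fv (bl H (vt U)) u.
Proof. intros -> ->; symmetry; apply quv. Qed.
End QuasiBoundaries.

Ltac bdq :=
  match goal with
  | |- context [fo (br _ _) _] => rewrite fo_br by bd
  | |- context [bo _ _ _] => unfold bo
  | |- context [top (qkk _ _ _)] => rewrite top_qkk by bd
  | |- context [bot (qkk _ _ _)] => rewrite bot_qkk by bd
  | |- context [lft (qkk _ _ _)] => rewrite lft_qkk by bd
  | |- context [rgt (qkk _ _ _)] => rewrite rgt_qkk by bd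
  | |- context [top (qku _ _ _)] => rewrite top_qku by bd
  | |- context [bot (qku _ _ _)] => rewrite bot_qku by bd
  | |- context [lft (qku _ _ _)] => rewrite lft_qku by bd
  | |- context [rgt (qku _ _ _)] => rewrite rgt_qku by bd
  | |- context [top (quk _ _ _)] => rewrite top_quk by bd
  | |- context [bot (quk _ _ _)] => rewrite bot_quk by bd
  | |- context [lft (quk _ _ _)] => rewrite lft_quk by bd
  | |- context [rgt (quk _ _ _)] => rewrite rgt_quk by bd
  | |- context [fv (bl _ _) _ // fv (br _ _) _] => rewrite quv_swap by bd
  end.
Ltac bdstepq ::= first [bdgq | bdq].
Ltac vi_quasi :=
  lazymatch goal with
  | |- vinvertible (qkk _ _ _) => apply vinvertible_qkk; bd
  end.
Ltac vi_extra ::= first [vi_gq | vi_quasi].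

Section QuasiLaws.
Context {B : dcat} {hB : is_double_category B} (H : quasi B) {hH : is_quasi H}.

Lemma qkk_comp_r K k k' : ht k = hs k' ->
  (fcomp (bl H (hs K)) k k' <|> sidh (fh (br H (ht k')) K)) </> qkk H K (k ;; k')
  = (sidh (fh (bl H (hs K)) k) <|> qkk H K k')
    </> (qkk H K k <|> sidh (fh (bl H (ht K)) k'))
    </> (sidh (fh (br H (hs k)) K) <|> fcomp (bl H (ht K)) k k').
Proof. apply (hpt_hcomp (q_hl hH K)). Qed.

(** The axiom in the first variable belongs to [hpt_r], whose globular cells are the inverses of
    [qkk]; cancelling these gives a law for [qkk] itself. *)
Lemma qkk_comp_l K K' k : ht K = hs K' ->
  (sidh (fh (bl H (hs K)) k) <|> fcomp (br H (ht k)) K K') </> qkk H (K ;; K') k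
  = (qkk H K k <|> sidh (fh (br H (ht k)) K'))
    </> (sidh (fh (br H (hs k)) K) <|> qkk H K' k)
    </> (fcomp (br H (hs k)) K K' <|> sidh (fh (bl H (ht K')) k)).
Proof.
  intros e. pose proof (hpt_hcomp (q_hr hH k) e) as E; cbn in E.
  apply (@vcancel_r _ _ (vinv (qkk H (K ;; K') k))); [bd..|].
  rewrite <- !(svassoc (c := vinv _)) by bd. rewrite E. rewrite vinvr, svunitr by bd.
  rewrite !svassoc by bd.
  rewrite <- (svassoc (b := _ <|> qkk H K' k)) by bd.
  rewrite (interchange (b := qkk H K' k)) by bd. rewrite vinvr, svunitr by bd.
  rewrite top_qkk, <- e, sidh_hcomp, shassoc, <- 2sidh_hcomp by bd.
  rewrite svunitr by bd. rewrite interchange, vinvr, svunitr by bd. rewrite <- (sidh_hcomp (f := top _)), svunitl by bd. easy.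
Qed.

Lemma qkk_hid_r K Y :
  (funit (bl H (hs K)) Y <|> sidh (fh (br H Y) K)) </> qkk H K (hid Y)
  = sidh (fh (br H Y) K) <|> funit (bl H (ht K)) Y.
Proof. apply (hpt_hid (q_hl hH K)). Qed.

Lemma qkk_hid_l X k :
  (sidh (fh (bl H X) k) <|> funit (br H (ht k)) X) </> qkk H (hid X) k
  = funit (br H (hs k)) X <|> sidh (fh (bl H X) k).
Proof.
  pose proof (hpt_hid (q_hr hH k) X) as E; cbn in E.
  apply (@vcancel_r _ _ (vinv (qkk H (hid X) k))); [bd..|].
  rewrite E. rewrite <- svassoc, vinvr, svunitr by bd. easy.
Qed.

Lemma qkk_nat_r K d :
  (fs (bl H (hs K)) d <|> qku H K (rgt d)) </> qkk H K (bot d)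
  = qkk H K (top d) </> (qku H K (lft d) <|> fs (bl H (ht K)) d).
Proof. apply (hpt_nat (q_hl hH K)). Qed.

Lemma qkk_nat_l s k :
  (quk H (lft s) k <|> fs (br H (ht k)) s) </> qkk H (bot s) k
  = qkk H (top s) k </> (fs (br H (hs k)) s <|> quk H (rgt s) k).
Proof. apply (mod_h (q_ml hH s) k). Qed.

Lemma qku_vcomp K u v : vt u = vs v -> qku H K (u // v) = qku H K u </> qku H K v.
Proof. apply (hpt_vcomp (q_hl hH K)). Qed.
Lemma qku_vid K Y : qku H K (vid Y) = sidh (fh (br H Y) K).
Proof. apply (hpt_vid (q_hl hH K)). Qed.
Lemma quk_vcomp U V k : vt U = vs V -> quk H (U // V) k = quk H U k </> quk H V k.
Proof. apply (hpt_vcomp (q_hr hH k)). Qed.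
Lemma quk_vid X k : quk H (vid X) k = sidh (fh (bl H X) k).
Proof. apply (hpt_vid (q_hr hH k)). Qed.
Lemma qku_comp K K' u : ht K = hs K' ->
  (qku H K u <|> qku H K' u) </> fcomp (br H (vt u)) K K'
  = fcomp (br H (vs u)) K K' </> qku H (K ;; K') u.
Proof. apply (vst_hcomp (q_vr hH u)). Qed.
Lemma quk_comp U k k' : ht k = hs k' ->
  (quk H U k <|> quk H U k') </> fcomp (bl H (vt U)) k k'
  = fcomp (bl H (vs U)) k k' </> quk H U (k ;; k').
Proof. apply (vst_hcomp (q_vl hH U)). Qed.
Lemma qku_hid X u : sidv (fv (bl H X) u) </> funit (br H (vt u)) X
  = funit (br H (vs u)) X </> qku H (hid X) u.
Proof. apply (vst_hid (q_vr hH u) X). Qed.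
Lemma quk_hid U Y : sidv (fv (br H Y) U) </> funit (bl H (vt U)) Y
  = funit (bl H (vs U)) Y </> quk H U (hid Y).
Proof. apply (vst_hid (q_vl hH U) Y). Qed.
Lemma qku_nat s u : fs (br H (vs u)) s </> qku H (bot s) u
  = qku H (top s) u </> fs (br H (vt u)) s.
Proof. apply (vst_nat (q_vr hH u)). Qed.
Lemma quk_nat U d : fs (bl H (vs U)) d </> quk H U (bot d)
  = quk H U (top d) </> fs (bl H (vt U)) d.
Proof. apply (vst_nat (q_vl hH U)). Qed.
End QuasiLaws.

Lemma is_psf_eq {A B : dcat} {hA : is_double_category A} (F G : psf A B) :
  psf_eq F G -> is_psf F -> is_psf G.
Proof.
  intros (e1 & e2 & e3 & e4 & e5 & e6) h.
  split; intros.
  - rewrite <- !e1, <- !e2; now apply h.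
  - rewrite <- !e1, <- !e3; now apply h.
  - rewrite <- !e2, <- !e3, <- e4; now apply h.
  - rewrite <- !e1, <- !e3; now apply h.
  - rewrite <- !e3; now apply h.
  - rewrite <- !e2, <- e4; now apply h.
  - rewrite <- !e4; now apply h.
  - rewrite <- !e2, <- e5 by easy; now apply h.
  - rewrite <- !e1, <- e2, <- e6; now apply h.
  - rewrite <- !e4, <- !e5 by bd; now apply h.
  - rewrite <- !e6, <- !e3, <- e4; now apply h.
  - rewrite <- !e2, <- !e5 by bd; now apply h.
  - rewrite <- !e2, <- !e6, <- !e5 by bd; now apply h.
  - rewrite <- !e2, <- !e6, <- !e5 by bd; now apply h.
Qed.

Definition qgq (B : dcat) (H : quasi B) : gq B B B :=
  Gq (br H) (bl H) (qkk H) (qku H) (quk H).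

Section Tensor.
Context {B : dcat} {hB : is_double_category B} (H : quasi B) {hH : is_quasi H}.

Global Instance is_gq_quasi : is_gq (qgq H).
Proof.
  split; cbn; intros; try typeclasses eauto.
  - bd.
  - split; [repeat split; bd | vi].
  - repeat split; bd.
  - repeat split; bd.
  - apply quv; bd.
Qed.

Section Assoc.
Variables (K1 K2 K3 k1 k2 k3 : hc B) (e1 : ht K1 = hs K2) (e2 : ht K2 = hs K3)
  (f1 : ht k1 = hs k2) (f2 : ht k2 = hs k3).
Local Notation p1 := (sidh (fh (br H (hs k1)) K1)).
Local Notation q1 := (sidh (fh (bl H (ht K1)) k1)).
Local Notation q1' := (sidh (fh (bl H (ht K2)) k1)).
Local Notation q1'' := (sidh (fh (bl H (ht K3)) k1)).
Local Notation p2'' := (sidh (fh (br H (hs k1)) K2)).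
Local Notation p3'' := (sidh (fh (br H (hs k1)) K3)).
Local Notation p2 := (sidh (fh (br H (hs k2)) K2)).
Local Notation q2 := (sidh (fh (bl H (ht K2)) k2)).
Local Notation q2' := (sidh (fh (bl H (ht K3)) k2)).
Local Notation p3 := (sidh (fh (br H (hs k3)) K3)).
Local Notation p3' := (sidh (fh (br H (hs k2)) K3)).
Local Notation q3 := (sidh (fh (bl H (ht K3)) k3)).
Local Notation x21 := (qkk H K2 k1).
Local Notation x32 := (qkk H K3 k2).
Local Notation x31 := (qkk H K3 k1).
Local Notation c := (fcomp (br H (hs k1))).
Local Notation d := (fcomp (bl H (ht K3))).

(** This lemma and [assoc_rhs] bring both bracketings of the compositors of the tensor product to
    one normal form: the exchange cells [x21] and [x32], then [x31], then all compositors of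
    one-variable functors. Associativity is thereby reduced to that of [br] and [bl]. Here the
    compositor of k1 and k2 is moved past K3 by [qkk_comp_r]. *)
Lemma assoc_lhs :
  (((p1 <|> x21 <|> q2) </> (c K1 K2 <|> fcomp (bl H (ht K2)) k1 k2)) <|> (p3 <|> q3))
  </> ((sidh (fh (br H (hs k1)) (K1 ;; K2)) <|> qkk H K3 (k1 ;; k2) <|> q3)
      </> (c (K1 ;; K2) K3 <|> d (k1 ;; k2) k3))
  = (p1 <|> x21 <|> x32 <|> q3) </> (p1 <|> p2'' <|> x31 <|> q2' <|> q3)
    </> (((c K1 K2 <|> p3'') </> c (K1 ;; K2) K3) <|> ((d k1 k2 <|> q3) </> d (k1 ;; k2) k3)).
Proof.
  pose proof (qkk_comp_r (H:=H) K3 f1) as E.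
  transitivity ((p1 <|> x21 <|> q2 <|> p3 <|> q3) </>
    ((c K1 K2 <|> ((fcomp (bl H (ht K2)) k1 k2 <|> p3) </> qkk H K3 (k1 ;; k2)) <|> q3)
     </> (c (K1 ;; K2) K3 <|> d (k1 ;; k2) k3))).
  { rewrite svassoc by bd. rewrite (svassoc (a := p1 <|> x21 <|> q2 <|> p3 <|> q3)) by bd. f_equal.
    transitivity (((p1 <|> x21 <|> q2) <|> (p3 <|> q3)) </>
     ((c K1 K2 <|> fcomp (bl H (ht K2)) k1 k2 <|> p3 <|> q3) </>
     (sidh (fh (br H (hs k1)) (K1 ;; K2)) <|> qkk H K3 (k1 ;; k2) <|> q3))).
    - rewrite svassoc by bd. f_equal. rewrite <- (shassoc (b := p3)) by bd.
      rewrite (interchange (b := p3 <|> q3)) by bd. rewrite (interchange (a := p3)), !svunitl by bd. easy.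
    - rewrite !shassoc by bd. f_equal. rewrite <- (shassoc (a := c K1 K2)) by bd. cols. easy. }
  rewrite <- e2, f2 in E. rewrite E. clear E.
  transitivity ((p1 <|> x21 <|> q2 <|> p3 <|> q3) </>
    ((((p1 <|> p2'') <|> (q1' <|> x32) <|> q3) </> ((p1 <|> p2'') <|> (x31 <|> q2') <|> q3)
    </> (c K1 K2 <|> (p3'' <|> d k1 k2) <|> q3)) </> (c (K1 ;; K2) K3 <|> d (k1 ;; k2) k3))).
  { do 2 f_equal. cols. easy. }
  repeat vas. rewrite <- (svassoc (c := c _ _ <|> d _ _)) by bd.
  repeat has. f_equal; [f_equal|].
  - rewrite <- (shassoc (b := q2)) by bd. rewrite <- (shassoc (a := p1) (b := p2'')) by bd.
    cols. easy.
  - rewrite <- (shassoc (c := q3)) by bd. cols. easy.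
Qed.

(** On this side it is the compositor of K2 and K3 that is moved past k1, by [qkk_comp_l]. *)
Lemma assoc_rhs :
  ((p1 <|> q1) <|> ((p2 <|> x32 <|> q3) </> (fcomp (br H (hs k2)) K2 K3 <|> d k2 k3)))
  </> ((p1 <|> qkk H (K2 ;; K3) k1 <|> sidh (fh (bl H (ht K3)) (k2 ;; k3)))
      </> (c K1 (K2 ;; K3) <|> d k1 (k2 ;; k3)))
  = (p1 <|> x21 <|> x32 <|> q3) </> (p1 <|> p2'' <|> x31 <|> q2' <|> q3)
    </> (((p1 <|> c K2 K3) </> c K1 (K2 ;; K3)) <|> ((q1'' <|> d k2 k3) </> d k1 (k2 ;; k3))).
Proof.
  pose proof (qkk_comp_l (H:=H) k1 e2) as E. rewrite <- e1, f1 in E.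
  transitivity ((p1 <|> q1 <|> p2 <|> x32 <|> q3) </>
    ((p1 <|> ((q1 <|> fcomp (br H (hs k2)) K2 K3) </> qkk H (K2 ;; K3) k1) <|> d k2 k3)
     </> (c K1 (K2 ;; K3) <|> d k1 (k2 ;; k3)))).
  { repeat vas. f_equal.
    transitivity (((p1 <|> q1) <|> (p2 <|> x32 <|> q3)) </>
     ((p1 <|> q1 <|> fcomp (br H (hs k2)) K2 K3 <|> d k2 k3) </>
     (p1 <|> qkk H (K2 ;; K3) k1 <|> sidh (fh (bl H (ht K3)) (k2 ;; k3))))).
    - repeat vas. f_equal. rewrite <- (shassoc (c := d k2 k3)) by bd. cols. easy.
    - repeat has. f_equal. rewrite <- (shassoc (a := p1) (b := q1)) by bd. cols. easy. }
  rewrite E. clear E.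
  transitivity ((p1 <|> q1 <|> p2 <|> x32 <|> q3) </>
    (((p1 <|> (x21 <|> p3') <|> (q2' <|> q3)) </> (p1 <|> (p2'' <|> x31) <|> (q2' <|> q3))
    </> (p1 <|> (c K2 K3 <|> q1'') <|> d k2 k3)) </> (c K1 (K2 ;; K3) <|> d k1 (k2 ;; k3)))).
  { do 2 f_equal. cols. easy. }
  repeat vas. rewrite <- (svassoc (c := c _ _ <|> d _ _)) by bd.
  repeat has. f_equal; [f_equal|].
  - rewrite <- (shassoc (b := q1)) by bd. rewrite <- (shassoc (b := p3')) by bd. cols. easy.
  - rewrite <- (shassoc (c := d k2 k3)) by bd. cols. easy.
Qed.
End Assoc.

(** By [qkk_hid_r] the exchange of K with an identity only slides the unitor across K; the unit laws
    of [br] and [bl] then apply side by side. *)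
Lemma unit_l K k :
  (((funit (br H (hs k)) (hs K) <|> funit (bl H (hs K)) (hs k)) <|>
     (sidh (fh (br H (hs k)) K) <|> sidh (fh (bl H (ht K)) k)))
  </> ((sidh (fh (br H (hs k)) (hid (hs K))) <|> qkk H K (hid (hs k))
         <|> sidh (fh (bl H (ht K)) k))
       </> (fcomp (br H (hs k)) (hid (hs K)) K <|> fcomp (bl H (ht K)) (hid (hs k)) k)))
  = sidh (fh (br H (hs k)) K) <|> sidh (fh (bl H (ht K)) k).
Proof.
  pose proof (qkk_hid_r (H:=H) K (hs k)) as E.
  repeat vas. repeat has.
  rewrite <- (shassoc (a := funit (br H (hs k)) (hs K))) by bd.
  rewrite (interchange (d := sidh (fh (bl H (ht K)) k))), (interchange (d := qkk _ _ _)), E by bd. cols. repeat has.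
  rewrite <- (shassoc (c := sidh (fh (bl H (ht K)) k))) by bd. rewrite interchange by bd.
  f_equal; [apply (psf_unitl (is_psf_br (H:=H) (hs k)))|].
  apply (psf_unitl (is_psf_bl (H:=H) (ht K)) k).
Qed.

Lemma unit_r K k :
  ((sidh (fh (br H (hs k)) K) <|> sidh (fh (bl H (ht K)) k)) <|>
    (funit (br H (ht k)) (ht K) <|> funit (bl H (ht K)) (ht k)))
  </> ((sidh (fh (br H (hs k)) K) <|> qkk H (hid (ht K)) k
         <|> sidh (fh (bl H (ht K)) (hid (ht k))))
       </> (fcomp (br H (hs k)) K (hid (ht K)) <|> fcomp (bl H (ht K)) k (hid (ht k))))
  = sidh (fh (br H (hs k)) K) <|> sidh (fh (bl H (ht K)) k).
Proof.
  pose proof (qkk_hid_l (H:=H) (ht K) k) as E.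
  repeat vas. repeat has.
  rewrite <- (shassoc (b := sidh (fh (bl H (ht K)) k))) by bd.
  rewrite (interchange (b := funit _ _)), (interchange (d := qkk _ _ _)), E by bd. cols. repeat has.
  rewrite <- (shassoc (c := funit (bl H (ht K)) (ht k))) by bd. rewrite interchange by bd.
  f_equal; [apply (psf_unitr (is_psf_br (H:=H) (hs k)))|].
  apply (psf_unitr (is_psf_bl (H:=H) (ht K)) k).
Qed.

Instance is_psf_gtensor : is_psf (gtensor (qgq H)).
Proof.
  pose proof (is_ppsf_gtensor (S := qgq H)) as hp.
  split; try apply hp; cbn.
  - intros [K k]; cbn. rewrite !fs_sidh by bd.
    rewrite !top_sidh, !bot_sidh, lft_sidh, rgt_sidh, qku_vid, quk_vid by bd.
    rewrite !svunitl, sidh_hcomp by bd. easy.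
  - intros [s1 d1] [s2 d2] e; cbn in *. injection e as e1 e2.
    pose proof (svc_lft e1) as a1; pose proof (svc_rgt e1) as a2.
    pose proof (svc_lft e2) as b1; pose proof (svc_rgt e2) as b2.
    rewrite !fs_svc, !top_svc, !bot_svc, !lft_svc, !rgt_svc, qku_vcomp, quk_vcomp by bd.
    rewrite interchange by bd. repeat vas. f_equal.
    + rewrite <- !svassoc by bd. f_equal. rewrite !svassoc by bd. f_equal.
      pose proof (qku_nat (H:=H) s2 (lft d1)) as E.
      rewrite <- e1, b1, <- !hs_top in E by bd. exact E.
    + rewrite <- !svassoc by bd. f_equal. rewrite !svassoc by bd. f_equal.
      pose proof (quk_nat (H:=H) (rgt s2) d1) as E.
      rewrite e2, <- a2, <- !ht_bot in E by bd. now symmetry.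
  - intros [s1 d1] [s2 d2] e; cbn in *. injection e as e1 e2.
    rewrite !top_shc, !bot_shc, lft_shc, rgt_shc by bd.
    rewrite !hs_hcomp, !ht_hcomp by bd.
    pose proof (qkk_nat_l (H:=H) s2 (top d1)) as E1.
    pose proof (qkk_nat_r (H:=H) (bot s2) d1) as E2.
    (* The inner two blocks exchange by naturality of [qkk] in both variables: [E2] moves [d1] past
       the bottom of [s2], then [E1] moves [s2] past the top of [d1]. The equations [EP] and [EQ]
       treat the outer compositors. *)
    assert (E : ((quk H (rgt s1) (top d1) </> fs (bl H (ht (bot s1))) d1) <|>
      (fs (br H (hs (top d2))) s2 </> qku H (bot s2) (lft d2))) </> qkk H (bot s2) (bot d1)
      = qkk H (top s2) (top d1) </> ((fs (br H (hs (top d1))) s2 </> qku H (bot s2) (lft d1))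
       <|> (quk H (rgt s2) (top d1) </> fs (bl H (ht (bot s2))) d1))).
    { rewrite ?hs_top, ?hs_bot, ?ht_top, ?ht_bot, <- ?e1, <- ?e2 in *.
      rewrite <- interchange by bd. rewrite <- svassoc, E2, svassoc, E1, <- svassoc by bd.
      rewrite interchange by bd. easy. }
    repeat vas. repeat has.
    rewrite <- (shassoc (b := _ </> fs (bl H (ht (bot s1))) d1)) by bd.
    rewrite (interchange (c := _ <|> qkk _ _ _)), (interchange (d := qkk _ _ _)), E by bd.
    assert (EP : ((fs (br H (hs (top d1))) s1 </> qku H (bot s1) (lft d1)) <|>
        (fs (br H (hs (top d1))) s2 </> qku H (bot s2) (lft d1)))
      </> fcomp (br H (hs (bot d1))) (bot s1) (bot s2) =
      fcomp (br H (hs (top d1))) (top s1) (top s2)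
      </> (fs (br H (hs (top d1))) (s1 <|> s2) </> qku H (bot s1 ;; bot s2) (lft d1))).
    { rewrite hs_bot, hs_top by bd. rewrite <- interchange, <- svassoc, qku_comp by bd.
      rewrite !svassoc, <- fcomp_nat by bd. easy. }
    assert (EQ : ((quk H (rgt s2) (top d1) </> fs (bl H (ht (bot s2))) d1) <|>
        (quk H (rgt s2) (top d2) </> fs (bl H (ht (bot s2))) d2))
      </> fcomp (bl H (ht (bot s2))) (bot d1) (bot d2) =
      fcomp (bl H (ht (top s2))) (top d1) (top d2)
      </> (quk H (rgt s2) (top d1 ;; top d2) </> fs (bl H (ht (bot s2))) (d1 <|> d2))).
    { rewrite ht_bot, ht_top by bd. rewrite svassoc, <- quk_comp by bd.
      rewrite <- (svassoc (c := fs _ (_ <|> _))), <- fcomp_nat, svassoc, interchange by bd. easy. }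
    rewrite <- (svassoc (b := fcomp (br H _) _ _ <|> _)), (interchange (a := fcomp (br H _) _ _)),
      <- EP, <- EQ by bd.
    rewrite <- (interchange (c := fcomp (br H _) _ _)), svassoc by bd. f_equal.
    repeat has. rewrite <- (shassoc (b := fs _ s2 </> _)) by bd. cols. easy.
  - intros [U u]; cbn.
    rewrite sidv_vcomp, top_sidv, bot_sidv, lft_sidv, rgt_sidv by bd.
    rewrite !hs_hid, !ht_hid by bd.
    rewrite interchange by bd. rewrite (svassoc (a := funit (br _ _) _)) by bd.
    rewrite <- (psf_funit_nat (is_psf_br (H:=H) (vs u)) U).
    rewrite (svassoc (a := funit (bl _ _) _)), <- quk_hid by bd.
    rewrite <- !svassoc by bd. rewrite <- (qku_hid (H:=H)).
    rewrite <- (psf_funit_nat (is_psf_bl (H:=H) (vt U)) u).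
    rewrite !svassoc by bd. rewrite <- interchange by bd. f_equal.
    rewrite <- sidv_vcomp, shunitl by bd. easy.
  - intros [K1 k1] [K2 k2] [K3 k3] e f; cbn in *.
    injection e as e1 f1; injection f as e2 f2.
    rewrite ?(hs_hcomp (f := k1)), ?(hs_hcomp (f := k2)), ?(ht_hcomp (f := K1)),
     ?(ht_hcomp (f := K2)) by bd.
    rewrite !(sidh_hcomp (f := fh (br H _) _)) by bd.
    rewrite assoc_lhs, assoc_rhs by bd. f_equal. f_equal.
    + now apply (psf_assoc (is_psf_br (H:=H) (hs k1))).
    + now apply (psf_assoc (is_psf_bl (H:=H) (ht K3))).
  - intros [K k]; cbn. rewrite (sidh_hcomp (f := fh (br H _) _)) by bd.
    rewrite hs_hid by bd. apply unit_l.
  - intros [K k]; cbn. rewrite (sidh_hcomp (f := fh (br H _) _)) by bd.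
    rewrite ht_hid by bd. apply unit_r.
Qed.

Lemma tensor_gtensor : psf_eq (gtensor (qgq H)) (tensor H).
Proof.
  repeat split; cbn; intros; repeat match goal with x : _ * _ |- _ => destruct x end; easy.
Qed.

Global Instance is_psf_tensor : is_psf (tensor H).
Proof. eapply is_psf_eq; [apply tensor_gtensor | apply is_psf_gtensor]. Qed.
End Tensor.

(** * Compositors at several 1h-cells, and a functor applied to the tensor product *)

Section MultiCompositor.
Context {A B : dcat} {hA : is_double_category A} {hB : is_double_category B}
  (F : psf A B) {hF : is_psf F}.

(** By associativity, four images may be composed in pairs or from the middle pair outwards; the
    second order exposes the pair on which an exchange cell acts. *)
Lemma fcomp4 p q r s : ht p = hs q -> ht q = hs r -> ht r = hs s ->
  (fcomp F p q <|> fcomp F r s) </> fcomp F (p ;; q) (r ;; s)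
  = (sidh (fh F p) <|> fcomp F q r <|> sidh (fh F s))
    </> ((fcomp F p (q ;; r) <|> sidh (fh F s)) </> fcomp F (p ;; (q ;; r)) s).
Proof.
  intros e1 e2 e3. rewrite hassoc by bd.
  transitivity (((fcomp F p q <|> (sidh (fh F r) <|> sidh (fh F s))) </>
    (sidh (fh F (p ;; q)) <|> fcomp F r s)) </> fcomp F (p ;; q) (r ;; s)).
  { f_equal. cols. easy. }
  rewrite <- svassoc by bd. rewrite <- (psf_assoc hF) by bd.
  repeat vas. f_equal. repeat has.
  rewrite !interchange by bd. rewrite (psf_assoc hF) by bd. easy.
Qed.

(** Naturality in the middle entry of the nested compositor, in the shape that [fcomp4] produces. *)
Lemma fcomp_mid p s a f g :
  lft a = vid (ht p) -> rgt a = vid (hs s) -> top a = f -> bot a = g ->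
  ((fcomp F p f <|> sidh (fh F s)) </> fcomp F (p ;; f) s) </> fs F (sidh p <|> a <|> sidh s)
  = (sidh (fh F p) <|> fs F a <|> sidh (fh F s))
    </> ((fcomp F p g <|> sidh (fh F s)) </> fcomp F (p ;; g) s).
Proof.
  intros e1 e2 <- <-.
  assert (ht p = hs (top a)) by bd.
  assert (ht (top a) = hs s) by bd.
  assert (ht p = hs (bot a)) by bd.
  assert (ht (bot a) = hs s) by bd.
  rewrite <- svassoc by bd.
  rewrite <- (fcomp_nat' (F := F) (a := sidh p <|> a) (f' := p ;; bot a) (g' := s)) by bd.
  repeat vas. f_equal. rewrite !interchange by bd. rewrite fs_sidh by bd. cols. f_equal.
  rewrite <- (fcomp_nat' (F := F) (a := sidh p) (f' := p) (g' := bot a)) by bd.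
  rewrite fs_sidh by bd. easy.
Qed.
Lemma funit2 X : (funit F X <|> funit F X) </> fcomp F (hid X) (hid X) = funit F X.
Proof.
  pose proof (psf_unitl hF (hid X)) as e. rewrite hs_hid in e by bd.
  transitivity (((sidh (hid (fo F X)) <|> funit F X) </> (funit F X <|> sidh (fh F (hid X))))
    </> fcomp F (hid X) (hid X)); [f_equal; cols; easy|].
  rewrite <- svassoc, e, sidh_unitl, svunitr by bd. easy.
Qed.
End MultiCompositor.

Section Conj.
Context {B : dcat} {hB : is_double_category B} (H : quasi B) {hH : is_quasi H}.
Local Notation T := (tensor H).

Section Functor.
Context (F : psf B B) {hF : is_psf F}.

(** The quasi-functor H followed by [F]. The image of an exchange cell is framed by images of
    composites, hence the conjugation. [t12] of [left_ternary] is the case where [F] is [br H C],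
    and [t23] of [right_ternary] the case of [bl H X]. *)
Definition cgq : gq B B B := {|
  gP := fun Y => psf_comp (br H Y) F;
  gQ := fun X => psf_comp (bl H X) F;
  gx := fun K k => conjh F (fh (bl H (hs K)) k) (fh (br H (ht k)) K)
             (fh (br H (hs k)) K) (fh (bl H (ht K)) k) (qkk H K k);
  gy := fun K u => fs F (qku H K u);
  gz := fun U k => fs F (quk H U k) |}.

Instance is_gq_cgq : is_gq cgq.
Proof.
  split; cbn; intros; unfold conjh; try typeclasses eauto.
  - bd.
  - split; [repeat split; bd | vi].
  - repeat split; bd.
  - repeat split; bd.
  - rewrite <- !fv_vcomp by bd. now rewrite quv by bd.
Qed.

(** Compares the tensor product formed after applying [F] with the image under [F] of the tensor
    product. *)
Definition tcmp : vst (dprod B B) B :=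
  @Vst (dprod B B) B (fun X => vid (fo F (fo T X)))
    (fun f => fcomp F (fh (br H (hs (snd f))) (fst f)) (fh (bl H (ht (fst f))) (snd f))).

Lemma is_vst_tcmp : is_vst (gtensor cgq) (psf_comp T F) tcmp.
Proof.
  pose proof (is_ppsf_gtensor (S := cgq)).
  apply is_vst_intro; cbn.
  - intros [X Y]; cbn. split; bd.
  - intros [K k]; cbn. repeat split; bd.
  - intros [U u]; cbn. bd.
  - intros [K k] [K' k'] e; cbn in *. injection e as e1 e2.
    rewrite hs_hcomp, ht_hcomp by bd. unfold conjh.
    rewrite fs_svc by bd.
    (* Both sides are composed from the middle outwards. On the left the image of [qkk] passes the
       nested compositor by [fcomp_mid]; on the right the compositor of the inner pair cancels the
       trailing inverse in [conjh]. *)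
    rewrite svassoc, svassoc, fcomp4 by bd.
    rewrite <- (svassoc (c := fs F (_ <|> _ <|> _))) by bd.
    rewrite <- e1, <- e2.
    rewrite (fcomp_mid (F := F) (a := qkk H K' k)
      (g := fh (br H (hs k)) K' ;; fh (bl H (ht K')) k)) by bd.
    rewrite <- (interchange (c := fs F _)), <- (svassoc (b := _ </> (fs F _ <|> _))),
      <- (svassoc (b := fs F _ <|> _)) by bd.
    rewrite fcomp_nat' with (f := fh (br H (hs k)) K ;; fh (br H (hs k)) K')
      (g := fh (bl H (ht K')) k ;; fh (bl H (ht K')) k') by bd.
    rewrite (svassoc (b := fcomp F _ _)), fcomp4 by bd.
    repeat vas. do 3 f_equal. cols.
    rewrite <- (svassoc (b := vinv _)), vinvl, svunitr by bd. easy.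
  - intros [X Y]; cbn. rewrite sidv_unitl by bd.
    rewrite <- interchange, <- svassoc by bd.
    rewrite fcomp_nat' with (f := hid (fo (bl H X) Y)) (g := hid (fo (bl H X) Y)) by bd.
    rewrite svassoc, fo_br, funit2 by bd. easy.
  - intros [s d]; cbn.
    rewrite <- !fs_svc by bd. rewrite ?hs_top, ?hs_bot, ?ht_top, ?ht_bot.
    rewrite fcomp_nat' with (f := fh (br H (vs (lft d))) (top s)) (g := fh (bl H (vs (rgt s))) (top d)) by bd.
    easy.
Qed.
End Functor.
End Conj.

Ltac feq := lazymatch goal with
  | |- @eq (sq _) _ _ => first [reflexivity | progress f_equal; feq | bd]
  | |- @eq (psf _ _) _ _ => progress f_equal; feq
  | |- _ => bd
  end.

(** * The threefold tensor products as glued functors *)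

Section Ternary.
Context {B : dcat} {hB : is_double_category B} (H : quasi B) {hH : is_quasi H}.
Local Notation T := (tensor H).

(** The identity side makes the exchange square [quk] an identity, and [qku] is one because the left
    side of [sidh l] is; only the image of [a] remains beside an identity. *)
Lemma fs_tensor_sidh_r a l A : rgt a = vid A ->
  fs T (a, sidh l) = fs (br H (hs l)) a <|> sidh (fh (bl H (ht (bot a))) l).
Proof.
  intros e; cbn. rewrite top_sidh, lft_sidh, e, qku_vid, quk_vid, fs_sidh by bd.
  rewrite ht_bot, e, vt_vid by bd. cols. easy.
Qed.

Lemma fs_tensor_sidh_l K a A : lft a = vid A ->
  fs T (sidh K, a) = sidh (fh (br H (hs (top a))) K) <|> fs (bl H (ht K)) a.
Proof.
  intros e; cbn. rewrite bot_sidh, rgt_sidh, e, qku_vid, quk_vid, fs_sidh by bd.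
  rewrite hs_top, e, vs_vid by bd. cols. easy.
Qed.

(* T(T x 1), T(1 x (- x| Z)) and the source of the last step of Sigma, in the form [gtensor] *)
Definition gleft : gq (dprod B B) B B :=
  @Gq (dprod B B) B B (fun Z => psf_comp T (br H Z))
    (fun XY => bl H (bo H (fst XY) (snd XY)))
    (fun f l => qkk H (fh T f) l) (fun f w => qku H (fh T f) w)
    (fun U l => quk H (fv T U) l).

Definition gslide (Z : ob B) : gq B B B :=
  Gq (fun Y => br H (bo H Y Z)) (fun X => psf_comp (br H Z) (bl H X))
    (fun K k => qkk H K (fh (br H Z) k)) (fun K u => qku H K (fv (br H Z) u))
    (fun U k => quk H U (fh (br H Z) k)).

Definition gmid : gq (dprod B B) B B :=
  @Gq (dprod B B) B B (fun Z => psf_comp (psf_prod (psf_id B) (br H Z)) T)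
    (fun XY => psf_comp (bl H (snd XY)) (bl H (fst XY)))
    (fun f l => let K := fst f in let k := snd f in
       (qkk H K (fh (bl H (hs k)) l) <|> sidh (fh (bl H (ht K)) (fh (br H (ht l)) k)))
       </> (sidh (fh (br H (fo (br H (hs l)) (hs k))) K) <|>
            conjh (bl H (ht K)) (fh (bl H (hs k)) l) (fh (br H (ht l)) k)
             (fh (br H (hs l)) k) (fh (bl H (ht k)) l) (qkk H k l)))
    (fun f w => let K := fst f in let k := snd f in
       qku H K (fv (bl H (hs k)) w) <|> fs (bl H (ht K)) (qku H k w))
    (fun U l => let u := snd U in let U := fst U in
       quk H U (fh (bl H (vs u)) l) </> fs (bl H (vt U)) (quk H u l)).

Global Instance is_gq_left : is_gq gleft.
Proof.
  split.
  - intros; cbn; typeclasses eauto.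
  - intros; cbn; typeclasses eauto.
  - intros [X Y] Z; cbn; bd.
  - intros [K k] l; cbn. split; [repeat split; bd | vi].
  - intros [K k] w; cbn. repeat split; bd.
  - intros [U u] l; cbn. repeat split; bd.
  - intros [U u] w; cbn.
    pose proof (quv (H:=H) (fv (br H (vs u)) U // fv (bl H (vt U)) u) w) as e.
    rewrite vs_vcomp, vt_vcomp, !vs_fv, !vt_fv, fo_br in e by bd. exact e.
Qed.

Global Instance is_gq_slide Z : is_gq (gslide Z).
Proof.
  split; cbn.
  - intros; typeclasses eauto.
  - intros; typeclasses eauto.
  - intros; bd.
  - intros; split; [repeat split; bd | vi].
  - intros; repeat split; bd.
  - intros; repeat split; bd.
  - intros. bd.
Qed.

Global Instance is_gq_mid : is_gq gmid.
Proof.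
  split.
  - intros; cbn; typeclasses eauto.
  - intros; cbn; typeclasses eauto.
  - intros [X Y] Z; cbn; bd.
  - intros [K k] l; cbn; unfold conjh. split; [repeat split; bd | vi].
  - intros [K k] w; cbn. repeat split; bd.
  - intros [U u] l; cbn. repeat split; bd.
  - intros [U u] w; cbn.
    rewrite <- vassoc, <- fv_vcomp, quv, fv_vcomp by bd. bd.
Qed.

(** The factor [psf_id] contributes identity squares to compositors and unitors; once absorbed, they
    leave the formula of [gtensor]. *)
Lemma tensor_left_eq : psf_eq (gtensor gleft) (tensor_left T).
Proof.
  split; [|split; [|split; [|split; [|split]]]].
  - intros [[X Y] Z]; reflexivity.
  - intros [[K k] l]; cbn. rewrite ht_hcomp, ht_fh by bd. easy.
  - intros [[U u] w]; cbn. rewrite vt_vcomp, vt_fv by bd. easy.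
  - intros [[s d] e]; cbn. feq.
  - intros [[K k] l] [[K' k'] l'] e; cbn in e; injection e as e1 e2 e3.
    cbn [fcomp tensor_left psf_comp psf_prod psf_id psf_strict fst snd fs fh].
    erewrite fs_tensor_sidh_r by (cbn; bd). cbn.
    rewrite <- svassoc by bd. f_equal; [feq|].
    ich. f_equal; [feq|]. cols. feq.
  - intros [[X Y] Z].
    cbn [funit tensor_left psf_comp psf_prod psf_id psf_strict fst snd fs].
    erewrite fs_tensor_sidh_r by (cbn; bd). cbn.
    ich. f_equal; [feq|]. cols. feq.
Qed.

Lemma gslide_eq Z : psf_eq (gtensor (gslide Z)) (psf_comp (psf_prod (psf_id B) (br H Z)) T).
Proof.
  split; [|split; [|split; [|split; [|split]]]].
  - easy.
  - intros [K k]; cbn. feq.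
  - intros [U u]; cbn. feq.
  - intros [s d]; cbn. feq.
  - intros [K k] [K' k'] e; cbn in e; injection e as e1 e2.
    cbn [fcomp tensor_left psf_comp psf_prod psf_id psf_strict fst snd fs].
    erewrite fs_tensor_sidh_l by (cbn; bd). cbn.
    rewrite <- svassoc by bd. f_equal; [feq|].
    ich. f_equal; [|feq]. cols. feq.
  - intros [X Y].
    cbn [funit tensor_left psf_comp psf_prod psf_id psf_strict fst snd fs].
    erewrite fs_tensor_sidh_l by (cbn; bd). cbn.
    ich. f_equal; [|feq]. cols. feq.
Qed.
End Ternary.

(** * The transformation Sigma *)

Existing Class is_associativity.
Global Hint Mode is_associativity - - ! : typeclass_instances.

Section Facts.
Context {B : dcat} {hB : is_double_category B} {H : quasi B} {hH : is_quasi H}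
  (th : ttrans B) {hth : is_associativity H th}.

Lemma is_vst_th1 Y C :
  is_vst (psf_comp (br H Y) (br H C)) (br H (bo H Y C)) (th1 th Y C).
Proof. apply (proj1 (proj1 (proj1 (proj1 hth) C))). Qed.
Lemma is_vst_th2 X C :
  is_vst (psf_comp (bl H X) (br H C)) (psf_comp (br H C) (bl H X)) (th2 th X C).
Proof. apply (proj1 (proj1 (proj2 (proj2 (proj1 hth)) X))). Qed.
Lemma is_vst_th3 X Y :
  is_vst (bl H (bo H X Y)) (psf_comp (bl H Y) (bl H X)) (th3 th X Y).
Proof. apply (proj1 (proj2 (proj1 (proj2 (proj2 (proj1 hth)) X)))). Qed.
Lemma vto_th2 X Y C : vto (th2 th X C) Y = vto (th1 th Y C) X.
Proof. symmetry; apply (proj1 (proj1 (proj1 hth) C)). Qed.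
Lemma vto_th3 X Y C : vto (th3 th X Y) C = vto (th1 th Y C) X.
Proof. symmetry; apply (proj1 (proj1 (proj2 (proj1 hth)) Y)). Qed.
Lemma th_exch12_kk C K k :
  conjh (br H C) (fh (bl H (hs K)) k) (fh (br H (ht k)) K)
    (fh (br H (hs k)) K) (fh (bl H (ht K)) k) (qkk H K k)
    </> (vth (th1 th (hs k) C) K <|> vth (th2 th (ht K) C) k)
  = (vth (th2 th (hs K) C) k <|> vth (th1 th (ht k) C) K) </> qkk H K (fh (br H C) k).
Proof. apply (proj1 (proj1 hth) C). Qed.
Lemma th_exch12_ku C K u :
  fs (br H C) (qku H K u) </> vth (th1 th (vt u) C) K
  = vth (th1 th (vs u) C) K </> qku H K (fv (br H C) u).
Proof. apply (proj1 (proj1 hth) C). Qed.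
Lemma th_exch12_uk C U k :
  fs (br H C) (quk H U k) </> vth (th2 th (vt U) C) k
  = vth (th2 th (vs U) C) k </> quk H U (fh (br H C) k).
Proof. apply (proj1 (proj1 hth) C). Qed.
Lemma th_exch13_kk Y K l :
  qkk H (fh (br H Y) K) l </> (vth (th1 th Y (hs l)) K <|> vth (th3 th (ht K) Y) l)
  = (vth (th3 th (hs K) Y) l <|> vth (th1 th Y (ht l)) K) </> qkk H K (fh (bl H Y) l).
Proof. apply (proj1 (proj2 (proj1 hth)) Y). Qed.
Lemma th_exch13_ku Y K w :
  qku H (fh (br H Y) K) w </> vth (th1 th Y (vt w)) K
  = vth (th1 th Y (vs w)) K </> qku H K (fv (bl H Y) w).
Proof. apply (proj1 (proj2 (proj1 hth)) Y). Qed.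
Lemma th_exch13_uk Y U l :
  quk H (fv (br H Y) U) l </> vth (th3 th (vt U) Y) l
  = vth (th3 th (vs U) Y) l </> quk H U (fh (bl H Y) l).
Proof. apply (proj1 (proj2 (proj1 hth)) Y). Qed.
Lemma th_exch23_kk X k l :
  qkk H (fh (bl H X) k) l </> (vth (th2 th X (hs l)) k <|> vth (th3 th X (ht k)) l)
  = (vth (th3 th X (hs k)) l <|> vth (th2 th X (ht l)) k)
    </> conjh (bl H X) (fh (bl H (hs k)) l) (fh (br H (ht l)) k)
         (fh (br H (hs l)) k) (fh (bl H (ht k)) l) (qkk H k l).
Proof. apply (proj2 (proj2 (proj1 hth)) X). Qed.
Lemma th_exch23_ku X k w :
  qku H (fh (bl H X) k) w </> vth (th2 th X (vt w)) k
  = vth (th2 th X (vs w)) k </> fs (bl H X) (qku H k w).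
Proof. apply (proj2 (proj2 (proj1 hth)) X). Qed.
Lemma th_exch23_uk X u l :
  quk H (fv (bl H X) u) l </> vth (th3 th X (vt u)) l
  = vth (th3 th X (vs u)) l </> fs (bl H X) (quk H u l).
Proof. apply (proj2 (proj2 (proj1 hth)) X). Qed.

Lemma top_th1 Y C K : top (vth (th1 th Y C) K) = fh (br H C) (fh (br H Y) K).
Proof. apply (vst_top (is_vst_th1 Y C)). Qed.
Lemma bot_th1 Y C K : bot (vth (th1 th Y C) K) = fh (br H (bo H Y C)) K.
Proof. apply (vst_bot (is_vst_th1 Y C)). Qed.
Lemma top_th2 X C k : top (vth (th2 th X C) k) = fh (br H C) (fh (bl H X) k).
Proof. apply (vst_top (is_vst_th2 X C)). Qed.
Lemma bot_th2 X C k : bot (vth (th2 th X C) k) = fh (bl H X) (fh (br H C) k).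
Proof. apply (vst_bot (is_vst_th2 X C)). Qed.
Lemma top_th3 X Y l : top (vth (th3 th X Y) l) = fh (bl H (bo H X Y)) l.
Proof. apply (vst_top (is_vst_th3 X Y)). Qed.
Lemma bot_th3 X Y l : bot (vth (th3 th X Y) l) = fh (bl H X) (fh (bl H Y) l).
Proof. apply (vst_bot (is_vst_th3 X Y)). Qed.
Lemma vs_th1 Y C X : vs (vto (th1 th Y C) X) = fo (bl H (fo (bl H X) Y)) C.
Proof. rewrite (vst_vs (is_vst_th1 Y C)); cbn; bd. Qed.
Lemma vt_th1 Y C X : vt (vto (th1 th Y C) X) = fo (bl H X) (fo (bl H Y) C).
Proof. rewrite (vst_vt (is_vst_th1 Y C)); cbn; bd. Qed.
Lemma th_v1 Y Z U : vto (th1 th Y Z) (vs U) // fv (br H (fo (bl H Y) Z)) U =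
  fv (br H Z) (fv (br H Y) U) // vto (th1 th Y Z) (vt U).
Proof. apply (vst_v (is_vst_th1 Y Z) U). Qed.
(** The common 1v-components are always written through [th1], the form to which [bdth] rewrites. *)
Lemma th_v2 X Z u : vto (th1 th (vs u) Z) X // fv (bl H X) (fv (br H Z) u) =
  fv (br H Z) (fv (bl H X) u) // vto (th1 th (vt u) Z) X.
Proof. rewrite <- !vto_th2. apply (vst_v (is_vst_th2 X Z) u). Qed.
Lemma th_v3 X Y w : vto (th1 th Y (vs w)) X // fv (bl H X) (fv (bl H Y) w) =
  fv (bl H (fo (bl H X) Y)) w // vto (th1 th Y (vt w)) X.
Proof. rewrite <- !vto_th3. apply (vst_v (is_vst_th3 X Y) w). Qed.
Lemma vinvertible_th1 Y C K : vinvertible (vth (th1 th Y C) K).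
Proof. apply (proj2 hth). Qed.
Lemma vinvertible_th2 Y C K : vinvertible (vth (th2 th Y C) K).
Proof. apply (proj2 hth). Qed.
Lemma vinvertible_th3 Y C K : vinvertible (vth (th3 th Y C) K).
Proof. apply (proj2 hth). Qed.
Lemma lft_th1 Y C K : lft (vth (th1 th Y C) K) = vto (th1 th Y C) (hs K).
Proof. apply (vst_lft (is_vst_th1 Y C)). Qed.
Lemma rgt_th1 Y C K : rgt (vth (th1 th Y C) K) = vto (th1 th Y C) (ht K).
Proof. apply (vst_rgt (is_vst_th1 Y C)). Qed.
Lemma lft_th2 X C K : lft (vth (th2 th X C) K) = vto (th1 th (hs K) C) X.
Proof. rewrite (vst_lft (is_vst_th2 X C)); apply vto_th2. Qed.
Lemma rgt_th2 X C K : rgt (vth (th2 th X C) K) = vto (th1 th (ht K) C) X.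
Proof. rewrite (vst_rgt (is_vst_th2 X C)); apply vto_th2. Qed.
Lemma lft_th3 X Y K : lft (vth (th3 th X Y) K) = vto (th1 th Y (hs K)) X.
Proof. rewrite (vst_lft (is_vst_th3 X Y)); apply vto_th3. Qed.
Lemma rgt_th3 X Y K : rgt (vth (th3 th X Y) K) = vto (th1 th Y (ht K)) X.
Proof. rewrite (vst_rgt (is_vst_th3 X Y)); apply vto_th3. Qed.
End Facts.

Ltac bdth :=
  match goal with
  | |- context [vto (th2 ?t ?X ?C) ?Y] => rewrite (vto_th2 (th := t) X Y C)
  | |- context [vto (th3 ?t ?X ?C) ?Y] => rewrite (vto_th3 (th := t) X C Y)
  | |- context [top (vth (th1 ?t _ _) _)] => rewrite (top_th1 (th := t))
  | |- context [bot (vth (th1 ?t _ _) _)] => rewrite (bot_th1 (th := t))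
  | |- context [lft (vth (th1 ?t _ _) _)] => rewrite (lft_th1 (th := t))
  | |- context [rgt (vth (th1 ?t _ _) _)] => rewrite (rgt_th1 (th := t))
  | |- context [top (vth (th2 ?t _ _) _)] => rewrite (top_th2 (th := t))
  | |- context [bot (vth (th2 ?t _ _) _)] => rewrite (bot_th2 (th := t))
  | |- context [lft (vth (th2 ?t _ _) _)] => rewrite (lft_th2 (th := t))
  | |- context [rgt (vth (th2 ?t _ _) _)] => rewrite (rgt_th2 (th := t))
  | |- context [top (vth (th3 ?t _ _) _)] => rewrite (top_th3 (th := t))
  | |- context [bot (vth (th3 ?t _ _) _)] => rewrite (bot_th3 (th := t))
  | |- context [lft (vth (th3 ?t _ _) _)] => rewrite (lft_th3 (th := t))
  | |- context [rgt (vth (th3 ?t _ _) _)] => rewrite (rgt_th3 (th := t))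
  | |- context [vs (vto (th1 ?t _ _) _)] => rewrite (vs_th1 (th := t))
  | |- context [vt (vto (th1 ?t _ _) _)] => rewrite (vt_th1 (th := t))
  end.
Ltac bdstepq ::= first [bdgq | bdq | bdth].
Ltac vi_th :=
  lazymatch goal with
  | |- vinvertible (vth (th1 _ _ _) _) => eapply vinvertible_th1; typeclasses eauto
  | |- vinvertible (vth (th2 _ _ _) _) => eapply vinvertible_th2; typeclasses eauto
  | |- vinvertible (vth (th3 _ _ _) _) => eapply vinvertible_th3; typeclasses eauto
  end.
Ltac vi_extra ::= first [vi_gq | vi_quasi | vi_th].

Section Sigma.
Context {B : dcat} {hB : is_double_category B} (H : quasi B) {hH : is_quasi H}
  (th : ttrans B) {hth : is_associativity H th}.
Local Notation T := (tensor H).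

(* [Sigma] is the composite of three steps: th1 and th2 glued (with the compositor of - x| Z
   undone first), th3 glued to the result, and the compositor [reassoc]. *)
Definition slide (Z : ob B) : vst (dprod B B) B :=
  vst_comp (vst_vinv (gtensor (cgq H (br H Z))) (tcmp H (br H Z)))
    (glue (fun Y => th1 th Y Z) (fun X => th2 th X Z)).

Lemma is_vst_slide Z : is_vst (psf_comp T (br H Z))
  (psf_comp (psf_prod (psf_id B) (br H Z)) T) (slide Z).
Proof.
  pose proof (is_gq_cgq (H := H) (F := br H Z)).
  pose proof (is_ppsf_gtensor (S := cgq H (br H Z))).
  pose proof (is_ppsf_gtensor (S := gslide H Z)).
  apply (@is_vst_comp _ _ _ _ _ (gtensor (cgq H (br H Z)))).
  all: try typeclasses eauto.
  - apply (is_vst_vinv (G := psf_comp T (br H Z))).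
    + apply is_vst_tcmp; bd.
    + intros [K k]. change (vinvertible (vth (tcmp H (br H Z)) (K, k))). cbn. vi.
    + easy.
  (* Gluing yields a transformation into [gtensor (gslide H Z)], which is the required target only
     up to [psf_eq]. *)
  - apply (@is_vst_ext _ _ _ _ (gtensor (cgq H (br H Z))) (gtensor (gslide H Z)) _ _ _ _ _ _
      (glue (fun Y => th1 th Y Z) (fun X => th2 th X Z))).
    + apply psf_eq_refl.
    + now apply gslide_eq.
    + easy.
    + easy.
    + apply (is_vst_glue (S := cgq H (br H Z)) (T := gslide H Z)); cbn; intros.
      * now apply is_vst_th1.
      * now apply is_vst_th2.
      * now apply (vto_th2 (th := th)).
      * now apply th_exch12_kk.
      * now apply th_exch12_ku.
      * now apply th_exch12_uk.
Qed.

(** The first variable is now the pair (K,k), and its exchange with l splits into those of k and of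
    K with l. So the axioms for slots (2,3) and (1,3) are combined; the one for (1,2) went into
    [slide]. *)
Lemma is_vst_glue_slide : is_vst (gtensor (gleft H)) (gtensor (gmid H))
  (@glue (dprod B B) B B slide (fun XY => th3 th (fst XY) (snd XY))).
Proof.
  apply (is_vst_glue (S := gleft H) (T := gmid H)).
  - intros Z; cbn. apply is_vst_slide.
  - intros [X Y]; cbn. now apply is_vst_th3.
  - intros [X Y] Z; cbn. rewrite vunitl by bd. now apply (vto_th3 (th := th)).
  - intros [K k] l; cbn.
    pose proof (qkk_comp_l (H:=H) (K := fh (br H (hs k)) K) (K' := fh (bl H (ht K)) k) l) as E.
    rewrite !hs_fh, !ht_fh, !fo_br in E by bd.
    pose proof (th_exch13_kk (th:=th) (hs k) K l) as E1.
    pose proof (th_exch23_kk (th:=th) (ht K) k l) as E2.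
    assert (ht (fh (br H (hs k)) K) = hs (fh (bl H (ht K)) k)) by bd.
    (* This compositor is cancelled by the inverse with which [slide] starts on the right, and on
       the left it is what [E] needs to split the exchange of the composite with l. *)
    apply (@vcancel_l _ _ (sidh (fh (bl H (bo H (hs K) (hs k))) l) <|>
      fcomp (br H (ht l)) (fh (br H (hs k)) K) (fh (bl H (ht K)) k))); unfold bo, conjh in *.
    1-3: bd.
    rewrite !svassoc, E by bd.
    rewrite <- (svassoc (b := fcomp _ _ _ <|> _)) by bd.
    rewrite (interchange (a := fcomp _ _ _)) by bd.
    rewrite svassoc, vinvr, !svunitl by bd.
    rewrite (interchange (d := vinv _ </> _)) by bd.
    rewrite (svassoc (b := vinv _)), vinvr, !svunitl by bd.
    rewrite <- (svassoc (b := sidh _ <|> qkk _ _ _)) by bd.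
    rewrite <- (shassoc (a := vth (th1 th (hs k) (hs l)) K)) by bd.
    rewrite (interchange (b := qkk _ _ _)), E2, svunitl by bd.
    rewrite <- (svunitr (a := vth (th1 th (hs k) (hs l)) K) (f := fh (br H (fo (bl H (hs k)) (hs l))) K)) by bd.
    rewrite <- interchange, svassoc, fo_br by bd. f_equal.
    rewrite !shassoc, interchange, E1, svunitl by bd.
    rewrite interchange, svunitr by bd. easy.
  - intros [K k] w; cbn.
    pose proof (th_exch13_ku (th:=th) (hs k) K w) as E1.
    pose proof (th_exch23_ku (th:=th) (ht K) k w) as E2.
    apply (@vcancel_l _ _ (fcomp (br H (vs w)) (fh (br H (hs k)) K) (fh (bl H (ht K)) k))).
    1-3: bd.
    rewrite !svassoc, vinvr, svunitl by bd. rewrite <- qku_comp by bd.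
    rewrite <- (svassoc (b := fcomp _ _ _)), vinvr, svunitr by bd.
    rewrite !interchange, E1, E2 by bd. easy.
  - intros [U u] l; cbn. rewrite quk_vcomp by bd.
    pose proof (th_exch13_uk (th:=th) (vs u) U l) as E1.
    pose proof (th_exch23_uk (th:=th) (vt U) u l) as E2.
    rewrite <- svassoc, E2, svassoc, E1, svassoc by bd. easy.
Qed.

Definition reassoc : vst (dprod (dprod B B) B) B :=
  @Vst (dprod (dprod B B) B) B
    (fun X => vid (fo (bl H (fst (fst X))) (fo (bl H (snd (fst X))) (snd X))))
    (fun f => let K := fst (fst f) in let k := snd (fst f) in let l := snd f in
      sidh (fh (br H (fo (bl H (hs k)) (hs l))) K) <|>
      fcomp (bl H (ht K)) (fh (br H (hs l)) k) (fh (bl H (ht k)) l)).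

(** The strict functors in [tensor_right] leave identity squares inside the compositor; the proof
    makes them visible by conversion and then removes them. *)
Lemma fcomp_tensor_right K k l K' k' l' :
  ht K = hs K' -> ht k = hs k' -> ht l = hs l' ->
  fcomp (tensor_right T) ((K, k), l) ((K', k'), l')
  = (sidh (fh (br H (fo (bl H (hs k)) (hs l))) K) <|> qkk H K' (fh T (k, l))
     <|> sidh (fh (bl H (ht K')) (fh T (k', l'))))
    </> (fcomp (br H (fo (bl H (hs k)) (hs l))) K K'
     <|> (fcomp (bl H (ht K')) (fh T (k, l)) (fh T (k', l'))
       </> fs (bl H (ht K')) (fcomp T (k, l) (k', l')))).
Proof.
  intros e1 e2 e3.
  transitivity (fcomp T (K, fh T (k, l)) (K', fh T (k', l')) </>
    fs T (sidh (K ;; K') </> sidh (K ;; K'),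
      fcomp T (k, l) (k', l') </> fs T (@sidh (dprod B B) (k ;; k', l ;; l')))).
  { reflexivity. }
  rewrite (fs_sidh (F := T)), !svunitr by (cbn; bd).
  erewrite fs_tensor_sidh_l by (cbn; bd). cbn.
  rewrite <- svassoc by bd. f_equal; [feq|].
  ich. f_equal; [cols; feq | feq].
Qed.

Lemma funit_tensor_right X Y Z : funit (tensor_right T) ((X, Y), Z)
  = funit (br H (fo (bl H Y) Z)) X <|>
    (funit (bl H X) (fo (bl H Y) Z) </> fs (bl H X) (funit T (Y, Z))).
Proof.
  transitivity (funit T (X, fo T (Y, Z)) </>
    fs T (sidh (hid X) </> sidh (hid X),
      funit T (Y, Z) </> fs T (@sidh (dprod B B) (hid Y, hid Z)))).
  { reflexivity. }
  rewrite (fs_sidh (F := T)), !svunitr by (cbn; bd).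
  erewrite fs_tensor_sidh_l by (cbn; bd). cbn.
  ich. f_equal; [cols; feq | feq].
Qed.

Section ReassocComp.
Variables (K k l K' k' l' : hc B) (e1 : ht K = hs K') (e2 : ht k = hs k') (e3 : ht l = hs l').
Local Notation F := (bl H (ht K')).
Local Notation Y0 := (fo (bl H (hs k)) (hs l)).
Local Notation p := (fh (br H (hs l)) k).
Local Notation q := (fh (bl H (ht k)) l).
Local Notation p' := (fh (br H (ht l)) k').
Local Notation p0' := (fh (br H (hs l)) k').
Local Notation q' := (fh (bl H (ht k')) l').
Local Notation q0 := (fh (bl H (ht k')) l).
Local Notation oK := (sidh (fh (br H Y0) K)).
Local Notation oK' := (sidh (fh (br H Y0) K')).
Local Notation cj := (conjh F q p' p0' q0 (qkk H k' l)).
Local Notation a := (fcomp (br H Y0) K K').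
Local Notation bA := (fcomp F p p0' </> fs F (fcomp (br H (hs l)) k k')).
Local Notation bB := (fcomp F q0 q' </> fs F (fcomp (bl H (ht k')) l l')).
Local Notation cc := (fcomp F (fh (br H (hs l)) (k ;; k')) (fh (bl H (ht k')) (l ;; l'))).
Local Notation c' := (fcomp (bl H (ht K)) p q).
Local Notation c'' := (fcomp F p' q').
Local Notation N :=
  ((oK <|> sidh (fh (bl H (ht K)) p) <|> qkk H K' q <|> sidh (fh F p') <|> sidh (fh F q'))
  </> (oK <|> qkk H K' p <|> cj <|> sidh (fh F q')) </> (a <|> (bA <|> bB))
  </> (sidh (fh (br H Y0) (K ;; K')) <|> cc)).

(** Compatibility of [reassoc] with compositors holds because both sides equal [N]: K' passes the
    part [q] in l, then K' passes the part [p] in k while k' passes l, and compositors come last.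
    The main inputs are [qkk_comp_r] and the compatibility of [tcmp] with compositors, for the
    functor [F]. *)
Lemma reassoc_lhs :
  (oK <|> c' <|> (sidh (fh (br H (fo (bl H (ht k)) (ht l))) K') <|> c'')) </>
  ((oK <|> qkk H K' (p ;; q) <|> sidh (fh F (p' ;; q'))) </>
   (a <|> (fcomp F (p ;; q) (p' ;; q') </>
     fs F ((sidh p <|> qkk H k' l <|> sidh q') </>
        (fcomp (br H (hs l)) k k' <|> fcomp (bl H (ht k')) l l'))))) = N.
Proof.
  pose proof (vst_hcomp (is_vst_tcmp (H := H) (F := F)) (f := (k, l)) (g := (k', l'))) as E.
  cbn in E. rewrite hs_hcomp, ht_hcomp in E by bd.
  specialize (E (f_equal2 pair e2 e3)).
  assert (e4 : ht p = hs q) by bd.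
  pose proof (qkk_comp_r (H := H) K' e4) as E'.
  rewrite !hs_fh, !ht_fh, !fo_br in E' by bd. rewrite <- e1 in *. rewrite <- e2, <- e3 in E.
  unfold conjh in *.
  repeat vas. repeat has.
  rewrite <- (shassoc (b := c')) by bd.
  rewrite (interchange (b := c'')), (interchange (b := c' <|> _)), E', svunitr, svunitr by bd.
  transitivity ((oK <|> (sidh (fh (bl H (ht K)) p) <|> qkk H K' q) <|> (sidh (fh F p') <|> sidh (fh F q')))
   </> (oK <|> (qkk H K' p <|> sidh (fh F q)) <|> (sidh (fh F p') <|> sidh (fh F q')))
   </> (((oK <|> oK') <|> (fcomp F p q <|> c'')) </>
    (a <|> (fcomp F (p ;; q) (p' ;; q') </>
     fs F ((sidh p <|> qkk H k' l <|> sidh q') </>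
        (fcomp (br H (hs l)) k k' <|> fcomp (bl H (ht k')) l l')))))).
  { rewrite svassoc by bd. f_equal.
    rewrite (shassoc (a := oK <|> oK')), <- (shassoc (b := oK')) by bd. cols. easy. }
  rewrite (interchange (c := a)), E by bd. clear E E'.
  repeat has. rewrite <- !svassoc by bd. f_equal.
  transitivity ((oK <|> qkk H K' p <|> sidh (fh F q) <|> sidh (fh F p') <|> sidh (fh F q')) </>
    ((oK <|> oK' <|> sidh (fh F p) <|> cj <|> sidh (fh F q')) </>
     ((a <|> (bA <|> bB)) </> (sidh (fh (br H Y0) (K ;; K')) <|> cc)))); unfold conjh.
  - f_equal. repeat vas.
    rewrite <- !(shassoc (c := sidh (fh F q'))), <- !(shassoc (b := sidh (fh F p))) by bd.
    cols. repeat vas. easy.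
  - rewrite svassoc by bd. repeat has. repeat vas. do 2 f_equal.
    rewrite <- (shassoc (b := sidh (fh F q))), <- (shassoc (b := oK')) by bd. cols. easy.
Qed.

Local Notation oK1' := (sidh (fh (br H (fo (bl H (ht k)) (hs l))) K')).
(** In [gmid] the exchange of (K',k') with l is already a composite of two exchanges, so regrouping
    by interchange suffices. *)
Lemma reassoc_rhs :
  (((oK <|> sidh (fh (bl H (ht K)) p)) <|>
    ((qkk H K' q <|> sidh (fh F p')) </> (oK1' <|> cj)) <|> sidh (fh F q')) </>
  (((oK <|> qkk H K' p <|> sidh (fh F p0')) </> (a <|> bA)) <|> bB))
   </> (sidh (fh (br H Y0) (K ;; K')) <|> cc) = N.
Proof.
  f_equal.
  transitivity (((oK <|> sidh (fh (bl H (ht K)) p)) <|> (qkk H K' q <|> sidh (fh F p'))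
     <|> sidh (fh F q')) </>
   ((((oK <|> sidh (fh (bl H (ht K)) p)) <|> (oK1' <|> cj)) <|> sidh (fh F q')) </>
   (((oK <|> qkk H K' p <|> sidh (fh F p0')) <|> (sidh (fh F q0) <|> sidh (fh F q')))
    </> ((a <|> bA) <|> bB)))); unfold conjh.
  - rewrite svassoc by bd. f_equal; cols; easy.
  - repeat has. repeat vas. f_equal. rewrite <- !svassoc by bd. f_equal. repeat vas.
    rewrite <- (shassoc (b := sidh (fh F p0'))), <- (shassoc (b := sidh _) (c := oK1')) by bd.
    cols. easy.
Qed.
End ReassocComp.

Lemma is_vst_reassoc : is_vst (gtensor (gmid H)) (tensor_right T) reassoc.
Proof.
  pose proof (is_ppsf_gtensor (S := gmid H)).
  apply is_vst_intro.
  - intros [[X Y] Z]; cbn. split; bd.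
  - intros [[K k] l]; cbn. repeat split; bd.
  - intros [[U u] w]; cbn. bd.
  - intros [[K k] l] [[K' k'] l'] e; cbn in e; injection e as e1 e2 e3.
    rewrite fcomp_tensor_right by easy.
    pose proof (vst_hcomp (is_vst_tcmp (H := H) (F := bl H (ht K'))) (f := (k, l)) (g := (k', l'))) as E.
    cbn in E. rewrite hs_hcomp, ht_hcomp in E by bd.
    specialize (E (f_equal2 pair e2 e3)).
    pose proof (qkk_comp_r (H := H) K' (k := fh (br H (hs l)) k) (k' := fh (bl H (ht k)) l)) as E'.
    rewrite !hs_fh, !ht_fh, !fo_br, <- e1 in E' by bd.
    (* The part of this compositor in the first two variables is replaced by that of [gslide], which
       has no inserted identity squares. *)
    assert (G : fcomp (gtensor (gmid H)) ((K, k), l) ((K', k'), l') =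
      ((sidh (fh (br H (fo (bl H (hs k)) (hs l))) K) <|> sidh (fh (bl H (ht K)) (fh (br H (hs l)) k)))
        <|> gx (gmid H) (K', k') l
        <|> sidh (fh (bl H (ht K')) (fh (bl H (ht k')) l')))
     </> (fcomp (gtensor (gslide H (hs l))) (K, k) (K', k') <|>
      (fcomp (bl H (ht K')) (fh (bl H (ht k')) l) (fh (bl H (ht k')) l')
        </> fs (bl H (ht K')) (fcomp (bl H (ht k')) l l')))).
    { cbn [fcomp gtensor]. f_equal;
        [cbn; rewrite (sidh_hcomp (f := fh (br H _) _)) by bd; feq|]. f_equal.
      destruct (gslide_eq (H:=H) (hs l)) as (_ & _ & _ & _ & e5 & _).
      symmetry. exact (e5 (K, k) (K', k') (f_equal2 pair e1 e2)). }
    etransitivity; [|symmetry; apply (f_equal (fun x => x </> _) G)]. cbn. clear G.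
    rewrite !hs_hcomp, !ht_hcomp, <- ?e1, <- ?e2, <- ?e3, ?fo_br by bd. unfold bo.
    rewrite (reassoc_rhs e1 e2 e3). exact (reassoc_lhs e1 e2 e3).
  - intros [[X Y] Z]; cbn [vto vth reassoc fst snd]. rewrite funit_tensor_right.
    pose proof (vst_hid (is_vst_tcmp (H := H) (F := bl H X)) (Y, Z)) as E.
    cbn in E. rewrite hs_hid, ht_hid in E by bd.
    cbn [funit gtensor gmid gP gQ fst snd].
    destruct (gslide_eq (H:=H) Z) as (_ & _ & _ & _ & _ & e6). rewrite <- (e6 (X, Y)).
    cbn. rewrite !hs_hid, !ht_hid by bd. unfold bo in *. rewrite ?fo_br in * by bd.
    rewrite !sidv_unitl in * by bd. rewrite <- shassoc, interchange, <- E by bd.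
    cols. easy.
  - intros [[s d] e]; cbn.
    pose proof (is_ppsf_gtensor (hS := is_gq_cgq (H := H) (F := bl H (ht (bot s))))).
    pose proof (vst_nat (is_vst_tcmp (H := H) (F := bl H (ht (bot s)))) (d, e)) as E.
    cbn in E. clear H0 H1.
    rewrite ?hs_top, ?hs_bot, ?ht_top, ?ht_bot in * by bd.
    rewrite !lft_shc, !top_shc, !lft_svc, !top_svc, !top_fs, !top_quk, !lft_fs, !lft_qku by bd.
    rewrite hs_bot, qku_vcomp by bd.
    rewrite (interchange (a := sidh _)), svunitl by bd.
    rewrite (svassoc (b := quk H (rgt s) _)), <- quk_comp by bd.
    rewrite <- (svassoc (b := fcomp _ _ _)), <- E by bd.
    rewrite vs_vcomp, !vs_fv, fo_br by bd.
    rewrite (interchange (c := qku H (bot s) _)) by bd.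
    rewrite <- shassoc, interchange, svunitr by bd. f_equal; [repeat vas; easy|].
    rewrite svassoc, interchange by bd. repeat vas. easy.
Qed.

Lemma is_vst_Sigma : is_vst (tensor_left T) (tensor_right T) (Sigma H th).
Proof.
  pose proof (is_ppsf_gtensor (S := gleft H)).
  pose proof (is_ppsf_gtensor (S := gmid H)).
  apply (@is_vst_ext _ _ _ _ (gtensor (gleft H)) (tensor_right T) _ _ _ _ _ _
    (vst_comp (@glue (dprod B B) B B slide (fun XY => th3 th (fst XY) (snd XY))) reassoc)).
  - now apply tensor_left_eq.
  - apply psf_eq_refl.
  - intros [[X Y] Z]; cbn. rewrite vunitl, vunitr by bd. easy.
  - intros [[K k] l]; cbn.
    unfold bo. f_equal. repeat has. cols. easy.
  - apply (is_vst_comp is_vst_glue_slide is_vst_reassoc).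
Qed.
End Sigma.

(** * Sigma on generators *)

Section Generators.
Context {B : dcat} {hB : is_double_category B} (H : quasi B) {hH : is_quasi H}.
Local Notation T := (tensor H).

(* The isomorphisms from [T (K, hid Y)] to [fh (br H Y) K] and from [T (hid X, k)] to
   [fh (bl H X) k]. *)
Definition ii (Y : ob B) (K : hc B) : sq B :=
  sidh (fh (br H Y) K) <|> vinv (funit (bl H (ht K)) Y).
Definition jj (X : ob B) (k : hc B) : sq B :=
  vinv (funit (br H (hs k)) X) <|> sidh (fh (bl H X) k).

Lemma top_ii Y K : top (ii Y K) = fh T (K, hid Y).
Proof. unfold ii; cbn. rewrite hs_hid by bd. bd. Qed.
Lemma bot_ii Y K : bot (ii Y K) = fh (br H Y) K.
Proof. unfold ii; bd. Qed.
Lemma lft_ii Y K : lft (ii Y K) = vid (fo (bl H (hs K)) Y).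
Proof. unfold ii; bd. Qed.
Lemma rgt_ii Y K : rgt (ii Y K) = vid (fo (bl H (ht K)) Y).
Proof. unfold ii; bd. Qed.
Lemma vinvertible_ii Y K : vinvertible (ii Y K).
Proof. unfold ii; vi. Qed.
Lemma top_jj X k : top (jj X k) = fh T (hid X, k).
Proof. unfold jj; cbn. rewrite ht_hid by bd. bd. Qed.
Lemma bot_jj X k : bot (jj X k) = fh (bl H X) k.
Proof. unfold jj; bd. Qed.
Lemma lft_jj X k : lft (jj X k) = vid (fo (bl H X) (hs k)).
Proof. unfold jj; bd. Qed.
Lemma rgt_jj X k : rgt (jj X k) = vid (fo (bl H X) (ht k)).
Proof. unfold jj; bd. Qed.
Lemma vinvertible_jj X k : vinvertible (jj X k).
Proof. unfold jj; vi. Qed.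

Lemma quk_hid_vinv U Y :
  quk H U (hid Y) </> vinv (funit (bl H (vt U)) Y)
  = vinv (funit (bl H (vs U)) Y) </> sidv (fv (br H Y) U).
Proof.
  apply vinv_move_r; [vi|bd|]. symmetry. rewrite <- svassoc by bd.
  apply vinv_move; [vi|bd|]. apply quk_hid; bd.
Qed.
Lemma qku_hid_vinv X u :
  qku H (hid X) u </> vinv (funit (br H (vt u)) X)
  = vinv (funit (br H (vs u)) X) </> sidv (fv (bl H X) u).
Proof.
  apply vinv_move_r; [vi|bd|]. symmetry. rewrite <- svassoc by bd.
  apply vinv_move; [vi|bd|]. apply qku_hid; bd.
Qed.
Lemma fs_sidv_vinv (F : psf B B) {hF : is_psf F} u :
  fs F (sidv u) </> vinv (funit F (vt u)) = vinv (funit F (vs u)) </> sidv (fv F u).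
Proof.
  apply vinv_move_r; [vi|bd|]. symmetry. rewrite <- svassoc by bd.
  apply vinv_move; [vi|bd|]. apply hF.
Qed.

(** Naturality of [ii] jointly in a square of the first variable and a 1v-cell of the second. The
    cell [qku] left behind is how 1v-components of the associativity enter the premonoidal
    pentagon. *)
Lemma tensor_ii s u :
  fs T (s, sidv u) </> ii (vt u) (bot s)
  = ii (vs u) (top s) </> fs (br H (vs u)) s </> qku H (bot s) u.
Proof.
  unfold ii; cbn. rewrite top_sidv, hs_hid, lft_sidv by bd.
  rewrite interchange, svunitr by bd.
  rewrite <- svassoc, ht_bot, fs_sidv_vinv by bd.
  rewrite svassoc, quk_hid_vinv, <- svassoc by bd. rewrite <- sidv_vcomp by bd.
  rewrite <- (svunitl (a := fs _ s </> _) (f := fh (br H (vs u)) (top s))) by bd.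
  rewrite <- interchange, shunitr, <- svassoc, ht_top by bd. easy.
Qed.

Lemma tensor_jj U d :
  fs T (sidv U, d) </> jj (vt U) (bot d)
  = jj (vs U) (top d) </> quk H U (top d) </> fs (bl H (vt U)) d.
Proof.
  unfold jj; cbn. rewrite bot_sidv, ht_hid, rgt_sidv by bd.
  rewrite interchange, svunitr by bd.
  rewrite <- svassoc, hs_bot, qku_hid_vinv by bd.
  rewrite hs_top, svassoc, fs_sidv_vinv, <- svassoc by bd. rewrite <- sidv_vcomp by bd.
  rewrite <- (svunitl (a := quk _ _ _ </> _) (f := fh (bl H (vs U)) (top d))) by bd.
  rewrite <- interchange, shunitl, <- svassoc by bd. easy.
Qed.

(** The unitor of the tensor product juxtaposes a unitor in each variable, and [ii] cancels the one
    in the second. *)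
Lemma funit_ii X Y : funit T (X, Y) </> ii Y (hid X) = funit (br H Y) X.
Proof.
  unfold ii; cbn. rewrite ht_hid, interchange, vinvr, svunitr by bd.
  rewrite top_funit by bd. bd || apply sidh_unitr; bd.
Qed.
Lemma funit_jj X Y : funit T (X, Y) </> jj X (hid Y) = funit (bl H X) Y.
Proof.
  unfold jj; cbn. rewrite hs_hid, interchange, vinvr, svunitr by bd.
  rewrite top_funit by bd. apply sidh_unitl; bd.
Qed.
End Generators.

Ltac bdij :=
  match goal with
  | |- context [top (ii _ _ _)] => rewrite top_ii by bd
  | |- context [bot (ii _ _ _)] => rewrite bot_ii by bd
  | |- context [lft (ii _ _ _)] => rewrite lft_ii by bd
  | |- context [rgt (ii _ _ _)] => rewrite rgt_ii by bd
  | |- context [top (jj _ _ _)] => rewrite top_jj by bd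
  | |- context [bot (jj _ _ _)] => rewrite bot_jj by bd
  | |- context [lft (jj _ _ _)] => rewrite lft_jj by bd
  | |- context [rgt (jj _ _ _)] => rewrite rgt_jj by bd
  end.
Ltac bdstepq ::= first [bdgq | bdq | bdth | bdij].

(** * Unit coherence of compositors and of components at identities *)

Section Units.
Context {A B : dcat} {hA : is_double_category A} {hB : is_double_category B}.

(** A component at an identity 1h-cell is forced by the unit axiom: up to unitors it is the identity
    square on the 1v-component. This removes two of the three factors of [Sigma] at a generator. *)
Lemma vst_hid_vinv (F G : psf A B) {hF : is_psf F} {hG : is_psf G} al X : is_vst F G al ->
  vth al (hid X) </> vinv (funit G X) = vinv (funit F X) </> sidv (vto al X).
Proof.
  intros h. vst_facts h. apply vinv_move_r; [vi|bd|]. symmetry. rewrite <- svassoc by bd.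
  apply vinv_move; [vi|bd|]. now apply vst_hid.
Qed.

Context (F : psf A B) {hF : is_psf F}.
(** Naturality moves the compositor up to the identity 1h-cell, where the unit axiom cancels it. *)
Lemma fcomp_unit_r p q Y a : ht p = Y -> top a = hid Y -> bot a = q -> lft a = vid Y ->
  (sidh (fh F p) <|> (funit F Y </> fs F a)) </> fcomp F p q = fs F (sidh p <|> a).
Proof.
  intros <- e1 <- e2.
  transitivity ((sidh (fh F p) <|> funit F (ht p)) </>
    ((fs F (sidh p) <|> fs F a) </> fcomp F p (bot a))).
  { rewrite svassoc, interchange, fs_sidh, svunitr by bd. easy. }
  rewrite fcomp_nat' with (f := p) (g := hid (ht p)) by bd.
  rewrite svassoc, (psf_unitr hF), svunitl by bd. easy.
Qed.
Lemma fcomp_unit_l p q Y a : hs p = Y -> top a = hid Y -> bot a = q -> rgt a = vid Y ->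
  ((funit F Y </> fs F a) <|> sidh (fh F p)) </> fcomp F q p = fs F (a <|> sidh p).
Proof.
  intros <- e1 <- e2.
  transitivity ((funit F (hs p) <|> sidh (fh F p)) </>
    ((fs F a <|> fs F (sidh p)) </> fcomp F (bot a) p)).
  { rewrite svassoc, interchange, fs_sidh, svunitr by bd. easy. }
  rewrite fcomp_nat' with (f := hid (hs p)) (g := p) by bd.
  rewrite svassoc, (psf_unitl hF), svunitl by bd. easy.
Qed.

Lemma fcomp_unit_2 Y a b : top a = hid Y -> top b = hid Y ->
  lft a = vid Y -> rgt a = vid Y -> lft b = vid Y -> rgt b = vid Y ->
  ((funit F Y </> fs F a) <|> (funit F Y </> fs F b)) </> fcomp F (bot a) (bot b)
  = funit F Y </> fs F (a <|> b).
Proof.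
  intros.
  transitivity ((funit F Y <|> funit F Y) </>
    ((fs F a <|> fs F b) </> fcomp F (bot a) (bot b))).
  { rewrite svassoc, interchange by bd. easy. }
  rewrite fcomp_nat' with (f := hid Y) (g := hid Y) by bd.
  rewrite svassoc, funit2 by bd. easy.
Qed.

(** The form of [fcomp_unit_r] for the inverse unitors that occur in [ii] and [jj]. *)
Lemma fcomp_vinv_r p q Y a : ht p = Y -> top a = hid Y -> bot a = q -> lft a = vid Y ->
  rgt a = vid Y -> vinvertible a ->
  fcomp F p q </> fs F (sidh p <|> vinv a) = sidh (fh F p) <|> vinv (funit F Y </> fs F a).
Proof.
  intros e e1 e2 e3 e4 i.
  pose proof (fcomp_unit_r e e1 e2 e3) as E. subst q Y.
  rewrite <- (vinv_sidh p) at 1. rewrite <- vinv_shc, fs_vinv, <- E by bd.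
  rewrite vinv_svc, vinv_shc, vinv_sidh by bd.
  rewrite svassoc, vinvr, svunitl by bd. easy.
Qed.
Lemma fcomp_vinv_l p q Y a : hs p = Y -> top a = hid Y -> bot a = q -> lft a = vid Y ->
  rgt a = vid Y -> vinvertible a ->
  fcomp F q p </> fs F (vinv a <|> sidh p) = vinv (funit F Y </> fs F a) <|> sidh (fh F p).
Proof.
  intros e e1 e2 e3 e4 i.
  pose proof (fcomp_unit_l e e1 e2 e4) as E. subst q Y.
  rewrite <- (vinv_sidh p) at 1. rewrite <- vinv_shc, fs_vinv, <- E by bd.
  rewrite vinv_svc, vinv_shc, vinv_sidh by bd.
  rewrite svassoc, vinvr, svunitl by bd. easy.
Qed.
Lemma fcomp_vinv_2 Y a b q r : top a = hid Y -> top b = hid Y -> bot a = q -> bot b = r ->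
  lft a = vid Y -> rgt a = vid Y -> lft b = vid Y -> rgt b = vid Y ->
  vinvertible a -> vinvertible b ->
  fcomp F q r </> (fs F (vinv (a <|> b)) </> vinv (funit F Y))
  = vinv (funit F Y </> fs F a) <|> vinv (funit F Y </> fs F b).
Proof.
  intros e1 e2 <- <- e3 e4 e5 e6 i j.
  pose proof (fcomp_unit_2 e1 e2 e3 e4 e5 e6) as E.
  rewrite fs_vinv, <- vinv_svc, <- E by bd.
  rewrite vinv_svc, vinv_shc by bd. rewrite svassoc, vinvr, svunitl by bd. easy.
Qed.
End Units.

Section SigmaGenerators.
Context {B : dcat} {hB : is_double_category B} (H : quasi B) {hH : is_quasi H}
  (th : ttrans B) {hth : is_associativity H th}.
Local Notation T := (tensor H).

Lemma fs_tensor_vunit_r K Y Z : fs T (sidh K, vinv (funit T (Y, Z)))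
  = sidh (fh (br H (fo (bl H Y) Z)) K) <|>
    fs (bl H (ht K)) (vinv (funit (br H Z) Y <|> funit (bl H Y) Z)).
Proof.
  rewrite (fs_tensor_sidh_l (H:=H) K (a := vinv (funit T (Y, Z))) (A := fo (bl H Y) Z))
    by (cbn; bd). cbn. feq.
Qed.
Lemma fs_tensor_vunit_l X Y l : fs T (vinv (funit T (X, Y)), sidh l)
  = fs (br H (hs l)) (vinv (funit (br H Y) X <|> funit (bl H X) Y))
    <|> sidh (fh (bl H (fo (bl H X) Y)) l).
Proof.
  rewrite (fs_tensor_sidh_r (H:=H) l (a := vinv (funit T (X, Y))) (A := fo (bl H X) Y))
    by (cbn; bd). cbn. feq.
Qed.
Lemma fs_tensor_ii_l Y K l : fs T (ii H Y K, sidh l)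
  = fs (br H (hs l)) (ii H Y K) <|> sidh (fh (bl H (fo (bl H (ht K)) Y)) l).
Proof.
  rewrite (fs_tensor_sidh_r (H:=H) l (a := ii H Y K) (A := fo (bl H (ht K)) Y)) by bd. feq.
Qed.
Lemma fs_tensor_jj_l X k l : fs T (jj H X k, sidh l)
  = fs (br H (hs l)) (jj H X k) <|> sidh (fh (bl H (fo (bl H X) (ht k))) l).
Proof.
  rewrite (fs_tensor_sidh_r (H:=H) l (a := jj H X k) (A := fo (bl H X) (ht k))) by bd. feq.
Qed.
Lemma fs_tensor_ii_r Y K k : fs T (sidh K, ii H Y k)
  = sidh (fh (br H (fo (bl H (hs k)) Y)) K) <|> fs (bl H (ht K)) (ii H Y k).
Proof.
  rewrite (fs_tensor_sidh_l (H:=H) K (a := ii H Y k) (A := fo (bl H (hs k)) Y)) by bd. feq.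
Qed.
Lemma fs_tensor_jj_r X K k : fs T (sidh K, jj H X k)
  = sidh (fh (br H (fo (bl H X) (hs k))) K) <|> fs (bl H (ht K)) (jj H X k).
Proof.
  rewrite (fs_tensor_sidh_l (H:=H) K (a := jj H X k) (A := fo (bl H X) (hs k))) by bd. feq.
Qed.

(** The factors of [Sigma] from [th2] and [th3] are at identities and turn into inverse unitors by
    [E2] and [E3]. The compositors before and after the factors are absorbed by [fcomp_vinv_r] and
    [fcomp_vinv_2]. *)
Lemma Sigma_1 K Y Z :
  vth (Sigma H th) ((K, hid Y), hid Z)
    </> (fs T (sidh K, vinv (funit T (Y, Z))) </> ii H (fo (bl H Y) Z) K)
  = fs T (ii H Y K, sidh (hid Z)) </> ii H Z (fh (br H Y) K) </> vth (th1 th Y Z) K.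
Proof.
  pose proof (vst_hid_vinv (Y : ob B) (is_vst_th2 (th := th) (ht K) Z)) as E2.
  pose proof (vst_hid_vinv (Z : ob B) (is_vst_th3 (th := th) (ht K) Y)) as E3.
  rewrite fs_tensor_vunit_r, fs_tensor_ii_l by bd.
  unfold ii. cbn. cbn in E2, E3. unfold bo in *.
  rewrite !hs_hid, !ht_hid, ht_fh, fo_br by bd. rewrite fo_br in E2 by bd.
  rewrite (interchange (c := sidh _) (d := vinv (funit _ _))), <- (svassoc (b := sidh _ <|> fcomp _ _ _)) by bd.
  rewrite (interchange (b := fcomp _ _ _)), !svunitl, fcomp_vinv_2 by bd.
  rewrite shassoc, <- (svassoc (b := _ <|> vth (th3 _ _ _) _)) by bd.
  rewrite (interchange (b := vth (th3 _ _ _) _)) by bd.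
  rewrite (interchange (b := vth (th2 _ _ _) _)), E2, E3, svunitr by bd.
  assert (E4 : fs (br H Z) (sidh (fh (br H Y) K) <|> vinv (funit (bl H (ht K)) Y))
    = vinv (fcomp (br H Z) (fh (br H Y) K) (fh (bl H (ht K)) (hid Y))) </>
     (sidh (fh (br H Z) (fh (br H Y) K)) <|>
      vinv (funit (br H Z) (fo (bl H (ht K)) Y) </> fs (br H Z) (funit (bl H (ht K)) Y)))).
  { symmetry. apply vinv_move; [vi|bd|]. symmetry. apply fcomp_vinv_r; bd. }
  rewrite E4.
  transitivity ((vinv (fcomp (br H Z) (fh (br H Y) K) (fh (bl H (ht K)) (hid Y))) <|>
     sidh (fh (bl H (fo (bl H (ht K)) Y)) (hid Z))) </>
    ((sidh (fh (br H Z) (fh (br H Y) K)) <|>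
      vinv (funit (br H Z) (fo (bl H (ht K)) Y) </> fs (br H Z) (funit (bl H (ht K)) Y))
      <|> vinv (funit (bl H (fo (bl H (ht K)) Y)) Z)) </>
     (vth (th1 th Y Z) K <|> sidv (vto (th1 th Y Z) (ht K)) <|> sidv (vto (th1 th Y Z) (ht K))))).
  { f_equal. rewrite !interchange, svunitl, vto_th2, vto_th3 by bd. easy. }
  rewrite 2(shunitr) by bd. repeat vas. f_equal.
  cols. easy.
Qed.

Lemma Sigma_2 X k Z :
  vth (Sigma H th) ((hid X, k), hid Z)
    </> (fs T (sidh (hid X), ii H Z k) </> jj H X (fh (br H Z) k))
  = fs T (jj H X k, sidh (hid Z)) </> ii H Z (fh (bl H X) k) </> vth (th2 th X Z) k.
Proof.
  pose proof (vst_hid_vinv (X : ob B) (is_vst_th1 (th := th) (hs k) Z)) as E1.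
  pose proof (vst_hid_vinv (Z : ob B) (is_vst_th3 (th := th) X (ht k))) as E3.
  rewrite fs_tensor_ii_r, fs_tensor_jj_l by bd.
  unfold ii, jj. cbn. cbn in E1, E3. unfold bo in *.
  rewrite !hs_hid, !ht_hid, ht_fh, hs_fh, fo_br by bd. rewrite fo_br in E1 by bd.
  rewrite (interchange (c := vinv _) (d := sidh _)), svunitl, svunitr by bd.
  rewrite <- (svassoc (b := sidh _ <|> fcomp _ _ _)) by bd.
  rewrite (interchange (b := fcomp _ _ _)), !svunitl, (fcomp_vinv_r (Y := fo (bl H (ht k)) Z)) by bd.
  assert (E4 : fs (br H Z) (vinv (funit (br H (hs k)) X) <|> sidh (fh (bl H X) k))
    = vinv (fcomp (br H Z) (fh (br H (hs k)) (hid X)) (fh (bl H X) k)) </>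
     (vinv (funit (br H Z) (fo (bl H X) (hs k)) </> fs (br H Z) (funit (br H (hs k)) X))
      <|> sidh (fh (br H Z) (fh (bl H X) k)))).
  { symmetry. apply vinv_move; [vi|bd|]. symmetry. apply fcomp_vinv_l; bd. }
  rewrite E4.
  transitivity ((vinv (fcomp (br H Z) (fh (br H (hs k)) (hid X)) (fh (bl H X) k)) <|>
     sidh (fh (bl H (fo (bl H X) (ht k))) (hid Z))) </>
    ((vinv (funit (br H Z) (fo (bl H X) (hs k)) </> fs (br H Z) (funit (br H (hs k)) X))
      <|> sidh (fh (br H Z) (fh (bl H X) k))
      <|> vinv (funit (bl H (fo (bl H X) (ht k))) Z)) </>
     (sidv (vto (th1 th (hs k) Z) X) <|> vth (th2 th X Z) k <|> sidv (vto (th1 th (ht k) Z) X)))).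
  { rewrite <- svassoc by bd. f_equal. rewrite shassoc, !interchange by bd.
    rewrite E1, E3, svunitl, svunitr, vto_th3 by bd. easy. }
  rewrite shunitl, shunitr by bd. repeat vas. f_equal. cols. easy.
Qed.

Lemma Sigma_3 X Y l :
  vth (Sigma H th) ((hid X, hid Y), l)
    </> (fs T (sidh (hid X), jj H Y l) </> jj H X (fh (bl H Y) l))
  = fs T (vinv (funit T (X, Y)), sidh l) </> jj H (fo (bl H X) Y) l </> vth (th3 th X Y) l.
Proof.
  pose proof (vst_hid_vinv (X : ob B) (is_vst_th1 (th := th) Y (hs l))) as E1.
  pose proof (vst_hid_vinv (Y : ob B) (is_vst_th2 (th := th) X (hs l))) as E2.
  rewrite fs_tensor_jj_r, fs_tensor_vunit_l by bd.
  unfold ii, jj. cbn. cbn in E1, E2. unfold bo in *.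
  rewrite !hs_hid, !ht_hid, ?hs_fh by bd. rewrite fo_br in E1, E2 by bd.
  rewrite (interchange (c := vinv _) (d := sidh _)), svunitl, svunitr by bd.
  rewrite <- (svassoc (b := sidh _ <|> fcomp _ _ _)) by bd.
  rewrite (interchange (b := fcomp _ _ _)), !svunitl, (fcomp_vinv_l (Y := fo (bl H Y) (hs l))) by bd.
  pose proof (fcomp_vinv_2 (F := br H (hs l)) (Y := fo (bl H X) Y) (a := funit (br H Y) X)
    (b := funit (bl H X) Y) (q := fh (br H Y) (hid X)) (r := fh (bl H X) (hid Y))) as E4.
  do 10 (specialize (E4 ltac:(bd))).
  transitivity ((vinv (fcomp (br H (hs l)) (fh (br H Y) (hid X)) (fh (bl H X) (hid Y))) <|>
     sidh (fh (bl H (fo (bl H X) Y)) l)) </>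
    ((vinv (funit (br H (hs l)) (fo (bl H X) Y) </> fs (br H (hs l)) (funit (br H Y) X))
     <|> vinv (funit (br H (hs l)) (fo (bl H X) Y) </> fs (br H (hs l)) (funit (bl H X) Y))
      <|> sidh (fh (bl H (fo (bl H X) Y)) l)) </>
     (sidv (vto (th1 th Y (hs l)) X) <|> sidv (vto (th1 th Y (hs l)) X) <|> vth (th3 th X Y) l))).
  { rewrite <- svassoc by bd. f_equal. rewrite shassoc, !interchange by bd.
    rewrite E1, E2, svunitl, svunitr, vto_th2 by bd. easy. }
  rewrite (shunitl (a := sidv _)), shunitl by bd. rewrite <- E4. repeat vas. f_equal.
  rewrite <- (svassoc (a := fcomp _ _ _)) by bd. rewrite !interchange by bd.
  rewrite svassoc, vinvl, svunitl by bd. cols. easy.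
Qed.
End SigmaGenerators.

(** * The pentagon *)

Section Pair.
Context {A B C : dcat} {hA : is_double_category A} {hB : is_double_category B}
  {hC : is_double_category C} (T : psf (dprod A B) C) {hT : is_psf T}.
Lemma fs_pair a b c d : bot a = top c -> bot b = top d ->
  fs T (a, b) </> fs T (c, d) = fs T (a </> c, b </> d).
Proof. intros e1 e2. rewrite <- fs_svc by (cbn; congruence). easy. Qed.
Lemma fs_pair_sidh f g : fs T (sidh f, sidh g) = sidh (fh T (f, g)).
Proof. apply (fs_sidh (F := T) ((f, g) : hc (dprod A B))). Qed.
End Pair.

Ltac merge := repeat first
  [ rewrite fs_pair_sidh by bd
  | progress vun
  | match goal with
    | |- context [fs ?T (?a, ?b) </> fs ?T (?c, ?d)] =>
        rewrite (fs_pair (T := T) (a := a) (b := b) (c := c) (d := d)) by bd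
    | |- context [?x </> fs ?T ?p </> fs ?T ?q] =>
        rewrite <- (svassoc (a := x) (b := fs T p) (c := fs T q)) by bd
    | |- context [?x </> (?y </> fs ?T ?p) </> fs ?T ?q] =>
        rewrite <- (svassoc (a := x)) by bd
    end ].

Section Pentagon.
Context {B : dcat} {hB : is_double_category B} (T : psf (dprod B B) B) {hT : is_psf T}.
Local Notation D4 := (dprod (dprod (dprod B B) B) B).
Local Notation TL := (tensor_left T).
Local Notation TR := (tensor_right T).

(* The functors through which the edges of the pentagon factor. *)
Definition pent_p2 : psf D4 (dprod (dprod B B) B) :=
  psf_prod (psf_comp (psf_assoc_iso B B B) (psf_prod (psf_id B) T)) (psf_id B).
Definition pent_p3 : psf D4 (dprod B (dprod (dprod B B) B)) :=
  @psf_strict D4 (dprod B (dprod (dprod B B) B))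
    (fun X => (fst (fst (fst X)), ((snd (fst (fst X)), snd (fst X)), snd X)))
    (fun X => (fst (fst (fst X)), ((snd (fst (fst X)), snd (fst X)), snd X)))
    (fun X => (fst (fst (fst X)), ((snd (fst (fst X)), snd (fst X)), snd X)))
    (fun X => (fst (fst (fst X)), ((snd (fst (fst X)), snd (fst X)), snd X))).
Definition pent_q1 : psf D4 (dprod (dprod B B) B) :=
  psf_prod (psf_prod T (psf_id B)) (psf_id B).
Definition pent_q2 : psf D4 (dprod (dprod B B) B) :=
  psf_comp (psf_assoc_iso (dprod B B) B B) (psf_prod (psf_id (dprod B B)) T).

Global Instance is_psf_tensor_left : is_psf TL.
Proof. unfold tensor_left; typeclasses eauto. Qed.
Global Instance is_psf_tensor_right : is_psf TR.
Proof. unfold tensor_right; typeclasses eauto. Qed.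
Global Instance is_psf_pent_p2 : is_psf pent_p2.
Proof. unfold pent_p2; typeclasses eauto. Qed.
Global Instance is_psf_pent_q1 : is_psf pent_q1.
Proof. unfold pent_q1; typeclasses eauto. Qed.
Global Instance is_psf_pent_q2 : is_psf pent_q2.
Proof. unfold pent_q2; typeclasses eauto. Qed.
Global Instance is_psf_pent_p3 : is_psf pent_p3.
Proof. apply is_psf_strict; repeat split; auto. Qed.

Ltac psfeq := split; [|split; [|split; [|split; [|split]]]];
  [ intros [[[W X] Y] Z]; reflexivity | intros [[[W X] Y] Z]; reflexivity
  | intros [[[W X] Y] Z]; reflexivity | intros [[[W X] Y] Z]; reflexivity
  | intros [[[K1 K2] K3] K4] [[[L1 L2] L3] L4] e; cbn in e;
    injection e as e1 e2 e3 e4; cbn; merge; easy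
  | intros [[[W X] Y] Z]; cbn; merge; easy ].

(** The vertices of the pentagon: where two edges meet, the functors are bracketed differently and
    their compositors differ by identity squares. *)
Lemma pent_eq1 : psf_eq (psf_comp (psf_prod TR (psf_id B)) T) (psf_comp pent_p2 TL).
Proof. psfeq. Qed.
Lemma pent_eq2 : psf_eq (psf_comp pent_p2 TR)
  (psf_comp pent_p3 (psf_comp (psf_prod (psf_id B) TL) T)).
Proof. psfeq. Qed.
Lemma pent_eq3 : psf_eq (psf_comp pent_q1 TR) (psf_comp pent_q2 TL).
Proof. psfeq. Qed.
Lemma pent_src : psf_eq (psf_comp pent_q1 TL) (psf_comp (psf_prod TL (psf_id B)) T).
Proof. psfeq. Qed.
Lemma pent_tgt : psf_eq (psf_comp pent_q2 TR)
  (psf_comp pent_p3 (psf_comp (psf_prod (psf_id B) TR) T)).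
Proof. psfeq. Qed.

Context (Sg : vst (dprod (dprod B B) B) B) (hS : is_vst TL TR Sg).

Definition pent_l : vst D4 B :=
  vst_comp (vst_comp (vst_post (vst_prod Sg (vst_id (psf_id B))) T) (vst_pre pent_p2 Sg))
    (vst_pre pent_p3 (vst_post (vst_prod (vst_id (psf_id B)) Sg) T)).
Definition pent_r : vst D4 B := vst_comp (vst_pre pent_q1 Sg) (vst_pre pent_q2 Sg).

Lemma is_vst_pent_l : is_vst (psf_comp (psf_prod TL (psf_id B)) T)
  (psf_comp pent_p3 (psf_comp (psf_prod (psf_id B) TR) T)) pent_l.
Proof.
  apply (is_vst_comp (G := psf_comp pent_p2 TR)); try typeclasses eauto.
  - apply (is_vst_comp (G := psf_comp pent_p2 TL)); try typeclasses eauto.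
    + apply (is_vst_ext (F := psf_comp (psf_prod TL (psf_id B)) T)
        (G := psf_comp (psf_prod TR (psf_id B)) T)
        (al := vst_post (vst_prod Sg (vst_id (psf_id B))) T)); try typeclasses eauto; try easy.
      * apply pent_eq1.
      * apply is_vst_post; try typeclasses eauto. apply is_vst_prod; try typeclasses eauto;
          [exact hS | apply is_vst_id; bd].
    + apply is_vst_pre; try typeclasses eauto; exact hS.
  - apply (is_vst_ext (F := psf_comp pent_p3 (psf_comp (psf_prod (psf_id B) TL) T))
        (G := psf_comp pent_p3 (psf_comp (psf_prod (psf_id B) TR) T))
        (al := vst_pre pent_p3 (vst_post (vst_prod (vst_id (psf_id B)) Sg) T))); try typeclasses eauto; try easy.
    + apply psf_eq_sym, pent_eq2.
    + apply is_vst_pre; try typeclasses eauto. apply is_vst_post; try typeclasses eauto.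
      apply is_vst_prod; try typeclasses eauto; [apply is_vst_id; bd | exact hS].
Qed.

Lemma is_vst_pent_r : is_vst (psf_comp (psf_prod TL (psf_id B)) T)
  (psf_comp pent_p3 (psf_comp (psf_prod (psf_id B) TR) T)) pent_r.
Proof.
  apply (is_vst_comp (G := psf_comp pent_q1 TR)); try typeclasses eauto.
  - apply (is_vst_ext (F := psf_comp pent_q1 TL) (G := psf_comp pent_q1 TR)
      (al := vst_pre pent_q1 Sg)); try typeclasses eauto; try easy.
    + apply pent_src.
    + apply is_vst_pre; try typeclasses eauto; exact hS.
  - apply (is_vst_ext (F := psf_comp pent_q2 TL) (G := psf_comp pent_q2 TR)
      (al := vst_pre pent_q2 Sg)); try typeclasses eauto; try easy.
    + apply psf_eq_sym, pent_eq3.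
    + apply pent_tgt.
    + apply is_vst_pre; try typeclasses eauto; exact hS.
Qed.

Lemma pentagon_generators :
  (forall K W X Y (f := (((K, hid W), hid X), hid Y) : hc D4), vth pent_l f = vth pent_r f) ->
  (forall W k X Y (f := (((hid W, k), hid X), hid Y) : hc D4), vth pent_l f = vth pent_r f) ->
  (forall W X l Y (f := (((hid W, hid X), l), hid Y) : hc D4), vth pent_l f = vth pent_r f) ->
  (forall W X Y m (f := (((hid W, hid X), hid Y), m) : hc D4), vth pent_l f = vth pent_r f) ->
  forall f, vth pent_l f = vth pent_r f.
Proof.
  intros g1 g2 g3 g4 [[[K k] l] m].
  (* Entries still to be moved are identities at the sources, those already moved are identities at
     the targets. The bracketing in two pairs allows [vst_agree] to be applied to the whole and then
     to each half. *)
  assert (E : (((K, k), l), m) = @hcomp D4 (@hcomp D4 (((K, hid (hs k)), hid (hs l)), hid (hs m))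
     (((hid (ht K), k), hid (hs l)), hid (hs m)))
    (@hcomp D4 (((hid (ht K), hid (ht k)), l), hid (hs m))
     (((hid (ht K), hid (ht k)), hid (ht l)), m))).
  { cbn. repeat f_equal; bd. }
  etransitivity; [apply (f_equal (fun x => vth pent_l x) E)|].
  etransitivity; [|symmetry; apply (f_equal (fun x => vth pent_r x) E)].
  pose proof is_vst_pent_l as hl. pose proof is_vst_pent_r as hr.
  apply (vst_agree hl hr); [cbn; bd| |];
    (apply (vst_agree hl hr); [cbn; bd| |]).
  - apply g1.
  - apply g2.
  - apply g3.
  - apply g4.
Qed.
End Pentagon.

Section Reassoc.
Context {B : dcat} {hB : is_double_category B}.
(** Vertical composites are kept bracketed to the left, where an inner composite is not a subterm;
    these variants rewrite it behind an arbitrary prefix. *)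
Lemma svc_rewrite2 (x a b r : sq B) : a </> b = r -> bot x = top a -> bot a = top b ->
  x </> a </> b = x </> r.
Proof. intros <- ? ?. now rewrite svassoc by bd. Qed.
Lemma svc_rewrite3 (x a b c r : sq B) : a </> b </> c = r ->
  bot x = top a -> bot a = top b -> bot b = top c -> x </> a </> b </> c = x </> r.
Proof. intros <- ? ? ?. now rewrite !svassoc by bd. Qed.
End Reassoc.

Ltac vrw E := first [rewrite E | rewrite (svc_rewrite2 E) by bd | rewrite (svc_rewrite3 E) by bd]; repeat vas.

Ltac bdT :=
  match goal with
  | |- context [fo (tensor ?H) (?X, ?Y)] => change (fo (tensor H) (X, Y)) with (fo (bl H X) Y)
  end.
Ltac bdstepq ::= first [bdgq | bdq | bdth | bdij | bdT].

Section SigmaBoundaries.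
Context {B : dcat} {hB : is_double_category B} (H : quasi B) {hH : is_quasi H}
  (th : ttrans B) {hth : is_associativity H th}.
Local Notation T := (tensor H).
Local Notation Sg K k l := (vth (Sigma H th) ((K, k), l)).

Lemma top_Sigma K k l : top (Sg K k l) = fh T (fh T (K, k), l).
Proof. apply (vst_top (is_vst_Sigma (th := th))). Qed.
Lemma bot_Sigma K k l : bot (Sg K k l) = fh T (K, fh T (k, l)).
Proof. apply (vst_bot (is_vst_Sigma (th := th))). Qed.
Lemma vinvertible_Sigma K k l : vinvertible (Sg K k l).
Proof. cbn. vi. Qed.
End SigmaBoundaries.

Ltac bdSg :=
  match goal with
  | |- context [top (vth (Sigma _ ?t) _)] => rewrite (top_Sigma (th := t))
  | |- context [bot (vth (Sigma _ ?t) _)] => rewrite (bot_Sigma (th := t))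
  end.
Ltac bdstepq ::= first [bdgq | bdq | bdth | bdij | bdT | bdSg].
Ltac vi_gen :=
  lazymatch goal with
  | |- vinvertible (ii _ _ _) => apply vinvertible_ii; bd
  | |- vinvertible (jj _ _ _) => apply vinvertible_jj; bd
  end.
Ltac vi_extra ::= first [vi_gq | vi_quasi | vi_th | vi_gen].

(** * Naturality of [ii], [jj] and [Sigma] in each entry *)

Section Functoriality.
Context {B : dcat} {hB : is_double_category B} (H : quasi B) {hH : is_quasi H}
  (th : ttrans B) {hth : is_associativity H th}.
Local Notation T := (tensor H).
Local Notation L a g := (fs T (a, sidh g)).
Local Notation R f a := (fs T (sidh f, a)).
Local Notation v X Y := (vinv (funit T (X, Y))).
Local Notation Sg K k l := (vth (Sigma H th) ((K, k), l)).
Local Notation asc X Y Z := (vto (th1 th Y Z) X).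

Lemma mapL a b g : bot a = top b -> L (a </> b) g = L a g </> L b g.
Proof. intros e. rewrite (fs_pair (T := T)) by bd. rewrite svunitl by bd. easy. Qed.
Lemma mapR f a b : bot a = top b -> R f (a </> b) = R f a </> R f b.
Proof. intros e. rewrite (fs_pair (T := T)) by bd. rewrite svunitl by bd. easy. Qed.
Lemma LR a b f f' g g' : top a = f -> bot a = f' -> top b = g -> bot b = g' ->
  L a g </> R f' b = R f b </> L a g'.
Proof. intros <- <- <- <-. rewrite !(fs_pair (T := T)) by bd. rewrite !svunitl, !svunitr by bd. easy. Qed.

Lemma nat_ii s Y K K' : top s = K -> bot s = K' ->
  L s (hid Y) </> ii H Y K' = ii H Y K </> fs (br H Y) s.
Proof.
  intros <- <-. pose proof (tensor_ii (H := H) s (vid Y)) as e.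
  rewrite <- sidh_hid, vt_vid, vs_vid, qku_vid, svunitr in e by bd. exact e.
Qed.
Lemma nat_iiv K u Y Y' : vs u = Y -> vt u = Y' ->
  R K (sidv u) </> ii H Y' K = ii H Y K </> qku H K u.
Proof.
  intros <- <-. pose proof (tensor_ii (H := H) (sidh K) u) as e.
  rewrite bot_sidh, top_sidh, fs_sidh, svunitr in e by bd. exact e.
Qed.
Lemma nat_jj X d k k' : top d = k -> bot d = k' ->
  R (hid X) d </> jj H X k' = jj H X k </> fs (bl H X) d.
Proof.
  intros <- <-. pose proof (tensor_jj (H := H) (vid X) d) as e.
  rewrite <- sidh_hid, vt_vid, vs_vid, quk_vid, svunitr in e by bd. exact e.
Qed.
Lemma nat_jjv U k X X' : vs U = X -> vt U = X' ->
  L (sidv U) k </> jj H X' k = jj H X k </> quk H U k.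
Proof.
  intros <- <-. pose proof (tensor_jj (H := H) U (sidh k)) as e.
  rewrite bot_sidh, top_sidh, fs_sidh, svunitr in e by bd. exact e.
Qed.
Lemma Sigma_nat s d e K k l K' k' l' :
  top s = K -> top d = k -> top e = l -> bot s = K' -> bot d = k' -> bot e = l' ->
  Sg K k l </> fs T (s, fs T (d, e)) = fs T (fs T (s, d), e) </> Sg K' k' l'.
Proof.
  intros <- <- <- <- <- <-.
  symmetry. exact (vst_nat (is_vst_Sigma (th := th)) ((s, d), e)).
Qed.
Lemma Sigma_nat1 a K K' k l : top a = K -> bot a = K' ->
  Sg K k l </> L a (fh T (k, l)) = L (L a k) l </> Sg K' k l.
Proof. intros. rewrite <- fs_pair_sidh by bd. apply Sigma_nat; bd. Qed.
Lemma Sigma_nat2 K a k k' l : top a = k -> bot a = k' ->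
  Sg K k l </> R K (L a l) = L (R K a) l </> Sg K k' l.
Proof. intros. apply Sigma_nat; bd. Qed.
Lemma Sigma_nat3 K k a l l' : top a = l -> bot a = l' ->
  Sg K k l </> R K (R k a) = R (fh T (K, k)) a </> Sg K k l'.
Proof. intros. rewrite <- (fs_pair_sidh (T := T) K k) by bd. apply Sigma_nat; bd. Qed.
Lemma vinv_L a g : vinvertible a -> vinv (L a g) = L (vinv a) g.
Proof.
  intros i. apply vinv_eq, (vinverse_fs (F := T)), vinverse_pair.
  - now apply vinv_spec.
  - apply vinverse_sidh.
Qed.
Lemma vinv_R f a : vinvertible a -> vinv (R f a) = R f (vinv a).
Proof.
  intros i. apply vinv_eq, (vinverse_fs (F := T)), vinverse_pair.
  - apply vinverse_sidh.
  - now apply vinv_spec.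
Qed.
(** The unit axiom of [Sigma], with the unitor of each threefold product spelled out as two
    successive unitors of [T]. *)
Lemma Sigma_hid X Y Z :
  Sg (hid X) (hid Y) (hid Z) </> R (hid X) (v Y Z) </> v X (fo (bl H Y) Z)
  = L (v X Y) (hid Z) </> v (fo (bl H X) Y) Z </> sidv (asc X Y Z).
Proof.
  pose proof (vst_hid_vinv (((X, Y), Z) : ob (dprod (dprod B B) B)) (is_vst_Sigma (th := th))) as e.
  assert (e1 : vinv (funit (tensor_left T) ((X, Y), Z))
    = L (v X Y) (hid Z) </> v (fo (bl H X) Y) Z).
  { transitivity (vinv (funit T (fo T (X, Y), Z) </> L (funit T (X, Y)) (hid Z)));
      [reflexivity|].
    rewrite vinv_svc, vinv_L by bd. easy. }
  assert (e2 : vinv (funit (tensor_right T) ((X, Y), Z))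
    = R (hid X) (v Y Z) </> v X (fo (bl H Y) Z)).
  { transitivity (vinv (funit T (X, fo T (Y, Z)) </>
      fs T (sidh (hid X) </> sidh (hid X), funit T (Y, Z) </>
         fs T (sidh (hid Y), sidh (hid Z))))); [reflexivity|].
    rewrite fs_pair_sidh, !svunitr by bd.
    rewrite vinv_svc, vinv_R by bd. easy. }
  cbn [hid dprod fst snd] in e. rewrite <- svassoc, <- e1, <- e2 by bd. exact e.
Qed.

Lemma Sigma1 K Y Z :
  Sg K (hid Y) (hid Z) </> R K (v Y Z) </> ii H (fo (bl H Y) Z) K
  = L (ii H Y K) (hid Z) </> ii H Z (fh (br H Y) K) </> vth (th1 th Y Z) K.
Proof. rewrite <- svassoc by bd. now apply Sigma_1. Qed.
Lemma Sigma2 X k Z :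
  Sg (hid X) k (hid Z) </> R (hid X) (ii H Z k) </> jj H X (fh (br H Z) k)
  = L (jj H X k) (hid Z) </> ii H Z (fh (bl H X) k) </> vth (th2 th X Z) k.
Proof. rewrite <- svassoc by bd. now apply Sigma_2. Qed.
Lemma Sigma3 X Y l :
  Sg (hid X) (hid Y) l </> R (hid X) (jj H Y l) </> jj H X (fh (bl H Y) l)
  = L (v X Y) l </> jj H (fo (bl H X) Y) l </> vth (th3 th X Y) l.
Proof. rewrite <- svassoc by bd. now apply Sigma_3. Qed.

Lemma vunit_ii X Y : ii H Y (hid X) </> vinv (funit (br H Y) X) = v X Y.
Proof.
  apply vinv_move_r; [vi|bd|]. symmetry. apply vinv_move; [bd|bd|].
  symmetry; now apply funit_ii.
Qed.
Lemma vunit_jj X Y : jj H X (hid Y) </> vinv (funit (bl H X) Y) = v X Y.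
Proof.
  apply vinv_move_r; [vi|bd|]. symmetry. apply vinv_move; [bd|bd|].
  symmetry; now apply funit_jj.
Qed.
End Functoriality.

Section Cancel.
Context {B : dcat} {hB : is_double_category B}.
(** Here [x] and [y] are the two paths of the monoidal pentagon at a generator, [a] and [b] those of
    the premonoidal one; the same invertible cells intertwine both pairs, so equality transfers both
    ways. *)
Lemma vcancel_iff (x y a b r1 r2 r3 p1 p2 p3 : sq B) :
  x </> r1 </> r2 </> r3 = p1 </> p2 </> p3 </> a ->
  y </> r1 </> r2 </> r3 = p1 </> p2 </> p3 </> b ->
  vinvertible r1 -> vinvertible r2 -> vinvertible r3 ->
  vinvertible p1 -> vinvertible p2 -> vinvertible p3 ->
  bot x = top r1 -> bot y = top r1 -> bot r1 = top r2 -> bot r2 = top r3 ->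
  bot p1 = top p2 -> bot p2 = top p3 -> bot p3 = top a -> bot p3 = top b ->
  x = y <-> a = b.
Proof.
  intros E F **. split; intros ->.
  - apply (@vcancel_l _ _ (p1 </> p2 </> p3)); [vi|bd|bd|congruence].
  - apply (@vcancel_r _ _ r1); [vi|bd|bd|]. apply (@vcancel_r _ _ r2); [vi|bd|bd|].
    apply (@vcancel_r _ _ r3); [vi|bd|bd|congruence].
Qed.
End Cancel.

Section PentagonGenerators.
Context {B : dcat} {hB : is_double_category B} (H : quasi B) {hH : is_quasi H}
  (th : ttrans B) {hth : is_associativity H th}.
Local Notation T := (tensor H).
Local Notation L a g := (fs T (a, sidh g)).
Local Notation R f a := (fs T (sidh f, a)).
Local Notation v X Y := (vinv (funit T (X, Y))).
Local Notation Sg K k l := (vth (Sigma H th) ((K, k), l)).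
Local Notation asc X Y Z := (vto (th1 th Y Z) X).
Local Notation pl K k l m :=
  (L (Sg K k l) m </> Sg K (fh T (k, l)) m </> R K (Sg k l m)).
Local Notation pr K k l m := (Sg (fh T (K, k)) l m </> Sg K k (fh T (l, m))).

Local Notation "X ** Y" := (fo (bl H X) Y) (at level 30, right associativity).
Local Notation "1 X" := (hid X) (at level 9, X at level 8).
Local Notation K_ Y K := (fh (br H Y) K).
Local Notation X_ X k := (fh (bl H X) k).

Tactic Notation "eqv" uconstr(lem) := (apply lem; bd).

(* Both sides of the pentagon at a generator, followed by invertible cells, are both sides of
   the premonoidal pentagon preceded by invertible cells. *)
Lemma pentagon_1_src K X Y Z :
  pl K (1 X) (1 Y) (1 Z) </> R K (R (1 X) (v Y Z)) </> R K (v X (Y ** Z))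
    </> ii H (X ** Y ** Z) K
  = L (L (ii H X K) (1 Y)) (1 Z) </> L (ii H Y (K_ X K)) (1 Z) </> ii H Z (K_ Y (K_ X K))
    </> (fs (br H Z) (vth (th1 th X Y) K) </> vth (th1 th (X ** Y) Z) K
         </> qku H K (asc X Y Z)).
Proof.
  assert (E1 : R K (Sg (1 X) (1 Y) (1 Z)) </> R K (R (1 X) (v Y Z)) </> R K (v X (Y ** Z))
    = R K (L (v X Y) (1 Z)) </> R K (v (X ** Y) Z) </> R K (sidv (asc X Y Z))).
  { rewrite <- !mapR by bd. rewrite Sigma_hid by bd. easy. }
  (* By [E1], [Sigma] at three identities leaves the identity square on the 1v-component; sliding it
     past [ii] yields the last factor of the premonoidal pentagon at K. *)
  assert (E2 : R K (sidv (asc X Y Z)) </> ii H (X ** Y ** Z) K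
    = ii H ((X ** Y) ** Z) K </> qku H K (asc X Y Z)) by eqv nat_iiv.
  assert (E3 : Sg K (fh T (1 X, 1 Y)) (1 Z) </> R K (L (v X Y) (1 Z))
    = L (R K (v X Y)) (1 Z) </> Sg K (1 (X ** Y)) (1 Z)) by eqv Sigma_nat2.
  assert (E4 : L (Sg K (1 X) (1 Y)) (1 Z) </> L (R K (v X Y)) (1 Z) </> L (ii H (X ** Y) K) (1 Z)
    = L (L (ii H X K) (1 Y)) (1 Z) </> L (ii H Y (K_ X K)) (1 Z) </> L (vth (th1 th X Y) K) (1 Z)).
  { rewrite <- !mapL by bd. rewrite Sigma1 by bd. easy. }
  assert (E5 : L (vth (th1 th X Y) K) (1 Z) </> ii H Z (K_ (X ** Y) K)
    = ii H Z (K_ Y (K_ X K)) </> fs (br H Z) (vth (th1 th X Y) K)) by eqv nat_ii.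
  repeat vas. vrw E1. vrw E2. vrw E3.
  vrw (Sigma1 (th := th) K (X ** Y) Z). vrw E4. vrw E5. easy.
Qed.
Lemma pentagon_1_tgt K X Y Z :
  pr K (1 X) (1 Y) (1 Z) </> R K (R (1 X) (v Y Z)) </> R K (v X (Y ** Z))
    </> ii H (X ** Y ** Z) K
  = L (L (ii H X K) (1 Y)) (1 Z) </> L (ii H Y (K_ X K)) (1 Z) </> ii H Z (K_ Y (K_ X K))
    </> (vth (th1 th Y Z) (K_ X K) </> vth (th1 th X (Y ** Z)) K).
Proof.
  assert (E1 : Sg K (1 X) (fh T (1 Y, 1 Z)) </> R K (R (1 X) (v Y Z))
    = R (fh T (K, 1 X)) (v Y Z) </> Sg K (1 X) (1 (Y ** Z))) by eqv Sigma_nat3.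
  assert (E2 : R (fh T (K, 1 X)) (v Y Z) </> L (ii H X K) (1 (Y ** Z))
    = L (ii H X K) (fh T (1 Y, 1 Z)) </> R (K_ X K) (v Y Z)).
  { symmetry. eqv LR. }
  assert (E3 : Sg (fh T (K, 1 X)) (1 Y) (1 Z) </> L (ii H X K) (fh T (1 Y, 1 Z))
    = L (L (ii H X K) (1 Y)) (1 Z) </> Sg (K_ X K) (1 Y) (1 Z)) by eqv Sigma_nat1.
  repeat vas. vrw E1. vrw (Sigma1 (th := th) K X (Y ** Z)). vrw E2. vrw E3.
  vrw (Sigma1 (th := th) (K_ X K) Y Z). easy.
Qed.
Lemma pentagon_2_src W k Y Z :
  pl (1 W) k (1 Y) (1 Z) </> R (1 W) (R k (v Y Z)) </> R (1 W) (ii H (Y ** Z) k)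
    </> jj H W (K_ (Y ** Z) k)
  = L (L (jj H W k) (1 Y)) (1 Z) </> L (ii H Y (X_ W k)) (1 Z) </> ii H Z (K_ Y (X_ W k))
    </> (fs (br H Z) (vth (th2 th W Y) k) </> vth (th2 th W Z) (K_ Y k)
         </> fs (bl H W) (vth (th1 th Y Z) k)).
Proof.
  assert (E1 : R (1 W) (Sg k (1 Y) (1 Z)) </> R (1 W) (R k (v Y Z)) </> R (1 W) (ii H (Y ** Z) k)
    = R (1 W) (L (ii H Y k) (1 Z)) </> R (1 W) (ii H Z (K_ Y k)) </> R (1 W) (vth (th1 th Y Z) k)).
  { rewrite <- !mapR by bd. rewrite Sigma1 by bd. easy. }
  assert (E2 : R (1 W) (vth (th1 th Y Z) k) </> jj H W (K_ (Y ** Z) k)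
    = jj H W (K_ Z (K_ Y k)) </> fs (bl H W) (vth (th1 th Y Z) k)) by eqv nat_jj.
  assert (E3 : Sg (1 W) (fh T (k, 1 Y)) (1 Z) </> R (1 W) (L (ii H Y k) (1 Z))
    = L (R (1 W) (ii H Y k)) (1 Z) </> Sg (1 W) (K_ Y k) (1 Z)) by eqv Sigma_nat2.
  assert (E4 : L (Sg (1 W) k (1 Y)) (1 Z) </> L (R (1 W) (ii H Y k)) (1 Z) </> L (jj H W (K_ Y k)) (1 Z)
    = L (L (jj H W k) (1 Y)) (1 Z) </> L (ii H Y (X_ W k)) (1 Z) </> L (vth (th2 th W Y) k) (1 Z)).
  { rewrite <- !mapL by bd. rewrite Sigma2 by bd. easy. }
  assert (E5 : L (vth (th2 th W Y) k) (1 Z) </> ii H Z (X_ W (K_ Y k))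
    = ii H Z (K_ Y (X_ W k)) </> fs (br H Z) (vth (th2 th W Y) k)) by eqv nat_ii.
  repeat vas. vrw E1. vrw E2. vrw E3.
  vrw (Sigma2 (th := th) W (K_ Y k) Z). vrw E4. vrw E5. easy.
Qed.
Lemma pentagon_2_tgt W k Y Z :
  pr (1 W) k (1 Y) (1 Z) </> R (1 W) (R k (v Y Z)) </> R (1 W) (ii H (Y ** Z) k)
    </> jj H W (K_ (Y ** Z) k)
  = L (L (jj H W k) (1 Y)) (1 Z) </> L (ii H Y (X_ W k)) (1 Z) </> ii H Z (K_ Y (X_ W k))
    </> (vth (th1 th Y Z) (X_ W k) </> vth (th2 th W (Y ** Z)) k).
Proof.
  assert (E1 : Sg (1 W) k (fh T (1 Y, 1 Z)) </> R (1 W) (R k (v Y Z))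
    = R (fh T (1 W, k)) (v Y Z) </> Sg (1 W) k (1 (Y ** Z))) by eqv Sigma_nat3.
  assert (E2 : R (fh T (1 W, k)) (v Y Z) </> L (jj H W k) (1 (Y ** Z))
    = L (jj H W k) (fh T (1 Y, 1 Z)) </> R (X_ W k) (v Y Z)).
  { symmetry. eqv LR. }
  assert (E3 : Sg (fh T (1 W, k)) (1 Y) (1 Z) </> L (jj H W k) (fh T (1 Y, 1 Z))
    = L (L (jj H W k) (1 Y)) (1 Z) </> Sg (X_ W k) (1 Y) (1 Z)) by eqv Sigma_nat1.
  repeat vas. vrw E1. vrw (Sigma2 (th := th) W k (Y ** Z)). vrw E2. vrw E3.
  vrw (Sigma1 (th := th) (X_ W k) Y Z). easy.
Qed.
Lemma pentagon_3_src W X l Z :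
  pl (1 W) (1 X) l (1 Z) </> R (1 W) (R (1 X) (ii H Z l)) </> R (1 W) (jj H X (K_ Z l))
    </> jj H W (X_ X (K_ Z l))
  = L (L (v W X) l) (1 Z) </> L (jj H (W ** X) l) (1 Z) </> ii H Z (X_ (W ** X) l)
    </> (fs (br H Z) (vth (th3 th W X) l) </> vth (th2 th W Z) (X_ X l)
         </> fs (bl H W) (vth (th2 th X Z) l)).
Proof.
  assert (E1 : R (1 W) (Sg (1 X) l (1 Z)) </> R (1 W) (R (1 X) (ii H Z l)) </> R (1 W) (jj H X (K_ Z l))
    = R (1 W) (L (jj H X l) (1 Z)) </> R (1 W) (ii H Z (X_ X l)) </> R (1 W) (vth (th2 th X Z) l)).
  { rewrite <- !mapR by bd. rewrite Sigma2 by bd. easy. }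
  assert (E2 : R (1 W) (vth (th2 th X Z) l) </> jj H W (X_ X (K_ Z l))
    = jj H W (K_ Z (X_ X l)) </> fs (bl H W) (vth (th2 th X Z) l)) by eqv nat_jj.
  assert (E3 : Sg (1 W) (fh T (1 X, l)) (1 Z) </> R (1 W) (L (jj H X l) (1 Z))
    = L (R (1 W) (jj H X l)) (1 Z) </> Sg (1 W) (X_ X l) (1 Z)) by eqv Sigma_nat2.
  assert (E4 : L (Sg (1 W) (1 X) l) (1 Z) </> L (R (1 W) (jj H X l)) (1 Z) </> L (jj H W (X_ X l)) (1 Z)
    = L (L (v W X) l) (1 Z) </> L (jj H (W ** X) l) (1 Z) </> L (vth (th3 th W X) l) (1 Z)).
  { rewrite <- !mapL by bd. rewrite Sigma3 by bd. easy. }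
  assert (E5 : L (vth (th3 th W X) l) (1 Z) </> ii H Z (X_ W (X_ X l))
    = ii H Z (X_ (W ** X) l) </> fs (br H Z) (vth (th3 th W X) l)) by eqv nat_ii.
  repeat vas. vrw E1. vrw E2. vrw E3.
  vrw (Sigma2 (th := th) W (X_ X l) Z). vrw E4. vrw E5. easy.
Qed.
Lemma pentagon_3_tgt W X l Z :
  pr (1 W) (1 X) l (1 Z) </> R (1 W) (R (1 X) (ii H Z l)) </> R (1 W) (jj H X (K_ Z l))
    </> jj H W (X_ X (K_ Z l))
  = L (L (v W X) l) (1 Z) </> L (jj H (W ** X) l) (1 Z) </> ii H Z (X_ (W ** X) l)
    </> (vth (th2 th (W ** X) Z) l </> vth (th3 th W X) (K_ Z l)).
Proof.
  assert (E1 : Sg (1 W) (1 X) (fh T (l, 1 Z)) </> R (1 W) (R (1 X) (ii H Z l))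
    = R (fh T (1 W, 1 X)) (ii H Z l) </> Sg (1 W) (1 X) (K_ Z l)) by eqv Sigma_nat3.
  assert (E2 : R (fh T (1 W, 1 X)) (ii H Z l) </> L (v W X) (K_ Z l)
    = L (v W X) (fh T (l, 1 Z)) </> R (1 (W ** X)) (ii H Z l)).
  { symmetry. eqv LR. }
  assert (E3 : Sg (fh T (1 W, 1 X)) l (1 Z) </> L (v W X) (fh T (l, 1 Z))
    = L (L (v W X) l) (1 Z) </> Sg (1 (W ** X)) l (1 Z)) by eqv Sigma_nat1.
  repeat vas. vrw E1. vrw (Sigma3 (th := th) W X (K_ Z l)). vrw E2. vrw E3.
  vrw (Sigma2 (th := th) (W ** X) l Z). easy.
Qed.
Lemma pentagon_4_src W X Y m :
  pl (1 W) (1 X) (1 Y) m </> R (1 W) (R (1 X) (jj H Y m)) </> R (1 W) (jj H X (X_ Y m))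
    </> jj H W (X_ X (X_ Y m))
  = L (L (v W X) (1 Y)) m </> L (v (W ** X) Y) m </> jj H ((W ** X) ** Y) m
    </> (quk H (asc W X Y) m </> vth (th3 th W (X ** Y)) m
         </> fs (bl H W) (vth (th3 th X Y) m)).
Proof.
  assert (E1 : R (1 W) (Sg (1 X) (1 Y) m) </> R (1 W) (R (1 X) (jj H Y m)) </> R (1 W) (jj H X (X_ Y m))
    = R (1 W) (L (v X Y) m) </> R (1 W) (jj H (X ** Y) m) </> R (1 W) (vth (th3 th X Y) m)).
  { rewrite <- !mapR by bd. rewrite Sigma3 by bd. easy. }
  assert (E2 : R (1 W) (vth (th3 th X Y) m) </> jj H W (X_ X (X_ Y m))
    = jj H W (X_ (X ** Y) m) </> fs (bl H W) (vth (th3 th X Y) m)) by eqv nat_jj.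
  assert (E3 : Sg (1 W) (fh T (1 X, 1 Y)) m </> R (1 W) (L (v X Y) m)
    = L (R (1 W) (v X Y)) m </> Sg (1 W) (1 (X ** Y)) m) by eqv Sigma_nat2.
  (* Mirror image of the case of the first variable: the identity square on the 1v-component now
     stands on the left and becomes [quk] when it passes [jj] in [E5]. *)
  assert (E4 : L (Sg (1 W) (1 X) (1 Y)) m </> L (R (1 W) (v X Y)) m </> L (v W (X ** Y)) m
    = L (L (v W X) (1 Y)) m </> L (v (W ** X) Y) m </> L (sidv (asc W X Y)) m).
  { rewrite <- !mapL by bd. rewrite Sigma_hid by bd. easy. }
  assert (E5 : L (sidv (asc W X Y)) m </> jj H (W ** X ** Y) m
    = jj H ((W ** X) ** Y) m </> quk H (asc W X Y) m) by eqv nat_jjv.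
  repeat vas. vrw E1. vrw E2. vrw E3.
  vrw (Sigma3 (th := th) W (X ** Y) m). vrw E4. vrw E5. easy.
Qed.
Lemma pentagon_4_tgt W X Y m :
  pr (1 W) (1 X) (1 Y) m </> R (1 W) (R (1 X) (jj H Y m)) </> R (1 W) (jj H X (X_ Y m))
    </> jj H W (X_ X (X_ Y m))
  = L (L (v W X) (1 Y)) m </> L (v (W ** X) Y) m </> jj H ((W ** X) ** Y) m
    </> (vth (th3 th (W ** X) Y) m </> vth (th3 th W X) (X_ Y m)).
Proof.
  assert (E1 : Sg (1 W) (1 X) (fh T (1 Y, m)) </> R (1 W) (R (1 X) (jj H Y m))
    = R (fh T (1 W, 1 X)) (jj H Y m) </> Sg (1 W) (1 X) (X_ Y m)) by eqv Sigma_nat3.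
  assert (E2 : R (fh T (1 W, 1 X)) (jj H Y m) </> L (v W X) (X_ Y m)
    = L (v W X) (fh T (1 Y, m)) </> R (1 (W ** X)) (jj H Y m)).
  { symmetry. eqv LR. }
  assert (E3 : Sg (fh T (1 W, 1 X)) (1 Y) m </> L (v W X) (fh T (1 Y, m))
    = L (L (v W X) (1 Y)) m </> Sg (1 (W ** X)) (1 Y) m) by eqv Sigma_nat1.
  repeat vas. vrw E1. vrw (Sigma3 (th := th) W X (X_ Y m)). vrw E2. vrw E3.
  vrw (Sigma3 (th := th) (W ** X) Y m). easy.
Qed.

Ltac gen_iff l r := apply (vcancel_iff l r); [vi|vi|vi|vi|vi|vi|bd|bd|bd|bd|bd|bd|bd|bd].
Lemma pentagon_1 K X Y Z :
  pl K (1 X) (1 Y) (1 Z) = pr K (1 X) (1 Y) (1 Z) <->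
  fs (br H Z) (vth (th1 th X Y) K) </> vth (th1 th (X ** Y) Z) K </> qku H K (asc X Y Z)
  = vth (th1 th Y Z) (K_ X K) </> vth (th1 th X (Y ** Z)) K.
Proof. gen_iff (pentagon_1_src K X Y Z) (pentagon_1_tgt K X Y Z). Qed.
Lemma pentagon_2 W k Y Z :
  pl (1 W) k (1 Y) (1 Z) = pr (1 W) k (1 Y) (1 Z) <->
  fs (br H Z) (vth (th2 th W Y) k) </> vth (th2 th W Z) (K_ Y k)
    </> fs (bl H W) (vth (th1 th Y Z) k)
  = vth (th1 th Y Z) (X_ W k) </> vth (th2 th W (Y ** Z)) k.
Proof. gen_iff (pentagon_2_src W k Y Z) (pentagon_2_tgt W k Y Z). Qed.
Lemma pentagon_3 W X l Z :
  pl (1 W) (1 X) l (1 Z) = pr (1 W) (1 X) l (1 Z) <->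
  fs (br H Z) (vth (th3 th W X) l) </> vth (th2 th W Z) (X_ X l)
    </> fs (bl H W) (vth (th2 th X Z) l)
  = vth (th2 th (W ** X) Z) l </> vth (th3 th W X) (K_ Z l).
Proof. gen_iff (pentagon_3_src W X l Z) (pentagon_3_tgt W X l Z). Qed.
Lemma pentagon_4 W X Y m :
  pl (1 W) (1 X) (1 Y) m = pr (1 W) (1 X) (1 Y) m <->
  quk H (asc W X Y) m </> vth (th3 th W (X ** Y)) m </> fs (bl H W) (vth (th3 th X Y) m)
  = vth (th3 th (W ** X) Y) m </> vth (th3 th W X) (X_ Y m).
Proof. gen_iff (pentagon_4_src W X Y m) (pentagon_4_tgt W X Y m). Qed.

Lemma fv_tensor U u X Y : vt U = X -> vs u = Y ->
  fv T (U, u) = fv (br H Y) U // fv (bl H X) u.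
Proof. intros <- <-. easy. Qed.
Lemma fv_tensor_vid_r U Y : fv T (U, vid Y) = fv (br H Y) U.
Proof. rewrite (fv_tensor (X := vt U) (Y := Y)) by bd. bd. Qed.
Lemma fv_tensor_vid_l X u : fv T (vid X, u) = fv (bl H X) u.
Proof. rewrite (fv_tensor (X := X) (Y := vs u)) by bd. bd. Qed.

(** On objects the two laws coincide, because tensoring with an identity 1v-cell is a one-variable
    functor; at 1h-cells the four families of generators match the four variables. *)
Lemma pentagon_iff :
  premonoidal_pentagon H (centers_of H) th <-> monoidal_pentagon T (Sigma H th).
Proof.
  assert (E : (forall K k l m, pl K k l m = pr K k l m) <->
    (forall K X Y Z, pl K (1 X) (1 Y) (1 Z) = pr K (1 X) (1 Y) (1 Z)) /\
    (forall W k Y Z, pl (1 W) k (1 Y) (1 Z) = pr (1 W) k (1 Y) (1 Z)) /\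
    (forall W X l Z, pl (1 W) (1 X) l (1 Z) = pr (1 W) (1 X) l (1 Z)) /\
    (forall W X Y m, pl (1 W) (1 X) (1 Y) m = pr (1 W) (1 X) (1 Y) m)).
  { split; [auto|]. intros (g1 & g2 & g3 & g4) K k l m.
    exact (pentagon_generators (is_vst_Sigma (th := th)) g1 g2 g3 g4 (((K, k), l), m)). }
  unfold premonoidal_pentagon, monoidal_pentagon. rewrite E. clear E.
  split.
  - intros (o & g1 & g2 & g3 & g4). split; [|split; [|split; [|split]]]; intros.
    + rewrite fv_tensor_vid_l, fv_tensor_vid_r. apply o.
    + apply pentagon_1, g1.
    + apply pentagon_2, g2.
    + apply pentagon_3, g3.
    + apply pentagon_4, g4.
  - intros (o & g1 & g2 & g3 & g4). split; [|split; [|split; [|split]]]; intros.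
    + rewrite <- fv_tensor_vid_l, <- fv_tensor_vid_r. apply o.
    + apply pentagon_1, g1.
    + apply pentagon_2, g2.
    + apply pentagon_3, g3.
    + apply pentagon_4, g4.
Qed.
End PentagonGenerators.

(** * Units and triangles *)

Section CancelR.
Context {B : dcat} {hB : is_double_category B}.
Lemma vcancel_iff_r (x y a b r p1 p2 p3 : sq B) :
  x </> r = p1 </> p2 </> p3 </> a -> y </> r = p1 </> p2 </> p3 </> b ->
  vinvertible r -> vinvertible p1 -> vinvertible p2 -> vinvertible p3 ->
  bot x = top r -> bot y = top r ->
  bot p1 = top p2 -> bot p2 = top p3 -> bot p3 = top a -> bot p3 = top b ->
  x = y <-> a = b.
Proof.
  intros E F **. split; intros ->.
  - apply (@vcancel_l _ _ (p1 </> p2 </> p3)); [vi|bd|bd|congruence].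
  - apply (@vcancel_r _ _ r); [vi|bd|bd|congruence].
Qed.
End CancelR.

Section TriangleGenerators.
Context {B : dcat} {hB : is_double_category B} (H : quasi B) {hH : is_quasi H}
  (th : ttrans B) {hth : is_associativity H th}.
Local Notation T := (tensor H).
Local Notation L a g := (fs T (a, sidh g)).
Local Notation R f a := (fs T (sidh f, a)).
Local Notation v X Y := (vinv (funit T (X, Y))).
Local Notation Sg K k l := (vth (Sigma H th) ((K, k), l)).
Local Notation "X ** Y" := (fo (bl H X) Y) (at level 30, right associativity).
Local Notation "1 X" := (hid X) (at level 9, X at level 8).
Local Notation K_ Y K := (fh (br H Y) K).
Local Notation X_ X k := (fh (bl H X) k).

(** A pseudodouble unit functor need not send the identity to an identity 1h-cell; the top of [w]
    stands for its value there. *)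
Context (I : ob B) (w : sq B) (bw : bot w = hid I)
  (iw : vinvertible w).
Context (la rho : vst B B) (hla : is_vst (bl H I) (psf_id B) la)
  (hrho : is_vst (br H I) (psf_id B) rho).
Local Notation i := (top w).

(* Unitors for the tensor product from unitors for H; [w] will be the inverse of the unitor of
   the unit functor. *)
Definition lunitor (l : hc B) : sq B := L w l </> jj H I l </> vth la l.
Definition runitor (K : hc B) : sq B := R K w </> ii H I K </> vth rho K.

Lemma la_hid X : vth la (hid X) = vinv (funit (bl H I) X) </> sidv (vto la X).
Proof.
  vst_facts hla. rewrite <- (vst_hid_vinv (al := la) X hla). cbn.
  rewrite vinv_sidh, svunitr by bd. easy.
Qed.
Lemma rho_hid X : vth rho (hid X) = vinv (funit (br H I) X) </> sidv (vto rho X).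
Proof.
  vst_facts hrho. rewrite <- (vst_hid_vinv (al := rho) X hrho). cbn.
  rewrite vinv_sidh, svunitr by bd. easy.
Qed.
(** At an identity, [jj] and the inverse unitor coming from [la] combine into one inverse unitor of
    the tensor product. *)
Lemma lunitor_hid X : lunitor (1 X) = L w (1 X) </> v I X </> sidv (vto la X).
Proof.
  unfold lunitor. vst_facts hla. rewrite la_hid, <- (vunit_jj (H := H) I X).
  repeat vas. easy.
Qed.
Lemma runitor_hid X : runitor (1 X) = R (1 X) w </> v X I </> sidv (vto rho X).
Proof.
  unfold runitor. vst_facts hrho. rewrite rho_hid, <- (vunit_ii (H := H) X I).
  repeat vas. easy.
Qed.

Tactic Notation "eqv" uconstr(lem) := (apply lem; bd).

Lemma lunitor_nat a k k' : top a = k -> bot a = k' ->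
  R i a </> lunitor k' = lunitor k </> a.
Proof.
  intros <- <-. unfold lunitor. vst_facts hla.
  assert (E1 : R i a </> L w (bot a) = L w (top a) </> R (1 I) a) by (symmetry; eqv LR).
  assert (E2 : R (1 I) a </> jj H I (bot a) = jj H I (top a) </> fs (bl H I) a) by eqv nat_jj.
  assert (E3 : fs (bl H I) a </> vth la (bot a) = vth la (top a) </> a)
    by exact (vst_nat hla a).
  repeat vas. vrw E1. vrw E2. vrw E3. easy.
Qed.
Lemma runitor_nat a k k' : top a = k -> bot a = k' ->
  L a i </> runitor k' = runitor k </> a.
Proof.
  intros <- <-. unfold runitor. vst_facts hrho.
  assert (E1 : L a i </> R (bot a) w = R (top a) w </> L a (1 I)) by eqv LR.
  assert (E2 : L a (1 I) </> ii H I (bot a) = ii H I (top a) </> fs (br H I) a) by eqv nat_ii.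
  assert (E3 : fs (br H I) a </> vth rho (bot a) = vth rho (top a) </> a)
    by exact (vst_nat hrho a).
  repeat vas. vrw E1. vrw E2. vrw E3. easy.
Qed.

(** As for the pentagon: followed by an invertible cell, each side of a triangle at a generator
    becomes the same string of invertible cells followed by the premonoidal side. *)
Lemma triangle_mid_l_src K Y : Sg K i (1 Y) </> R K (lunitor (1 Y)) </> ii H Y K
  = L (R K w) (1 Y) </> L (ii H I K) (1 Y) </> ii H Y (K_ I K)
    </> (vth (th1 th I Y) K </> qku H K (vto la Y)).
Proof.
  vst_facts hla.
  assert (E1 : Sg K i (1 Y) </> R K (L w (1 Y)) = L (R K w) (1 Y) </> Sg K (1 I) (1 Y))
    by eqv Sigma_nat2.
  assert (E2 : R K (sidv (vto la Y)) </> ii H Y K = ii H (I ** Y) K </> qku H K (vto la Y))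
    by eqv nat_iiv.
  rewrite lunitor_hid, !mapR by bd.
  repeat vas. vrw E1. vrw E2. vrw (Sigma1 (th := th) K I Y). easy.
Qed.
Lemma triangle_mid_l_tgt K Y : L (runitor K) (1 Y) </> ii H Y K
  = L (R K w) (1 Y) </> L (ii H I K) (1 Y) </> ii H Y (K_ I K) </> fs (br H Y) (vth rho K).
Proof.
  unfold runitor. vst_facts hrho.
  assert (E1 : L (vth rho K) (1 Y) </> ii H Y K = ii H Y (K_ I K) </> fs (br H Y) (vth rho K))
    by eqv nat_ii.
  rewrite !mapL by bd. vrw E1. easy.
Qed.
Lemma triangle_mid_l K Y : Sg K i (1 Y) </> R K (lunitor (1 Y)) = L (runitor K) (1 Y) <->
  vth (th1 th I Y) K </> qku H K (vto la Y) = fs (br H Y) (vth rho K).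
Proof.
  vst_facts hla. vst_facts hrho.
  apply (vcancel_iff_r (triangle_mid_l_src K Y) (triangle_mid_l_tgt K Y)); unfold lunitor, runitor; try vi; bd.
Qed.

Lemma triangle_mid_r_src W l : Sg (1 W) i l </> R (1 W) (lunitor l) </> jj H W l
  = L (R (1 W) w) l </> L (v W I) l </> jj H (W ** I) l
    </> (vth (th3 th W I) l </> fs (bl H W) (vth la l)).
Proof.
  unfold lunitor. vst_facts hla.
  assert (E1 : Sg (1 W) i l </> R (1 W) (L w l) = L (R (1 W) w) l </> Sg (1 W) (1 I) l)
    by eqv Sigma_nat2.
  assert (E2 : R (1 W) (vth la l) </> jj H W l = jj H W (X_ I l) </> fs (bl H W) (vth la l))
    by eqv nat_jj.
  rewrite !mapR by bd. repeat vas. vrw E1. vrw E2. vrw (Sigma3 (th := th) W I l). easy.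
Qed.
Lemma triangle_mid_r_tgt W l : L (runitor (1 W)) l </> jj H W l
  = L (R (1 W) w) l </> L (v W I) l </> jj H (W ** I) l </> quk H (vto rho W) l.
Proof.
  vst_facts hrho.
  assert (E1 : L (sidv (vto rho W)) l </> jj H W l = jj H (W ** I) l </> quk H (vto rho W) l)
    by eqv nat_jjv.
  rewrite runitor_hid, !mapL by bd. vrw E1. easy.
Qed.
Lemma triangle_mid_r W l : Sg (1 W) i l </> R (1 W) (lunitor l) = L (runitor (1 W)) l <->
  vth (th3 th W I) l </> fs (bl H W) (vth la l) = quk H (vto rho W) l.
Proof.
  vst_facts hla. vst_facts hrho.
  apply (vcancel_iff_r (triangle_mid_r_src W l) (triangle_mid_r_tgt W l)); unfold lunitor, runitor; try vi; bd.
Qed.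

Lemma triangle_left_l_src k Y : Sg i k (1 Y) </> lunitor (fh T (k, 1 Y)) </> ii H Y k
  = L (L w k) (1 Y) </> L (jj H I k) (1 Y) </> ii H Y (X_ I k)
    </> (vth (th2 th I Y) k </> vth la (K_ Y k)).
Proof.
  (* Naturality replaces the unitor at a tensor product by the one at the image of k under the
     one-variable functor. *)
  assert (E1 : lunitor (fh T (k, 1 Y)) </> ii H Y k = R i (ii H Y k) </> lunitor (K_ Y k)).
  { symmetry. eqv lunitor_nat. }
  unfold lunitor in *. vst_facts hla.
  assert (E2 : R i (ii H Y k) </> L w (K_ Y k) = L w (fh T (k, 1 Y)) </> R (1 I) (ii H Y k)).
  { symmetry. eqv LR. }
  assert (E3 : Sg i k (1 Y) </> L w (fh T (k, 1 Y)) = L (L w k) (1 Y) </> Sg (1 I) k (1 Y))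
    by eqv Sigma_nat1.
  rewrite <- svassoc, E1 by bd. repeat vas. vrw E2. vrw E3. vrw (Sigma2 (th := th) I k Y). easy.
Qed.
Lemma triangle_left_l_tgt k Y : L (lunitor k) (1 Y) </> ii H Y k
  = L (L w k) (1 Y) </> L (jj H I k) (1 Y) </> ii H Y (X_ I k) </> fs (br H Y) (vth la k).
Proof.
  unfold lunitor. vst_facts hla.
  assert (E1 : L (vth la k) (1 Y) </> ii H Y k = ii H Y (X_ I k) </> fs (br H Y) (vth la k))
    by eqv nat_ii.
  rewrite !mapL by bd. vrw E1. easy.
Qed.
Lemma triangle_left_l k Y : Sg i k (1 Y) </> lunitor (fh T (k, 1 Y)) = L (lunitor k) (1 Y) <->
  vth (th2 th I Y) k </> vth la (K_ Y k) = fs (br H Y) (vth la k).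
Proof.
  vst_facts hla.
  apply (vcancel_iff_r (triangle_left_l_src k Y) (triangle_left_l_tgt k Y)); unfold lunitor; try vi; bd.
Qed.

Lemma triangle_left_r_src W l : Sg i (1 W) l </> lunitor (fh T (1 W, l)) </> jj H W l
  = L (L w (1 W)) l </> L (v I W) l </> jj H (I ** W) l
    </> (vth (th3 th I W) l </> vth la (X_ W l)).
Proof.
  assert (E1 : lunitor (fh T (1 W, l)) </> jj H W l = R i (jj H W l) </> lunitor (X_ W l)).
  { symmetry. eqv lunitor_nat. }
  unfold lunitor in *. vst_facts hla.
  assert (E2 : R i (jj H W l) </> L w (X_ W l) = L w (fh T (1 W, l)) </> R (1 I) (jj H W l)).
  { symmetry. eqv LR. }
  assert (E3 : Sg i (1 W) l </> L w (fh T (1 W, l)) = L (L w (1 W)) l </> Sg (1 I) (1 W) l)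
    by eqv Sigma_nat1.
  rewrite <- svassoc, E1 by bd. repeat vas. vrw E2. vrw E3. vrw (Sigma3 (th := th) I W l). easy.
Qed.
Lemma triangle_left_r_tgt W l : L (lunitor (1 W)) l </> jj H W l
  = L (L w (1 W)) l </> L (v I W) l </> jj H (I ** W) l </> quk H (vto la W) l.
Proof.
  vst_facts hla.
  assert (E1 : L (sidv (vto la W)) l </> jj H W l = jj H (I ** W) l </> quk H (vto la W) l)
    by eqv nat_jjv.
  rewrite lunitor_hid, !mapL by bd. vrw E1. easy.
Qed.
Lemma triangle_left_r W l : Sg i (1 W) l </> lunitor (fh T (1 W, l)) = L (lunitor (1 W)) l <->
  vth (th3 th I W) l </> vth la (X_ W l) = quk H (vto la W) l.
Proof.
  vst_facts hla.
  apply (vcancel_iff_r (triangle_left_r_src W l) (triangle_left_r_tgt W l)); unfold lunitor; try vi; bd.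
Qed.

Lemma triangle_right_l_src K Y : Sg K (1 Y) i </> R K (runitor (1 Y)) </> ii H Y K
  = R (fh T (K, 1 Y)) w </> L (ii H Y K) (1 I) </> ii H I (K_ Y K)
    </> (vth (th1 th Y I) K </> qku H K (vto rho Y)).
Proof.
  vst_facts hrho.
  assert (E1 : Sg K (1 Y) i </> R K (R (1 Y) w) = R (fh T (K, 1 Y)) w </> Sg K (1 Y) (1 I))
    by eqv Sigma_nat3.
  assert (E2 : R K (sidv (vto rho Y)) </> ii H Y K = ii H (Y ** I) K </> qku H K (vto rho Y))
    by eqv nat_iiv.
  rewrite runitor_hid, !mapR by bd.
  repeat vas. vrw E1. vrw E2. vrw (Sigma1 (th := th) K Y I). easy.
Qed.
Lemma triangle_right_l_tgt K Y : runitor (fh T (K, 1 Y)) </> ii H Y K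
  = R (fh T (K, 1 Y)) w </> L (ii H Y K) (1 I) </> ii H I (K_ Y K) </> vth rho (K_ Y K).
Proof.
  assert (E1 : runitor (fh T (K, 1 Y)) </> ii H Y K = L (ii H Y K) i </> runitor (K_ Y K)).
  { symmetry. eqv runitor_nat. }
  unfold runitor in *. vst_facts hrho.
  assert (E2 : L (ii H Y K) i </> R (K_ Y K) w = R (fh T (K, 1 Y)) w </> L (ii H Y K) (1 I))
    by eqv LR.
  rewrite E1. repeat vas. vrw E2. easy.
Qed.
Lemma triangle_right_l K Y : Sg K (1 Y) i </> R K (runitor (1 Y)) = runitor (fh T (K, 1 Y)) <->
  vth (th1 th Y I) K </> qku H K (vto rho Y) = vth rho (K_ Y K).
Proof.
  vst_facts hrho.
  apply (vcancel_iff_r (triangle_right_l_src K Y) (triangle_right_l_tgt K Y)); unfold runitor; try vi; bd.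
Qed.

Lemma triangle_right_r_src W k : Sg (1 W) k i </> R (1 W) (runitor k) </> jj H W k
  = R (fh T (1 W, k)) w </> L (jj H W k) (1 I) </> ii H I (X_ W k)
    </> (vth (th2 th W I) k </> fs (bl H W) (vth rho k)).
Proof.
  unfold runitor. vst_facts hrho.
  assert (E1 : Sg (1 W) k i </> R (1 W) (R k w) = R (fh T (1 W, k)) w </> Sg (1 W) k (1 I))
    by eqv Sigma_nat3.
  assert (E2 : R (1 W) (vth rho k) </> jj H W k = jj H W (K_ I k) </> fs (bl H W) (vth rho k))
    by eqv nat_jj.
  rewrite !mapR by bd. repeat vas. vrw E1. vrw E2. vrw (Sigma2 (th := th) W k I). easy.
Qed.
Lemma triangle_right_r_tgt W k : runitor (fh T (1 W, k)) </> jj H W k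
  = R (fh T (1 W, k)) w </> L (jj H W k) (1 I) </> ii H I (X_ W k) </> vth rho (X_ W k).
Proof.
  assert (E1 : runitor (fh T (1 W, k)) </> jj H W k = L (jj H W k) i </> runitor (X_ W k)).
  { symmetry. eqv runitor_nat. }
  unfold runitor in *. vst_facts hrho.
  assert (E2 : L (jj H W k) i </> R (X_ W k) w = R (fh T (1 W, k)) w </> L (jj H W k) (1 I))
    by eqv LR.
  rewrite E1. repeat vas. vrw E2. easy.
Qed.
Lemma triangle_right_r W k : Sg (1 W) k i </> R (1 W) (runitor k) = runitor (fh T (1 W, k)) <->
  vth (th2 th W I) k </> fs (bl H W) (vth rho k) = vth rho (X_ W k).
Proof.
  vst_facts hrho.
  apply (vcancel_iff_r (triangle_right_r_src W k) (triangle_right_r_tgt W k)); unfold runitor; try vi; bd.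
Qed.
End TriangleGenerators.

Ltac bdunit :=
  match goal with
  | |- context [@hs dunit ?x] => change (@hs dunit x) with tt
  | |- context [@ht dunit ?x] => change (@ht dunit x) with tt
  | |- context [@vs dunit ?x] => change (@vs dunit x) with tt
  | |- context [@vt dunit ?x] => change (@vt dunit x) with tt
  | |- context [@hid dunit ?x] => change (@hid dunit x) with tt
  | |- context [@vid dunit ?x] => change (@vid dunit x) with tt
  | |- context [@hcomp dunit ?x ?y] => change (@hcomp dunit x y) with tt
  end.
Ltac bdstepq ::= first [bdgq | bdq | bdth | bdij | bdT | bdSg | bdunit].

Section TwoVariables.
Context {B C : dcat} {hB : is_double_category B} {hC : is_double_category C}.
Lemma vst_generators (F G : psf (dprod B B) C) {hF : is_psf F} {hG : is_psf G} al be :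
  is_vst F G al -> is_vst F G be ->
  (forall K Y (f := (K, hid Y) : hc (dprod B B)), vth al f = vth be f) ->
  (forall X l (f := (hid X, l) : hc (dprod B B)), vth al f = vth be f) ->
  forall f, vth al f = vth be f.
Proof.
  intros ha hb g1 g2 [K l].
  assert (E : (K, l) = @hcomp (dprod B B) (K, hid (hs l)) (hid (ht K), l)).
  { cbn. f_equal; bd. }
  etransitivity; [apply (f_equal (fun x => vth al x) E)|].
  etransitivity; [|symmetry; apply (f_equal (fun x => vth be x) E)].
  apply (vst_agree ha hb); [cbn; f_equal; bd|apply g1|apply g2].
Qed.
End TwoVariables.

(** * The triangles as equations between transformations in two variables *)

Section Triangles.
Context {B : dcat} {hB : is_double_category B} (T : psf (dprod B B) B) {hT : is_psf T}
  (I : psf dunit B) {hI : is_psf I}.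
Local Notation D2 := (dprod B B).
Local Notation TL := (tensor_left T).
Local Notation TR := (tensor_right T).
Local Notation UL := (unit_left T I).
Local Notation UR := (unit_right T I).

Global Instance is_psf_unit_left : is_psf UL.
Proof. unfold unit_left; typeclasses eauto. Qed.
Global Instance is_psf_unit_right : is_psf UR.
Proof. unfold unit_right; typeclasses eauto. Qed.

(** The unit is inserted in the first, middle or last slot; whiskering [Sg] with these functors
    gives the associativity edges of the three triangles. *)
Definition ins_l : psf D2 (dprod D2 B) :=
  psf_prod (psf_comp (psf_lunit_iso B) (psf_prod I (psf_id B))) (psf_id B).
Definition ins_m : psf D2 (dprod D2 B) :=
  psf_prod (psf_comp (psf_runit_iso B) (psf_prod (psf_id B) I)) (psf_id B).
Definition ins_r : psf D2 (dprod D2 B) :=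
  psf_comp (psf_runit_iso D2) (psf_prod (psf_id D2) I).
Global Instance is_psf_ins_l : is_psf ins_l.
Proof. unfold ins_l; typeclasses eauto. Qed.
Global Instance is_psf_ins_m : is_psf ins_m.
Proof. unfold ins_m; typeclasses eauto. Qed.
Global Instance is_psf_ins_r : is_psf ins_r.
Proof. unfold ins_r; typeclasses eauto. Qed.

Lemma fs_unit a : fs I a = sidh (fh I tt).
Proof. destruct a. exact (psf_sidh hI tt). Qed.
Lemma fv_unit u : fv I u = vid (fo I tt).
Proof. destruct u. exact (psf_vid hI tt). Qed.

Ltac psfeq := split; [|split; [|split; [|split; [|split]]]];
  [ intros [X Y]; reflexivity | intros [X Y]; reflexivity
  | intros [X Y]; cbn; rewrite ?fv_unit by bd; try reflexivity
  | intros [X Y]; cbn; rewrite ?fs_unit by bd; try reflexivity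
  | intros [K1 K2] [L1 L2] e; cbn in e; injection e as e1 e2; cbn; rewrite ?fs_unit; merge
  | intros [X Y]; cbn; rewrite ?fs_unit; merge ].

Lemma ins_l_src : psf_eq (psf_comp ins_l TL) (psf_comp (psf_prod UL (psf_id B)) T).
Proof. psfeq; easy. Qed.
Lemma ins_l_tgt : psf_eq (psf_comp ins_l TR) (psf_comp T UL).
Proof. psfeq; easy. Qed.
Lemma ins_m_src : psf_eq (psf_comp ins_m TL) (psf_comp (psf_prod UR (psf_id B)) T).
Proof. psfeq; easy. Qed.
Lemma ins_m_tgt : psf_eq (psf_comp ins_m TR) (psf_comp (psf_prod (psf_id B) UL) T).
Proof. psfeq; easy. Qed.
Lemma ins_r_src : psf_eq (psf_comp ins_r TL) (psf_comp T UR).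
Proof. psfeq; easy. Qed.
Lemma ins_r_tgt : psf_eq (psf_comp ins_r TR) (psf_comp (psf_prod (psf_id B) UR) T).
Proof. psfeq; easy. Qed.
(** Identity functors are not neutral by conversion, since they add identity squares to compositors;
    the sides of a triangle therefore reach their common target only up to [psf_eq]. *)
Lemma id_prod : psf_eq (psf_comp (psf_prod (psf_id B) (psf_id B)) T) T.
Proof. psfeq; easy. Qed.
Lemma comp_id : psf_eq (psf_comp T (psf_id B)) T.
Proof. psfeq; easy. Qed.

Context (Sg : vst (dprod D2 B) B) (hS : is_vst TL TR Sg) (la rho : vst B B)
  (hla : is_vst UL (psf_id B) la) (hrho : is_vst UR (psf_id B) rho).
Local Notation i := (fh I tt).

Local Ltac ext F' G' :=
  match goal with |- is_vst _ _ ?a =>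
    apply (is_vst_ext (F := F') (G := G') (al := a)); [| |reflexivity|reflexivity|]
  end.
Local Ltac vst_tac := repeat first
  [ typeclasses eauto | exact hS | exact hla | exact hrho
  | apply is_vst_id | apply is_vst_pre | apply is_vst_post | apply is_vst_prod ].

Lemma triangle_mid_generators :
  (forall K Y, vth Sg ((K, i), hid Y) </> fs T (sidh K, vth la (hid Y))
    = fs T (vth rho K, sidh (hid Y))) ->
  (forall X l, vth Sg ((hid X, i), l) </> fs T (sidh (hid X), vth la l)
    = fs T (vth rho (hid X), sidh l)) ->
  forall K l, vth Sg ((K, i), l) </> fs T (sidh K, vth la l) = fs T (vth rho K, sidh l).
Proof.
  intros g1 g2 K l.
  assert (a1 : is_vst (psf_comp (psf_prod UR (psf_id B)) T)
    (psf_comp (psf_prod (psf_id B) (psf_id B)) T)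
    (vst_comp (vst_pre ins_m Sg) (vst_post (vst_prod (vst_id (psf_id B)) la) T))).
  { apply (is_vst_comp (G := psf_comp ins_m TR)); try typeclasses eauto.
    - ext (psf_comp ins_m TL) (psf_comp ins_m TR);
        [apply ins_m_src|apply psf_eq_refl|vst_tac].
    - ext (psf_comp (psf_prod (psf_id B) UL) T)
        (psf_comp (psf_prod (psf_id B) (psf_id B)) T);
        [apply psf_eq_sym, ins_m_tgt|apply psf_eq_refl|vst_tac]. }
  assert (a2 : is_vst (psf_comp (psf_prod UR (psf_id B)) T)
    (psf_comp (psf_prod (psf_id B) (psf_id B)) T)
    (vst_post (vst_prod rho (vst_id (psf_id B))) T)) by vst_tac.
  exact (vst_generators a1 a2 g1 g2 (K, l)).
Qed.

Lemma triangle_left_generators :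
  (forall k Y, vth Sg ((i, k), hid Y) </> vth la (fh T (k, hid Y))
    = fs T (vth la k, sidh (hid Y))) ->
  (forall X l, vth Sg ((i, hid X), l) </> vth la (fh T (hid X, l))
    = fs T (vth la (hid X), sidh l)) ->
  forall k l, vth Sg ((i, k), l) </> vth la (fh T (k, l)) = fs T (vth la k, sidh l).
Proof.
  intros g1 g2 k l.
  assert (a1 : is_vst (psf_comp (psf_prod UL (psf_id B)) T)
    (psf_comp (psf_prod (psf_id B) (psf_id B)) T)
    (vst_comp (vst_pre ins_l Sg) (vst_pre T la))).
  { apply (is_vst_comp (G := psf_comp ins_l TR)); try typeclasses eauto.
    - ext (psf_comp ins_l TL) (psf_comp ins_l TR);
        [apply ins_l_src|apply psf_eq_refl|vst_tac].
    - ext (psf_comp T UL) (psf_comp T (psf_id B));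
        [apply psf_eq_sym, ins_l_tgt|apply (psf_eq_trans (G := T));
          [apply comp_id|apply psf_eq_sym, id_prod]|vst_tac]. }
  assert (a2 : is_vst (psf_comp (psf_prod UL (psf_id B)) T)
    (psf_comp (psf_prod (psf_id B) (psf_id B)) T)
    (vst_post (vst_prod la (vst_id (psf_id B))) T)) by vst_tac.
  exact (vst_generators a1 a2 g1 g2 (k, l)).
Qed.

Lemma triangle_right_generators :
  (forall K Y, vth Sg ((K, hid Y), i) </> fs T (sidh K, vth rho (hid Y))
    = vth rho (fh T (K, hid Y))) ->
  (forall X k, vth Sg ((hid X, k), i) </> fs T (sidh (hid X), vth rho k)
    = vth rho (fh T (hid X, k))) ->
  forall K k, vth Sg ((K, k), i) </> fs T (sidh K, vth rho k) = vth rho (fh T (K, k)).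
Proof.
  intros g1 g2 K k.
  assert (a1 : is_vst (psf_comp T UR) (psf_comp T (psf_id B))
    (vst_comp (vst_pre ins_r Sg) (vst_post (vst_prod (vst_id (psf_id B)) rho) T))).
  { apply (is_vst_comp (G := psf_comp ins_r TR)); try typeclasses eauto.
    - ext (psf_comp ins_r TL) (psf_comp ins_r TR);
        [apply ins_r_src|apply psf_eq_refl|vst_tac].
    - ext (psf_comp (psf_prod (psf_id B) UR) T)
        (psf_comp (psf_prod (psf_id B) (psf_id B)) T);
        [apply psf_eq_sym, ins_r_tgt|apply (psf_eq_trans (G := T));
          [apply id_prod|apply psf_eq_sym, comp_id]|vst_tac]. }
  assert (a2 : is_vst (psf_comp T UR) (psf_comp T (psf_id B)) (vst_pre T rho)) by vst_tac.
  exact (vst_generators a1 a2 g1 g2 (K, k)).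
Qed.
End Triangles.

(** * The unit functor and the comparison of unitors *)

Section UnitFunctor.
Context {B : dcat} {hB : is_double_category B} (I : psf dunit B) {hI : is_psf I}.
Local Notation w := (vinv (funit I tt)).

(** The strict functor on the same object. The unitor of [I] accounts for the whole difference, and
    its inverse is the component of [unit_vst]. *)
Definition unit_strict : psf dunit B :=
  @psf_strict dunit B (fun _ => fo I tt) (fun _ => hid (fo I tt)) (fun _ => vid (fo I tt))
    (fun _ => sidh (hid (fo I tt))).
Global Instance is_psf_unit_strict : is_psf unit_strict.
Proof.
  apply is_psf_strict; intros; repeat split; try bd.
  - apply sidh_hid.
  - rewrite sidh_hid, shunitl by bd; easy.
  - rewrite svunitl by bd; easy.
Qed.
Definition unit_vst : vst dunit B := @Vst dunit B (fun _ => vid (fo I tt)) (fun _ => w).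

Lemma is_vst_unit_vst : is_vst I unit_strict unit_vst.
Proof.
  apply is_vst_intro; cbn.
  - intros []; split; bd.
  - intros []; repeat split; bd.
  - intros []; rewrite fv_unit by bd; easy.
  - intros [] [] _. rewrite svunitr by bd.
    (* The only compositor of [I] is at an identity, where the unitor determines it. *)
    pose proof (funit2 (F := I) tt) as E.
    assert (e1 : bot (funit I tt) = fh I tt) by exact (bot_funit (F := I) tt).
    assert (e2 : top (fcomp I tt tt) = fh I tt ;; fh I tt)
      by exact (top_fcomp (F := I) (f := tt) (g := tt) eq_refl).
    assert (e3 : bot (fcomp I tt tt) = fh I tt)
      by exact (bot_fcomp (F := I) (f := tt) (g := tt) eq_refl).
    change (@hid dunit tt) with tt in E.
    apply (@vcancel_l _ _ (funit I tt <|> funit I tt)); [vi| | |].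
    + rewrite !top_shc, !bot_shc, top_vinv by bd. easy.
    + rewrite top_svc by (rewrite top_vinv by bd; congruence). rewrite bot_shc, e1, e2 by bd. easy.
    + rewrite svassoc by first [rewrite bot_shc, e1, e2 by bd; easy | rewrite top_vinv by bd; congruence].
      rewrite E. rewrite interchange by (rewrite ?top_vinv by bd; bd).
      rewrite vinvr by bd. rewrite top_funit, <- sidh_hcomp by bd. rewrite hunitl by bd; easy.
  - intros []. rewrite svunitr, vinvr, top_funit by bd. now rewrite sidh_hid.
  - intros []. rewrite fs_unit by bd. rewrite svunitr, svunitl by bd. easy.
Qed.
Lemma vinvertible_w : vinvertible w. Proof. vi. Qed.
End UnitFunctor.

Section Unitors.
Context {B : dcat} {hB : is_double_category B} (H : quasi B) {hH : is_quasi H}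
  (I : psf dunit B) {hI : is_psf I}.
Local Notation T := (tensor H).
Local Notation w := (vinv (funit I tt)).
Local Notation i0 := (fo I tt).

(* The icons into H(I,-) and H(-,I) from tensoring with the unit; the unitor of the functor I
   is dealt with by [unit_vst]. *)
Definition jj_vst : vst B B := Vst (fun X => vid (fo (bl H i0) X)) (jj H i0).
Definition ii_vst : vst B B := Vst (fun X => vid (fo (bl H X) i0)) (ii H i0).

Lemma fcomp_tensor K k K' k' : fcomp T (K, k) (K', k') =
  (sidh (fh (br H (hs k)) K) <|> qkk H K' k <|> sidh (fh (bl H (ht K')) k'))
       </> (fcomp (br H (hs k)) K K' <|> fcomp (bl H (ht K')) k k').
Proof. easy. Qed.

Lemma fcomp_hid_vinv (F : psf B B) {hF : is_psf F} X :
  fcomp F (hid X) (hid X) </> vinv (funit F X) = vinv (funit F X) <|> vinv (funit F X).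
Proof.
  pose proof (funit2 (F := F) X) as E.
  rewrite <- E at 1. rewrite vinv_svc, vinv_shc by bd.
  rewrite svassoc, vinvr, svunitl by bd. easy.
Qed.

(** The compositor of the tensor product contains the exchange of k with an identity; by [qkk_hid_l]
    it only slides the inverse unitor across k, which is [E']. *)
Lemma jj_hcomp X k k' : ht k = hs k' ->
  fcomp T (hid X, k) (hid X, k') </> jj H X (k ;; k')
  = (jj H X k <|> jj H X k') </> fcomp (bl H X) k k'.
Proof.
  intros e. rewrite fcomp_tensor, ht_hid by bd. unfold jj. rewrite hs_hcomp by bd.
  pose proof (qkk_hid_l (H := H) X k) as E.
  assert (E' : qkk H (hid X) k </> (vinv (funit (br H (hs k)) X) <|> sidh (fh (bl H X) k))
    = sidh (fh (bl H X) k) <|> vinv (funit (br H (ht k)) X)).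
  { apply (@vcancel_l _ _ (sidh (fh (bl H X) k) <|> funit (br H (ht k)) X)); [vi|bd|bd|].
    rewrite svassoc, E by bd. cols. rewrite !vinvr, !top_funit by bd. rewrite sidh_unitl, sidh_unitr by bd. easy. }
  rewrite <- svassoc, interchange, svunitr by bd. rewrite fcomp_hid_vinv by bd.
  transitivity ((sidh (fh (br H (hs k)) (hid X)) <|> qkk H (hid X) k <|> sidh (fh (bl H X) k'))
    </> ((vinv (funit (br H (hs k)) X) <|>
      (vinv (funit (br H (hs k)) X) <|> sidh (fh (bl H X) k)) <|> sidh (fh (bl H X) k'))
    </> fcomp (bl H X) k k')).
  - f_equal. transitivity (((vinv (funit (br H (hs k)) X) <|> vinv (funit (br H (hs k)) X)) <|>
       (sidh (fh (bl H X) k) <|> sidh (fh (bl H X) k'))) </>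
       (sidh (hid (fo (bl H X) (hs k))) <|> fcomp (bl H X) k k')).
    + rewrite interchange by bd. rewrite <- (sidh_hcomp (f := fh _ k)) by bd.
      rewrite svunitl, svunitr by bd. easy.
    + f_equal; [repeat has; easy|apply sidh_unitl; bd].

  - rewrite svassoc, !interchange by bd. rewrite E'. cols. f_equal. repeat has. rewrite e. easy.
Qed.

Lemma ii_hcomp Y K K' : ht K = hs K' ->
  fcomp T (K, hid Y) (K', hid Y) </> ii H Y (K ;; K')
  = (ii H Y K <|> ii H Y K') </> fcomp (br H Y) K K'.
Proof.
  intros e. rewrite fcomp_tensor, hs_hid by bd. unfold ii. rewrite ht_hcomp by bd.
  pose proof (qkk_hid_r (H := H) K' Y) as E.
  assert (E' : qkk H K' (hid Y) </> (sidh (fh (br H Y) K') <|> vinv (funit (bl H (ht K')) Y))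
    = vinv (funit (bl H (hs K')) Y) <|> sidh (fh (br H Y) K')).
  { apply (@vcancel_l _ _ (funit (bl H (hs K')) Y <|> sidh (fh (br H Y) K'))); [vi|bd|bd|].
    rewrite svassoc, E by bd. cols. rewrite !vinvr, !top_funit by bd.
    rewrite sidh_unitl, sidh_unitr by bd. easy. }
  rewrite <- svassoc, interchange, svunitr by bd. rewrite fcomp_hid_vinv by bd.
  transitivity ((sidh (fh (br H Y) K) <|> qkk H K' (hid Y) <|> sidh (fh (bl H (ht K')) (hid Y)))
    </> ((sidh (fh (br H Y) K) <|>
      (sidh (fh (br H Y) K') <|> vinv (funit (bl H (ht K')) Y)) <|> vinv (funit (bl H (ht K')) Y))
    </> fcomp (br H Y) K K')).
  - f_equal. transitivity (((sidh (fh (br H Y) K) <|> sidh (fh (br H Y) K')) <|>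
       (vinv (funit (bl H (ht K')) Y) <|> vinv (funit (bl H (ht K')) Y))) </>
       (fcomp (br H Y) K K' <|> sidh (hid (fo (bl H (ht K')) Y)))).
    + rewrite interchange by bd. rewrite <- (sidh_hcomp (f := fh _ K)) by bd.
      rewrite svunitl, svunitr by bd. easy.
    + f_equal; [repeat has; easy|apply sidh_unitr; bd].
  - rewrite svassoc, !interchange by bd. rewrite E'. cols. f_equal. repeat has. rewrite e. easy.
Qed.

Local Notation US_l := (unit_left T (unit_strict I)).
Local Notation US_r := (unit_right T (unit_strict I)).

Lemma fcomp_unit_strict_l k k' : ht k = hs k' ->
  fcomp US_l k k' = fcomp T (hid i0, k) (hid i0, k').
Proof. intros e. cbn -[tensor]. merge. easy. Qed.
Lemma fcomp_unit_strict_r k k' : ht k = hs k' ->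
  fcomp US_r k k' = fcomp T (k, hid i0) (k', hid i0).
Proof. intros e. cbn -[tensor]. merge. easy. Qed.
Lemma funit_unit_strict_l X : funit US_l X = funit T (i0, X).
Proof. cbn -[tensor]. merge. easy. Qed.
Lemma funit_unit_strict_r X : funit US_r X = funit T (X, i0).
Proof. cbn -[tensor]. merge. easy. Qed.

Lemma is_vst_jj : is_vst US_l (bl H i0) jj_vst.
Proof.
  apply is_vst_intro.
  - intros X; cbn -[tensor]. split; bd.
  - intros k; repeat split; cbn -[tensor jj]; bd.
  - intros u; cbn -[tensor]. rewrite fv_tensor_vid_l by bd. bd.
  - intros k k' e. rewrite fcomp_unit_strict_l by easy. symmetry; now apply jj_hcomp.
  - intros X. rewrite funit_unit_strict_l. cbn -[tensor jj].
    rewrite funit_jj, sidv_unitl by bd. easy.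
  - intros a. cbn -[tensor jj]. exact (nat_jj (H := H) (d := a) i0 eq_refl eq_refl).
Qed.
Lemma is_vst_ii : is_vst US_r (br H i0) ii_vst.
Proof.
  apply is_vst_intro.
  - intros X; cbn -[tensor]. split; bd.
  - intros k; repeat split; cbn -[tensor ii]; bd.
  - intros u; cbn -[tensor]. rewrite fv_tensor_vid_r by bd. bd.
  - intros k k' e. rewrite fcomp_unit_strict_r by easy. symmetry; now apply ii_hcomp.
  - intros X. rewrite funit_unit_strict_r. cbn -[tensor ii].
    rewrite funit_ii, sidv_unitl by bd. easy.
  - intros a. cbn -[tensor ii]. exact (nat_ii (H := H) (s := a) i0 eq_refl eq_refl).
Qed.

(** Its squares are, by conversion, the part of [lunitor] that precedes the component of [la]. *)
Definition eps_l : vst B B :=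
  vst_comp (vst_post (vst_pre (psf_lunit_iso B) (vst_prod (unit_vst I) (vst_id (psf_id B)))) T)
    jj_vst.
Definition eps_r : vst B B :=
  vst_comp (vst_post (vst_pre (psf_runit_iso B) (vst_prod (vst_id (psf_id B)) (unit_vst I))) T)
    ii_vst.
Lemma is_vst_eps_l : is_vst (unit_left T I) (bl H i0) eps_l.
Proof.
  apply (is_vst_comp (G := US_l)); try typeclasses eauto.
  - apply is_vst_post; try typeclasses eauto. apply is_vst_pre; try typeclasses eauto.
    apply is_vst_prod; try typeclasses eauto; [now apply is_vst_unit_vst | apply is_vst_id; bd].
  - apply is_vst_jj.
Qed.
Lemma is_vst_eps_r : is_vst (unit_right T I) (br H i0) eps_r.
Proof.
  apply (is_vst_comp (G := US_r)); try typeclasses eauto.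
  - apply is_vst_post; try typeclasses eauto. apply is_vst_pre; try typeclasses eauto.
    apply is_vst_prod; try typeclasses eauto; [apply is_vst_id; bd | now apply is_vst_unit_vst].
  - apply is_vst_ii.
Qed.
Lemma vto_eps_l X : vto eps_l X = vid (fo (bl H i0) X).
Proof. cbn -[tensor]. rewrite fv_tensor_vid_l by bd. bd. Qed.
Lemma vto_eps_r X : vto eps_r X = vid (fo (bl H X) i0).
Proof. cbn -[tensor]. rewrite fv_tensor_vid_r by bd. bd. Qed.
Lemma vinvertible_eps_l k : vinvertible (vth eps_l k).
Proof. cbn -[tensor jj]. vi. Qed.
Lemma vinvertible_eps_r k : vinvertible (vth eps_r k).
Proof. cbn -[tensor ii]. vi. Qed.
End Unitors.

Section TriangleEquivalences.
Context {B : dcat} {hB : is_double_category B} (H : quasi B) {hH : is_quasi H}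
  (th : ttrans B) {hth : is_associativity H th} (I : psf dunit B) {hI : is_psf I}.
Local Notation T := (tensor H).
Local Notation w := (vinv (funit I tt)).
Local Notation i0 := (fo I tt).
Local Notation i1 := (fh I tt).

(** The unitors for H and those for the tensor product are given separately and tied only by
    equations, so that the equivalences serve both implications, whichever pair is constructed from
    the other. *)
Context (la rho la' rho' : vst B B)
  (hla : is_vst (bl H i0) (psf_id B) la) (hrho : is_vst (br H i0) (psf_id B) rho)
  (hla' : is_vst (unit_left T I) (psf_id B) la') (hrho' : is_vst (unit_right T I) (psf_id B) rho')
  (ola : forall X, vto la' X = vto la X) (orho : forall X, vto rho' X = vto rho X)
  (ela : forall k, vth la' k = lunitor H i0 w la k)
  (erho : forall k, vth rho' k = runitor H i0 w rho k).

Lemma top_w : top w = i1. Proof. rewrite top_vinv by bd. exact (bot_funit (F := I) tt). Qed.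
Lemma bot_w : bot w = hid i0. Proof. bd. Qed.

Lemma triangle_mid_iff : premonoidal_triangle_mid H (centers_of H) i0 th la rho <->
  monoidal_triangle_mid T (Sigma H th) I la' rho'.
Proof.
  pose proof (triangle_mid_l (th := th) bot_w (vinvertible_w (I := I)) hla hrho) as m1.
  pose proof (triangle_mid_r (th := th) bot_w (vinvertible_w (I := I)) hla hrho) as m2.
  rewrite top_w in m1, m2.
  split.
  - intros (o & g1 & g2). split.
    + intros W Y. rewrite fv_tensor_vid_l, fv_tensor_vid_r, ola, orho by bd. apply o.
    + apply (triangle_mid_generators (is_vst_Sigma (th := th)) hla' hrho'); intros;
        rewrite ela, erho; [apply m1, g1|apply m2, g2].
  - intros (o & g). split; [|split].
    + intros W Y. rewrite <- ola, <- orho, <- fv_tensor_vid_l, <- fv_tensor_vid_r by bd. apply o.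
    + intros K Y. apply m1. rewrite <- ela, <- erho. apply g.
    + intros W l. apply m2. rewrite <- ela, <- erho. apply g.
Qed.
Lemma triangle_left_iff : premonoidal_triangle_left H (centers_of H) i0 th la <->
  monoidal_triangle_left T (Sigma H th) I la'.
Proof.
  pose proof (triangle_left_l (th := th) bot_w (vinvertible_w (I := I)) hla) as m1.
  pose proof (triangle_left_r (th := th) bot_w (vinvertible_w (I := I)) hla) as m2.
  rewrite top_w in m1, m2.
  split.
  - intros (o & g1 & g2). split.
    + intros W Y. rewrite fv_tensor_vid_r, !ola by bd. apply o.
    + apply (triangle_left_generators (is_vst_Sigma (th := th)) hla'); intros;
        rewrite !ela; [apply m1, g1|apply m2, g2].
  - intros (o & g). split; [|split].
    + intros W Y. rewrite <- !ola, <- fv_tensor_vid_r by bd. apply o.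
    + intros K Y. apply m1. rewrite <- !ela. apply g.
    + intros W l. apply m2. rewrite <- !ela. apply g.
Qed.
Lemma triangle_right_iff : premonoidal_triangle_right H (centers_of H) i0 th rho <->
  monoidal_triangle_right T (Sigma H th) I rho'.
Proof.
  pose proof (triangle_right_l (th := th) bot_w (vinvertible_w (I := I)) hrho) as m1.
  pose proof (triangle_right_r (th := th) bot_w (vinvertible_w (I := I)) hrho) as m2.
  rewrite top_w in m1, m2.
  split.
  - intros (o & g1 & g2). split.
    + intros W Y. rewrite fv_tensor_vid_l, !orho by bd. apply o.
    + apply (triangle_right_generators (is_vst_Sigma (th := th)) hrho'); intros;
        rewrite !erho; [apply m1, g1|apply m2, g2].
  - intros (o & g). split; [|split].
    + intros W Y. rewrite <- !orho, <- fv_tensor_vid_l by bd. apply o.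
    + intros K Y. apply m1. rewrite <- !erho. apply g.
    + intros W l. apply m2. rewrite <- !erho. apply g.
Qed.
End TriangleEquivalences.

(** * Exchange cells and centrality *)

Section Conjugation.
Context {B : dcat} {hB : is_double_category B} (F : psf B B) {hF : is_psf F}.
Lemma conjv_sidv u : conjv F (sidv u) = sidv (fv F u).
Proof.
  unfold conjv. rewrite lft_sidv, <- svassoc, fs_sidv_vinv, svassoc, vinvr by bd. vun. easy.
Qed.
Lemma conjh_vinv f g f' g' a : hglob (f ;; g) (f' ;; g') a -> ht f = hs g -> ht f' = hs g' ->
  vinvertible a -> conjh F f' g' f g (vinv a) = vinv (conjh F f g f' g' a).
Proof.
  intros (e1 & e2 & _) e e' i. unfold conjh.
  rewrite !vinv_svc, vinv_vinv, fs_vinv, svassoc by bd. easy.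
Qed.
Lemma vinv_exchange (x y a b : sq B) : vinvertible x -> vinvertible y ->
  bot x = top a -> top x = top b -> bot a = bot y -> bot b = top y ->
  x </> a = b </> y <-> vinv x </> b = a </> vinv y.
Proof.
  intros i j e1 e2 e3 e4. split; intros E.
  - apply (@vcancel_l _ _ x); [vi|bd|bd|].
    rewrite !svassoc, E, vinvr, svunitl, <- svassoc, vinvr, svunitr by bd. easy.
  - apply (@vcancel_l _ _ (vinv x)); [vi|bd|bd|].
    rewrite !svassoc, E, vinvl, svunitl, <- svassoc, vinvl, svunitr by bd. easy.
Qed.
End Conjugation.

Section Coincidence.
Context {B : dcat} {hB : is_double_category B} (H : quasi B) {hH : is_quasi H}.
Local Notation C := (centers_of H).

Lemma xcell_vv U u : xcell C Left (inr U) (inr u) = xcell C Right (inr U) (inr u).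
Proof. cbn. now rewrite quv. Qed.

Lemma hglob_qkk K k : hglob (fh (bl H (hs K)) k ;; fh (br H (ht k)) K)
  (fh (br H (hs k)) K ;; fh (bl H (ht K)) k) (qkk H K k).
Proof. exact (proj1 (hpt_h (q_hl hH K) k)). Qed.

(** The boundary rules for [th] presuppose an associativity, whereas the families in the next lemma
    are arbitrary; their boundaries are taken from the hypotheses. *)
Ltac bdstepq ::= first [bdgq | bdq].
Lemma quasi_left_right_coincide : left_right_coincide H.
Proof.
  intros th (h1 & h2 & h3) i X p q.
  assert (a1 : forall Y C, is_vst (psf_comp (br H Y) (br H C)) (br H (bo H Y C)) (th1 th Y C))
    by (intros; apply h1).
  assert (a2 : forall X C, is_vst (psf_comp (bl H X) (br H C)) (psf_comp (br H C) (bl H X)) (th2 th X C))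
    by (intros; apply h3).
  assert (a3 : forall X Y, is_vst (bl H (bo H X Y)) (psf_comp (bl H Y) (bl H X)) (th3 th X Y))
    by (intros; apply h3).
  assert (o2 : forall X Y C, vto (th2 th X C) Y = vto (th1 th Y C) X)
    by (intros; symmetry; apply h1).
  assert (o3 : forall X Y C, vto (th3 th X Y) C = vto (th1 th Y C) X)
    by (intros; symmetry; apply h2).
  clear h1 h2 h3.
  pose proof (fun Y C => vst_top (a1 Y C)) as t1. pose proof (fun Y C => vst_bot (a1 Y C)) as b1.
  pose proof (fun Y C => vst_lft (a1 Y C)) as l1. pose proof (fun Y C => vst_rgt (a1 Y C)) as r1.
  pose proof (fun Y C => vst_top (a2 Y C)) as t2. pose proof (fun Y C => vst_bot (a2 Y C)) as b2.
  pose proof (fun Y C => vst_lft (a2 Y C)) as l2. pose proof (fun Y C => vst_rgt (a2 Y C)) as r2.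
  pose proof (fun Y C => vst_top (a3 Y C)) as t3. pose proof (fun Y C => vst_bot (a3 Y C)) as b3.
  pose proof (fun Y C => vst_lft (a3 Y C)) as l3. pose proof (fun Y C => vst_rgt (a3 Y C)) as r3.
  cbn in *.
  destruct p as [K|U], q as [k|u].
  (* For two 1h-cells the exchange cells of the two versions are inverse to each other; in the
     other cases they are equal. *)
  - destruct i; cbn.
    + rewrite (conjh_vinv (F := br H X) (hglob_qkk K k)) by bd.
      apply vinv_exchange; unfold conjh. 1-2: vi. all: bd.
    + apply vinv_exchange. 1-2: vi. all: bd.
    + rewrite (conjh_vinv (F := bl H X) (hglob_qkk K k)) by bd.
      apply vinv_exchange; unfold conjh. 1-2: vi. all: bd.
  - destruct i; easy.
  - destruct i; easy.
  - destruct i; unfold exchange_axiom; cbn [Es Et fxcell on1]; rewrite !xcell_vv; easy.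
Qed.
End Coincidence.

Ltac bdstepq ::= first [bdgq | bdq | bdth | bdij | bdT | bdSg | bdunit].

Section Associativity.
Context {B : dcat} {hB : is_double_category B} (H : quasi B) {hH : is_quasi H}
  (th : ttrans B) {hth : is_associativity H th}.

Lemma family_associativity : is_ttrans_family (left_ternary H) (right_ternary H) th.
Proof.
  destruct (proj1 hth) as (h1 & h2 & h3).
  exact (conj (fun C => proj1 (h1 C)) (conj (fun Y => proj1 (h2 Y)) (fun X => proj1 (h3 X)))).
Qed.

Lemma associativity_axioms24 : axioms24 H th.
Proof.
  assert (L : forall i X p q, exchange_axiom H (centers_of H) th Left i X p q).
  { intros i X [K|U] [k|u].
    - destruct i; cbn.
      + apply (th_exch12_kk (th := th)).
      + apply (th_exch13_kk (th := th)).
      + apply (th_exch23_kk (th := th)).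
    - destruct i; cbn.
      + apply (th_exch12_ku (th := th)).
      + apply (th_exch13_ku (th := th)).
      + apply (th_exch23_ku (th := th)).
    - destruct i; cbn.
      + apply (th_exch12_uk (th := th)).
      + apply (th_exch13_uk (th := th)).
      + apply (th_exch23_uk (th := th)).
    (* For two 1v-cells both exchange cells are identity squares, so the axiom becomes an equality
       of 1v-cells; it follows from naturality of the 1v-components in the two slots. *)
    - pose proof (th_v1 (th := th)) as v1. pose proof (th_v2 (th := th)) as v2.
      pose proof (th_v3 (th := th)) as v3.
      destruct i; cbn; rewrite ?conjv_sidv, ?vto_th2, ?vto_th3 by bd;
        rewrite <- !sidv_vcomp by bd; f_equal.
      + rewrite fv_vcomp by bd. rewrite vs_fv, <- vassoc, <- v2, vassoc, <- v1, vassoc by bd.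
        rewrite fo_br by bd. easy.
      + rewrite vt_fv, vs_fv, fo_br, <- vassoc, <- v3, vassoc, <- v1, vassoc by bd. easy.
      + rewrite fv_vcomp, vt_fv, <- vassoc, <- v3, vassoc, <- v2, vassoc by bd. easy. }
  intros [|] i X p q; [apply L|].
  apply (quasi_left_right_coincide family_associativity), L.
Qed.
End Associativity.

Section Centrality.
Context {B : dcat} {hB : is_double_category B} (H : quasi B) {hH : is_quasi H}.
Lemma is_purely_central : purely_central H (centers_of H).
Proof.
  split; [apply hH|]. split; [|split; [|split; [|split; [|split; [|split]]]]]; try easy.
  - intros K; split; split; try easy; apply hH.
  - intros K; split; split; try easy; apply hH.
  - intros K k; cbn. apply vinv_spec; vi.
Qed.

(** All 1v-cells are central for a quasi-functor, and [quk] and [qku] respect vertical composition,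
    so they send inverse 1v-cells to inverse squares. *)
Lemma invertible_inversely_central U V : vs V = vt U -> vt V = vs U ->
  U // V = vid (vs U) -> V // U = vid (vt U) -> inversely_central H (centers_of H) U.
Proof.
  intros e1 e2 i1 i2. exists V. repeat (split; [first [easy | split; [apply hH|easy]]|]).
  split; intros k; cbn; (split; [bd|split; [bd|]]).
  - rewrite <- !quk_vcomp by bd. rewrite i1, i2, !quk_vid by bd. split; f_equal; bd.
  - rewrite <- !qku_vcomp by bd. rewrite i1, i2, !qku_vid by bd. split; f_equal; bd.
Qed.

(** Invertibility of a transformation is stated for its squares only. But the sides of a vertically
    invertible square are invertible 1v-cells, and the square at the identity of [X] has [vto al X]
    as its side. *)
Lemma component_inversely_central {F G : psf B B} {hF : is_psf F} {hG : is_psf G} al X :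
  is_vst F G al -> vst_invertible al -> inversely_central H (centers_of H) (vto al X).
Proof.
  intros h i. vst_facts h. destruct (i (hid X)) as [b hb].
  assert (e : lft (vth al (hid X)) = vto al X) by bd.
  rewrite <- e. apply (@invertible_inversely_central _ (lft b)).
  - rewrite <- hs_top, <- hs_bot by bd. now rewrite (proj1 hb).
  - rewrite <- hs_top, <- hs_bot by bd. now rewrite (proj1 (proj2 hb)).
  - now apply vinverse_lft.
  - rewrite (vinverse_lft (vinverse_sym hb)), <- hs_top, (proj1 hb), hs_bot by bd. easy.
Qed.
End Centrality.

Lemma vinv_svcK {B : dcat} {hB : is_double_category B} (a b : sq B) :
  vinvertible a -> top b = top a -> a </> (vinv a </> b) = b.
Proof. intros. rewrite svassoc, vinvr, svunitl by bd. easy. Qed.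

(** * The two implications *)

Section Main.
Context {B : dcat} {hB : is_double_category B} (H : quasi B) {hH : is_quasi H}
  (th : ttrans B) {hth : is_associativity H th} (I : psf dunit B) {hI : is_psf I}.
Local Notation T := (tensor H).
Local Notation i0 := (fo I tt).
Local Notation C := (centers_of H).

Lemma is_premonoidal_assoc : premonoidal_assoc H C th.
Proof.
  split; [|split; [|split; [|split; [|split; [|split]]]]].
  - intros; now apply is_vst_th1.
  - intros; now apply is_vst_th2.
  - intros; now apply is_vst_th3.
  - exact (proj2 hth).
  - intros; now apply (vto_th2 (th := th)).
  - intros; now apply (vto_th3 (th := th)).
  - intros. apply (component_inversely_central X (is_vst_th1 (th := th) Y Z)).
    apply (proj2 hth).
Qed.

Lemma premonoidal_monoidal :
  purely_central_premonoidal H th i0 -> monoidal T (Sigma H th) I.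
Proof.
  intros (_ & la & rho & _ & _ & (h1 & h2 & h3 & h4 & _ & _) & p & m & l & r).
  vst_facts h1. vst_facts h3.
  assert (k1 : is_vst (unit_left T I) (psf_id B) (vst_comp (eps_l H I) la))
    by (apply (is_vst_comp (is_vst_eps_l (H := H) (I := I)) h1)).
  assert (k2 : is_vst (unit_right T I) (psf_id B) (vst_comp (eps_r H I) rho))
    by (apply (is_vst_comp (is_vst_eps_r (H := H) (I := I)) h3)).
  assert (o1 : forall X, vto (vst_comp (eps_l H I) la) X = vto la X).
  { intros X. cbn [vst_comp vto]. rewrite vto_eps_l by bd. bd. }
  assert (o2 : forall X, vto (vst_comp (eps_r H I) rho) X = vto rho X).
  { intros X. cbn [vst_comp vto]. rewrite vto_eps_r by bd. bd. }
  exists (vst_comp (eps_l H I) la), (vst_comp (eps_r H I) rho).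
  split; [typeclasses eauto|]. split; [easy|]. split; [now apply is_vst_Sigma|].
  split; [intros [[K k] f]; now apply vinvertible_Sigma|].
  split; [easy|]. split.
  { intros k. apply vinvertible_svc; [|now apply vinvertible_eps_l|exact (h2 k)].
    rewrite (vst_bot (is_vst_eps_l (H := H) (I := I))) by bd. bd. }
  split; [easy|]. split.
  { intros k. apply vinvertible_svc; [|now apply vinvertible_eps_r|exact (h4 k)].
    rewrite (vst_bot (is_vst_eps_r (H := H) (I := I))) by bd. bd. }
  split; [now apply pentagon_iff|].
  split; [eapply triangle_mid_iff; eauto; easy|].
  split; [eapply triangle_left_iff; eauto; easy|].
  eapply triangle_right_iff; eauto; easy.
Qed.

Lemma monoidal_premonoidal :
  monoidal T (Sigma H th) I -> purely_central_premonoidal H th i0.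
Proof.
  intros (la & rho & _ & _ & _ & _ & h1 & h2 & h3 & h4 & p & m & l & r).
  vst_facts h1. vst_facts h3.
  pose proof (is_vst_eps_l (H := H) (I := I)) as hl.
  pose proof (is_vst_eps_r (H := H) (I := I)) as hr.
  vst_facts hl. vst_facts hr.
  pose proof (vto_eps_l (H := H) I) as ol. pose proof (vto_eps_r (H := H) I) as or.
  assert (il : forall k, vinvertible (vth (eps_l H I) k)) by (intros; now apply vinvertible_eps_l).
  assert (ir : forall k, vinvertible (vth (eps_r H I) k)) by (intros; now apply vinvertible_eps_r).
  set (la' := vst_comp (vst_vinv (unit_left T I) (eps_l H I)) la).
  set (rho' := vst_comp (vst_vinv (unit_right T I) (eps_r H I)) rho).
  assert (k1 : is_vst (bl H i0) (psf_id B) la').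
  { apply (is_vst_comp (G := unit_left T I)); try typeclasses eauto; [|exact h1].
    now apply (is_vst_vinv hl). }
  assert (k2 : is_vst (br H i0) (psf_id B) rho').
  { apply (is_vst_comp (G := unit_right T I)); try typeclasses eauto; [|exact h3].
    now apply (is_vst_vinv hr). }
  assert (o1 : forall X, vto la X = vto la' X) by (intros; cbn -[tensor]; bd).
  assert (o2 : forall X, vto rho X = vto rho' X) by (intros; cbn -[tensor]; bd).
  (* The given unitor is recovered from [la']: the part of [lunitor] before [la'] is the component
     of [eps_l], which cancels the inverse contained in [la']. *)
  assert (e1 : forall k, vth la k = lunitor H i0 (vinv (funit I tt)) la' k).
  { intros k. transitivity (vth (eps_l H I) k </> (vinv (vth (eps_l H I) k) </> vth la k));
      [|reflexivity].
    symmetry. apply vinv_svcK; [apply il|congruence]. }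
  assert (e2 : forall k, vth rho k = runitor H i0 (vinv (funit I tt)) rho' k).
  { intros k. transitivity (vth (eps_r H I) k </> (vinv (vth (eps_r H I) k) </> vth rho k));
      [|reflexivity].
    symmetry. apply vinv_svcK; [apply ir|congruence]. }
  assert (i1 : vst_invertible la').
  { intros k. apply vinvertible_svc; [cbn -[tensor eps_l]; rewrite bot_vinv by apply il; congruence|apply vinvertible_vinv, il|exact (h2 k)]. }
  assert (i2 : vst_invertible rho').
  { intros k. apply vinvertible_svc; [cbn -[tensor eps_r]; rewrite bot_vinv by apply ir; congruence|apply vinvertible_vinv, ir|exact (h4 k)]. }
  split; [now apply is_purely_central|].
  exists la', rho'.
  split; [apply hH|]. split; [apply is_premonoidal_assoc|]. split.
  { repeat (split; [easy|]).
    split; intros X; [apply (component_inversely_central X k1 i1)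
                     |apply (component_inversely_central X k2 i2)]. }
  split; [now apply pentagon_iff|].
  split; [eapply triangle_mid_iff; eauto; easy|].
  split; [eapply triangle_left_iff; eauto; easy|].
  eapply triangle_right_iff; eauto; easy.
Qed.
End Main.

Theorem theorem7p10 (B : dcat) (hB : is_double_category B)
    (H : quasi B) (hH : is_quasi H)
    (theta : ttrans B) (htheta : is_associativity H theta) :
  (axioms24 H theta /\ left_right_coincide H) /\
  (forall I : psf dunit B, is_psf I ->
     (purely_central_premonoidal H theta (fo I tt) <->
      monoidal (tensor H) (Sigma H theta) I)).
Proof.
  split; [split; [now apply associativity_axioms24 | now apply quasi_left_right_coincide]|].
  intros I hI. split; [now apply premonoidal_monoidal | now apply monoidal_premonoidal].
Qed.
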